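(* For a prime $p$ and an integer $n\ge 1$ let $\mathbb{F}=GF(p^n)$ be the field with $p^n$ elements and $R = \mathcal{M}_2(\mathbb{F})$ the ring of $2\times 2$ matrices over $\mathbb{F}$. Then for every (fixed) prime $p$ the number $v(R)$ of subrings of $R$ generated by one element and the number $v_1(R)$ of unital subrings of $R$ generated by one element satisfy $$\lim_{n \to \infty}\frac{v(R)}{\tfrac12\sigma(n)|\mathbb{F}|^2} = \lim_{n \to \infty}\frac{v_1(R)}{\tfrac12\sigma(n)|\mathbb{F}|^2} = 1,$$ and thus $$\limsup_{n \to \infty}\frac{v(R)}{p^{2n}\, n \log \log n} = \limsup_{n \to \infty}\frac{v_1(R)}{p^{2n}\, n \log \log n} = \tfrac12 e^{\gamma},$$ where $\gamma \approx 0.5772$ is Euler's gamma constant.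
   Context: $\sigma(n)=\sum_{d\mid n} d$ is the sum of the positive divisors of $n$. For a ring $R$ and $a\in R$, the subring generated by $a$ is $\langle a \rangle = \{q(a) \mid q \in \mathbb{Z}[x],\ q(0)=0\}$ (not necessarily containing $1$), and the unital subring generated by $a$ is $\langle a\rangle_1=\{q(a)\mid q\in\mathbb{Z}[x]\}$. Then $v(R)=|\{\langle a\rangle\mid a\in R\}|$ and $v_1(R)=|\{\langle a\rangle_1\mid a\in R\}|$. *)

(* Defs.v *)
From mathcomp Require Import all_boot all_order all_algebra.
From mathcomp Require Import all_classical all_reals all_analysis.

Set Implicit Arguments.
Unset Strict Implicit.
Unset Printing Implicit Defensive.

Import Order.TTheory GRing.Theory Num.Theory.
Import numFieldNormedType.Exports.
Local Open Scope ring_scope.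

Definition sigma (n : nat) : nat := (\sum_(d <- divisors n) d)%N.

(* Integer coefficients are central, so [horner] is the usual evaluation even
   when the ring is not commutative. *)
Definition eval_int (A : nzRingType) (q : {poly int}) (a : A) : A :=
  (map_poly intr q).[a].

Definition subring_gen (A : finNzRingType) (a : A) : {set A} :=
  [set x : A | `[< exists2 q : {poly int}, q.[0] = 0 & eval_int q a = x >]].

Definition unital_subring_gen (A : finNzRingType) (a : A) : {set A} :=
  [set x : A | `[< exists q : {poly int}, eval_int q a = x >]].

Definition v (A : finNzRingType) : nat :=
  #|[set subring_gen a | a : A]|.

Definition v1 (A : finNzRingType) : nat :=
  #|[set unital_subring_gen a | a : A]|.

Definition euler_gamma (R : realType) : R :=
  limn (fun n : nat => (\sum_(1 <= k < n.+1) k%:R^-1) - ln (n%:R : R)).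

(* Main.v *)
(* The unital subring <a>_1 of M_2(F), |F| = q = p^n, is classified by the
   eigenvalues of a.  If they are distinct and in F, then a = l e + m (1 - e) for
   a rank one idempotent e, and <a>_1 is the image of the subring of F x F
   generated by (l, m).  That subring is either the graph of x |-> x^(p^i) on
   GF(p^d), with d | n and i < d (sigma(n) of them), or a product of two subfields
   (d(n)^2 of them, where d(n) is the number of divisors).  There are q^2 + q
   idempotents e, and swapping e and 1 - e counts each subring twice, whence the
   main term sigma(n) q^2 / 2.  The graphs with i > 0 give pairwise distinct
   subrings up to this swap.  A double eigenvalue, irreducible characteristic
   polynomials, and non-invertible a (for v) contribute O(q^2 d(2n)), and d(n)^2 =
   o(n).

   The limsup is then Gronwall's theorem on sigma.  Let B(N) be the sum of
   - ln (1 - 1/p) over the primes p <= N.  Mertens' first theorem and Abel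
   summation give B(N) - ln ln N -> c.  To identify c, compare the sums over n of
   n^(-delta) weighted by the increments of B(N) and of the harmonic number
   H(log2 N): the former is ln zeta(1 + delta) + O(delta), the latter is
   - ln (1 - 2^-delta), and their difference tends to ln ln 2 as delta -> 0.  As
   B(N) - H(log2 N) -> c - gamma + ln ln 2, it follows that c = gamma. *)

Require Import Defs.
From mathcomp Require Import all_boot all_order all_algebra.
From mathcomp Require Import all_fingroup all_solvable all_field.
From mathcomp Require Import all_classical all_reals all_analysis.
From mathcomp Require Import zify ring lra.

Set Implicit Arguments.
Unset Strict Implicit.
Unset Printing Implicit Defensive.

Import Order.TTheory GRing.Theory Num.Theory.
Import numFieldNormedType.Exports.
Local Open Scope ring_scope.

(** * Sums over divisors *)

(** The classification is never stated as a bijection. From above, each generator is sent to data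
    that determine its subring, and it is enough that the data take few values; from below, one
    explicit family of subrings suffices. That family consists of invertible matrices: some positive
    power of an invertible [a] is 1, hence [<a>] and [<a>_1] coincide, and the same family serves
    [v] and [v1]. It uses only the idempotents with nonzero upper right entry, [q (q - 1)] of them,
    which costs a lower order term.

    Generated subrings are reached through integer polynomials only, so enough of these must be
    produced. A polynomial over [F] lifts to integer coefficients once Frobenius fixes its
    coefficients; this applies to minimal polynomials over the prime field. For an irreducible
    characteristic polynomial no quadratic extension is built: the field with [q^2] elements is the
    span of 1 and [a] inside the matrix ring, and the theory of finite fields is developed for
    subsets of a noncommutative ring. *)

Lemma divisors_coprimeM (a b : nat) : (0 < a)%N -> (0 < b)%N -> coprime a b ->
  perm_eq (divisors (a * b)) [seq (x * y)%N | x <- divisors a, y <- divisors b].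
Proof.
move=> a0 b0 ab; have ab0 : (0 < a * b)%N by rewrite muln_gt0 a0.
apply: uniq_perm.
- exact: divisors_uniq.
- apply: allpairs_uniq; try exact: divisors_uniq.
  move=> [x y] [x' y'] /allpairsP[[u w] /= [Hu Hw [-> ->]]].
  move=> /allpairsP[[u' w'] /= [Hu' Hw' [-> ->]]] /=.
  rewrite -!dvdn_divisors // in Hu Hw Hu' Hw'.
  move=> e.
  have key s t : (s %| a)%N -> (t %| b)%N -> gcdn (s * t) a = s.
    move=> sa tb; rewrite gcdnC Gauss_gcdl; first by apply/gcdn_idPr.
    exact: coprime_dvdr tb ab.
  have key2 s t : (s %| a)%N -> (t %| b)%N -> gcdn (s * t) b = t.
    move=> sa tb; rewrite gcdnC Gauss_gcdr; first by apply/gcdn_idPr.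
    rewrite coprime_sym; exact: coprime_dvdl sa ab.
  congr (_, _); first by rewrite -(key u w) // e key.
  by rewrite -(key2 u w) // e key2.
move=> d; apply/idP/allpairsP.
  rewrite -dvdn_divisors // => dab.
  exists (gcdn d a, gcdn d b); split => /=; try by rewrite -dvdn_divisors // dvdn_gcdr.
  apply/eqP; rewrite eqn_dvd; apply/andP; split.
    by rewrite muln_gcdl !muln_gcdr !dvdn_gcd dab (dvdn_mulr d (dvdnn d)) (dvdn_mulr b (dvdnn d)) (dvdn_mull a (dvdnn d)).
  rewrite Gauss_dvd ?dvdn_gcdl //.
  exact: coprime_dvdl (dvdn_gcdr _ _) (coprime_dvdr (dvdn_gcdr _ _) ab).
move=> [[x y] /= [Hx Hy ->]].
rewrite -dvdn_divisors // in Hx; rewrite -dvdn_divisors // in Hy.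
by rewrite -dvdn_divisors // dvdn_mul.
Qed.

(** Positivity of the factors matters: weights such as [zterm] take the value 1 at 0, since
    [ln 0 = 0], and the identity fails there. *)
Definition completely_mult (R : nzRingType) (g : nat -> R) :=
  g 1%N = 1 /\ forall a b, (0 < a)%N -> (0 < b)%N -> g (a * b)%N = g a * g b.

Lemma completely_multX (R : nzRingType) (g : nat -> R) p k : completely_mult g -> (0 < p)%N ->
  g (p ^ k)%N = g p ^+ k.
Proof.
move=> [g1 gM] p0; elim: k => [|k IH]; first by rewrite expn0 expr0.
by rewrite expnS exprS gM ?IH // expn_gt0 p0.
Qed.

Lemma sum_divisors_coprime (R : comNzRingType) (g : nat -> R) (a b : nat) :
  completely_mult g -> (0 < a)%N -> (0 < b)%N -> coprime a b ->
  \sum_(d <- divisors (a * b)) g d =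
  (\sum_(d <- divisors a) g d) * (\sum_(d <- divisors b) g d).
Proof.
move=> [g1 gM] a0 b0 ab; rewrite (perm_big _ (divisors_coprimeM a0 b0 ab)) /=.
rewrite big_allpairs_dep mulr_suml; apply: eq_big_seq => x xa.
rewrite mulr_sumr; apply: eq_big_seq => y yb.
rewrite -!dvdn_divisors // in xa yb.
by rewrite gM // (dvdn_gt0 _ xa, dvdn_gt0 _ yb).
Qed.

Lemma sum_divisorsX (R : comNzRingType) (g : nat -> R) (p k : nat) :
  completely_mult g -> prime p ->
  \sum_(d <- divisors (p ^ k)) g d = \sum_(i < k.+1) g p ^+ i.
Proof.
move=> gM pp; have p0 := prime_gt0 pp.
have pe : perm_eq (divisors (p ^ k)) [seq (p ^ i)%N | i <- iota 0 k.+1].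
  apply: uniq_perm; first exact: divisors_uniq.
    rewrite map_inj_uniq ?iota_uniq // => i j /eqP.
    by rewrite eqn_exp2l ?prime_gt1 // => /eqP.
  move=> d; rewrite -dvdn_divisors ?expn_gt0 ?p0 //.
  apply/(dvdn_pfactor _ _ pp)/mapP => [[m mk ->]|[m]].
    by exists m; rewrite // mem_iota.
  by rewrite mem_iota => mk ->; exists m.
rewrite (perm_big _ pe) big_map -[iota 0 k.+1]/(index_iota 0 k.+1) big_mkord.
by apply: eq_bigr => i _; rewrite completely_multX.
Qed.

(** The full power of the least prime divisor is split off, so that the cofactor is coprime to it
    and multiplicative functions factor. *)
Lemma pfactor_ind (P : nat -> Prop) :
  P 1%N ->
  (forall p k m, prime p -> (0 < k)%N -> (0 < m)%N -> coprime p m ->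
     P m -> P (p ^ k * m)%N) ->
  forall n, (0 < n)%N -> P n.
Proof.
move=> P1 PM n; elim/ltn_ind: n => n IH n0.
have [->//|n1] := eqVneq n 1%N.
have {}n1 : (1 < n)%N by lia.
have pp := pdiv_prime n1; set p := pdiv n in pp *.
have [k [m pm e]] : exists k, exists2 m, ~~ (p %| m)%N & n = (m * p ^ k)%N.
  have [m pm e] := pfactor_coprime pp n0.
  by exists (logn p n), m => //; rewrite -prime_coprime.
have m0 : (0 < m)%N by move: n0; rewrite e muln_gt0 => /andP[].
have k0 : (0 < k)%N.
  by case: k e => // e; move: pm; rewrite -[m]muln1 -(expn0 p) -e pdiv_dvd.
have pcm : coprime p m by rewrite prime_coprime.
rewrite e mulnC; apply: PM => //; apply: IH => //.
rewrite e ltn_Pmulr // -(exp1n k) ltn_exp2r // prime_gt1 //.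
Qed.

Lemma primesXM p k m : prime p -> (0 < k)%N -> (0 < m)%N -> coprime p m ->
  perm_eq (primes (p ^ k * m)) (p :: primes m).
Proof.
move=> pp k0 m0 pm; apply: uniq_perm.
- exact: primes_uniq.
- rewrite /= primes_uniq andbT mem_primes pp m0 /= -prime_coprime //.
move=> r; rewrite (primesM _ (_ : 0 < p ^ k)%N m0) ?expn_gt0 ?prime_gt0 //.
by rewrite primesX // (primes_prime pp) !inE.
Qed.

Lemma sum_divisorsE (R : comNzRingType) (g : nat -> R) (n : nat) :
  completely_mult g -> (0 < n)%N ->
  \sum_(d <- divisors n) g d =
  \prod_(p <- primes n) \sum_(i < (logn p n).+1) g p ^+ i.
Proof.
move=> gM; move: n; apply: pfactor_ind => [|p k m pp k0 m0 pm IH].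
  by rewrite (_ : divisors 1 = [:: 1%N]) // big_seq1 big_nil; case: gM.
have pk0 : (0 < p ^ k)%N by rewrite expn_gt0 prime_gt0.
  rewrite (sum_divisors_coprime gM pk0 m0 (coprimeXl k pm)).
  rewrite (sum_divisorsX _ gM pp) IH.
rewrite (perm_big _ (primesXM pp k0 m0 pm)) big_cons.
congr (_ * _).
  by rewrite lognM // pfactorK // (logn_coprime pm) addn0.
apply: eq_big_seq => r rm; rewrite lognM //.
rewrite lognX (_ : logn r p = 0%N) ?muln0 // logn_prime //.
case: eqP => // rp; move: rm; rewrite rp mem_primes => /and3P[_ _].
by rewrite -[(p %| m)%N]negbK -prime_coprime ?pm.
Qed.

Definition ndiv (n : nat) := size (divisors n).

Lemma ndivE n : (ndiv n)%:Z = \sum_(d <- divisors n) (1 : int).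
Proof. by rewrite big_const_seq count_predT iter_addr_0 natz. Qed.

Lemma completely_mult1 (R : nzRingType) : completely_mult (fun=> 1 : R).
Proof. by split=> // *; rewrite mulr1. Qed.

Lemma ndiv_coprime a b : (0 < a)%N -> (0 < b)%N -> coprime a b ->
  ndiv (a * b) = (ndiv a * ndiv b)%N.
Proof.
move=> a0 b0 ab; apply/eqP; rewrite -eqz_nat ndivE.
by rewrite (sum_divisors_coprime (completely_mult1 _)) // -!ndivE.
Qed.

Lemma ndivX p k : prime p -> ndiv (p ^ k) = k.+1.
Proof.
move=> pp; apply/eqP; rewrite -eqz_nat ndivE.
rewrite (sum_divisorsX _ (completely_mult1 _)) // (eq_bigr (fun=> 1)); last by move=> *; rewrite expr1n.
by rewrite sumr_const card_ord natz.
Qed.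

(* The primes below 8 each cost a factor 8; the others cost nothing as
   [(k+1)^3 <= 8^k]. *)
Lemma ndiv_cube n : (0 < n)%N -> (ndiv n ^ 3 <= 8 ^ 8 * n)%N.
Proof.
move=> n0.
suff H : (ndiv n ^ 3 <= 8 ^ (count (fun p => p < 8)%N (primes n)) * n)%N.
  apply: leq_trans H _; rewrite leq_mul2r; apply/orP; right.
  rewrite leq_exp2l //.
  have -> : 8%N = size (iota 0 8) by [].
  rewrite -size_filter; apply: uniq_leq_size; first by rewrite filter_uniq // primes_uniq.
  by move=> p; rewrite mem_filter mem_iota => /andP[].
move: n n0; apply: pfactor_ind => [|p k m pp k0 m0 pm IH].
  by [].
have P := seq.permP (primesXM pp k0 m0 pm).
have pk0 : (0 < p ^ k)%N by rewrite expn_gt0 prime_gt0.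
rewrite P ndiv_coprime ?coprimeXl // ndivX // expnMn expnD /=.
rewrite [leqRHS](_ : _ = 8 ^ (p < 8) * p ^ k * (8 ^ (count (fun p => p < 8)%N (primes m)) * m))%N; last ring.
apply: leq_mul => //.
have k2 : (k.+1 <= 2 ^ k)%N by rewrite ltn_expl.
have [p8|p8] := ltnP p 8.
  rewrite expn1; apply: (@leq_trans (8 * 2 ^ k)); last by rewrite leq_mul2l leq_exp2r ?prime_gt1.
  clear -k; case: k => [|[|[|k]]] //.
  elim: k => [|k IH] //.
  (* From exponent 3 on, where the bound is the equality [4 ^ 3 = 8 * 2 ^ 3], one more step at most
     doubles the cube because [(5/4)^3 < 2]. *)
  have H : (k.+1.+4 ^ 3 <= 2 * k.+4 ^ 3)%N by rewrite !expnS expn0; lia.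
  by apply: leq_trans H _; rewrite (expnS 2 k.+3) mulnCA leq_mul2l.
rewrite expn0 mul1n; apply: (@leq_trans (8 ^ k)); last by rewrite leq_exp2r.
by rewrite (_ : 8 = 2 ^ 3)%N // -expnM mulnC expnM leq_exp2r.
Qed.

(** * Subrings generated by one element *)

Section EvalInt.
Variable A : nzRingType.
Implicit Types (a b : A) (q r : {poly int}).

Fact commr_intr a : commr_rmorph (intr : int -> A) a.
Proof. by move=> z; exact: commr_int. Qed.

Lemma eval_intE a q : eval_int q a = horner_morph (commr_intr a) q.
Proof. by []. Qed.

Lemma eval_intD a q r : eval_int (q + r) a = eval_int q a + eval_int r a.
Proof. by rewrite !eval_intE rmorphD. Qed.

Lemma eval_intB a q r : eval_int (q - r) a = eval_int q a - eval_int r a.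
Proof. by rewrite !eval_intE rmorphB. Qed.

Lemma eval_intM a q r : eval_int (q * r) a = eval_int q a * eval_int r a.
Proof. by rewrite !eval_intE rmorphM. Qed.

Lemma eval_intXn a q k : eval_int (q ^+ k) a = eval_int q a ^+ k.
Proof. by rewrite !eval_intE rmorphXn. Qed.

Lemma eval_int1 a : eval_int 1 a = 1.
Proof. by rewrite eval_intE rmorph1. Qed.

Lemma eval_int0 a : eval_int 0 a = 0.
Proof. by rewrite eval_intE rmorph0. Qed.

Lemma eval_intX a : eval_int 'X a = a.
Proof. by rewrite /eval_int map_polyX hornerX. Qed.

Lemma eval_intC a (c : int) : eval_int c%:P a = c%:~R.
Proof. by rewrite /eval_int map_polyC hornerC. Qed.

Lemma eval_int_at0 q : eval_int q (0 : A) = (q.[0])%:~R.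
Proof. elim/poly_ind: q => [|q c _]; first by rewrite eval_int0 horner0.
by rewrite eval_intD eval_intM eval_intX eval_intC mulr0 hornerD hornerM hornerX hornerC mulr0 !add0r. Qed.

Lemma eval_int_comp a q r : eval_int (q \Po r) a = eval_int q (eval_int r a).
Proof.
elim/poly_ind: q => [|q c IH]; first by rewrite comp_poly0 !eval_int0.
by rewrite comp_polyD comp_polyM comp_polyX comp_polyC !eval_intD !eval_intM IH
  !eval_intC eval_intX.
Qed.

End EvalInt.

Lemma eval_int_rmorph (A B : nzRingType) (f : {rmorphism A -> B}) q a :
  f (eval_int q a) = eval_int q (f a).
Proof.
elim/poly_ind: q => [|q c IH]; first by rewrite !eval_int0 rmorph0.
by rewrite !eval_intD !eval_intM rmorphD rmorphM IH !eval_intC !eval_intX rmorph_int.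
Qed.

Section Generated.
Variable A : finNzRingType.
Implicit Types (a b x : A).

Lemma unital_subring_genP a x :
  reflect (exists q, eval_int q a = x) (x \in unital_subring_gen a).
Proof. by rewrite inE; exact: asboolP. Qed.

Lemma subring_genP a x :
  reflect (exists2 q : {poly int}, q.[0] = 0 & eval_int q a = x) (x \in subring_gen a).
Proof. by rewrite inE; exact: asboolP. Qed.

Lemma unital_subring_gen_sub a b : b \in unital_subring_gen a ->
  unital_subring_gen b \subset unital_subring_gen a.
Proof.
move=> /unital_subring_genP[r <-]; apply/fintype.subsetP => x /unital_subring_genP[q <-].
by apply/unital_subring_genP; exists (q \Po r); rewrite eval_int_comp.
Qed.

Lemma subring_gen_sub a b : b \in subring_gen a -> subring_gen b \subset subring_gen a.
Proof.
move=> /subring_genP[r r0 <-]; apply/fintype.subsetP => x /subring_genP[q q0 <-].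
apply/subring_genP; exists (q \Po r); last by rewrite eval_int_comp.
by rewrite horner_comp r0.
Qed.

Lemma unital_subring_gen_eq a b : a \in unital_subring_gen b -> b \in unital_subring_gen a ->
  unital_subring_gen a = unital_subring_gen b.
Proof. by move=> ab ba; apply/eqP; rewrite finset.eqEsubset !unital_subring_gen_sub. Qed.

Lemma subring_gen_eq a b : a \in subring_gen b -> b \in subring_gen a ->
  subring_gen a = subring_gen b.
Proof. by move=> ab ba; apply/eqP; rewrite finset.eqEsubset !subring_gen_sub. Qed.

Lemma mem_unital_subring_gen a : a \in unital_subring_gen a.
Proof. by apply/unital_subring_genP; exists 'X; rewrite eval_intX. Qed.

(** Multiplying a polynomial by ['X^k] kills its constant term and leaves its value at [a]
    unchanged. *)
Lemma subring_gen_unital a k : (0 < k)%N -> a ^+ k = 1 ->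
  subring_gen a = unital_subring_gen a.
Proof.
move=> k0 ak; apply/setP => x; apply/subring_genP/unital_subring_genP => [[q _ <-]|[q <-]].
  by exists q.
exists (q * 'X^k); first by rewrite hornerM hornerXn expr0n gtn_eqF // mulr0.
by rewrite eval_intM eval_intXn eval_intX ak mulr1.
Qed.

End Generated.

(** * Counting images through invariants and fibers *)

Section Counting.
Variables (T D : finType) (U : finType).

(** The data [g a] must determine [f a], but [f a] may be compatible with several data. The map [h]
    sends a datum to the image of some generator that carries it. *)
Lemma card_imset_data (P : {set T}) (f : T -> U) (g : T -> D) (K : {set D}) :
  (forall a, a \in P -> g a \in K) ->
  (forall a b, a \in P -> b \in P -> g a = g b -> f a = f b) ->
  (#|f @: P| <= #|K|)%N.
Proof.
move=> gK gf; have [->|[a0 a0P]] := set_0Vmem P; first by rewrite imset0 cards0.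
pose h d := if [pick a in P | g a == d] is Some a then f a else f a0.
apply: leq_trans (leq_imset_card h K); apply: subset_leq_card.
apply/fintype.subsetP => _ /imsetP[a aP ->]; apply/imsetP; exists (g a); first exact: gK.
rewrite /h; case: pickP => [b /andP[bP /eqP gb]|/(_ a)]; first exact: gf.
by rewrite aP eqxx.
Qed.

Lemma card_fibers (P : {set T}) (f : T -> U) :
  #|P| = (\sum_(y in f @: P) #|[set x in P | f x == y]|)%N.
Proof.
rewrite -sum1_card (partition_big_imset f) /=; apply: eq_bigr => y _.
by rewrite -sum1_card; apply: eq_bigl => x; rewrite inE.
Qed.

(** Each nonempty fiber of [f] contains some [x] together with [iota x], hence at least two
    elements. *)
Lemma card_imset_involution (P : {set T}) (f : T -> U) (iota : T -> T) :
  (forall x, x \in P -> [/\ iota x \in P, f (iota x) = f x & iota x != x]) ->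
  (2 * #|f @: P| <= #|P|)%N.
Proof.
move=> H; rewrite (card_fibers P f) mulnC -sum_nat_const; apply: leq_sum => _ /imsetP[x xP ->].
have [ixP fx ne] := H x xP.
have -> : 2%N = #|[set x; iota x]| by rewrite cards2 eq_sym ne.
apply: subset_leq_card; apply/fintype.subsetP => y; rewrite !inE => /orP[]/eqP->.
  by rewrite xP eqxx.
by rewrite ixP fx eqxx.
Qed.

(** On a fiber, [h] is injective with values among [h y] and [k (h y)]. In the application [h] reads
    off an idempotent and [k] is [e |-> 1 - e]. *)
Lemma card_imset_fiber2 (P : {set T}) (f : T -> U) (h : T -> D) (k : D -> D):
  (forall x y, x \in P -> y \in P -> f x = f y -> h x = h y \/ h x = k (h y)) ->
  (forall x y, x \in P -> y \in P -> f x = f y -> h x = h y -> x = y) ->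
  (#|P| <= 2 * #|f @: P|)%N.
Proof.
move=> H1 H2; rewrite (card_fibers P f) mulnC -sum_nat_const; apply: leq_sum => _ /imsetP[y yP ->].
apply: leq_trans (_ : #|[set h y; k (h y)]| <= 2)%N; last by rewrite cards2; case: (_ != _).
rewrite -(card_in_imset (f := h)).
  apply: subset_leq_card; apply/fintype.subsetP => _ /imsetP[x + ->].
  rewrite inE => /andP[xP /eqP fx]; rewrite !inE.
  by case: (H1 x y xP yP fx) => ->; rewrite eqxx ?orbT.
move=> x z; rewrite !inE => /andP[xP /eqP fx] /andP[zP /eqP fz]; apply: H2 => //.
by rewrite fx fz.
Qed.

End Counting.

(** * Finite fields as subsets of a noncommutative ring *)

Section FieldLike.
Variables (A : finUnitRingType) (p : nat).
Hypothesis (pp : prime p) (charA : p \in [pchar A]).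
Implicit Types (S E : {set A}) (x : A).

Definition unital_closed S :=
  [/\ 0 \in S, 1 \in S, {in S &, forall x y, x - y \in S} & {in S &, forall x y, x * y \in S}].

(** Working with subsets lets the field with [q^2] elements spanned by 1 and a matrix share its
    lemmas with [F] itself. *)
Definition field_like E :=
  [/\ unital_closed E, {in E &, forall x y, x * y = y * x}
    & {in E, forall x, x != 0 -> x \is a GRing.unit}].

Lemma unital_closed_gen a : unital_closed (unital_subring_gen a).
Proof.
split.
- by apply/unital_subring_genP; exists 0; rewrite eval_int0.
- by apply/unital_subring_genP; exists 1; rewrite eval_int1.
- move=> x y /unital_subring_genP[q <-] /unital_subring_genP[r <-].
  by apply/unital_subring_genP; exists (q - r); rewrite eval_intB.
- move=> x y /unital_subring_genP[q <-] /unital_subring_genP[r <-].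
  by apply/unital_subring_genP; exists (q * r); rewrite eval_intM.
Qed.

Lemma unital_closed_int S (z : int) : unital_closed S -> z%:~R \in S.
Proof.
move=> [S0 S1 SB _].
have SD x y : x \in S -> y \in S -> x + y \in S.
  by move=> xS yS; rewrite -[y]opprK -[- y]sub0r SB // SB.
have Sn (n : nat) : n%:R \in S.
  by elim: n => [|n IH] //; rewrite mulrS SD.
case: z => n; first exact: Sn.
by rewrite NegzE mulrNz -[- _]sub0r SB // -pmulrn Sn.
Qed.

Lemma unital_subring_gen_min S a : unital_closed S -> a \in S ->
  unital_subring_gen a \subset S.
Proof.
move=> cS aS; apply/fintype.subsetP => _ /unital_subring_genP[q <-].
have [S0 S1 SB SM] := cS.
elim/poly_ind: q => [|q c IH]; first by rewrite eval_int0.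
rewrite eval_intD eval_intM eval_intX eval_intC.
rewrite -[_%:~R]opprK -mulrNz SB ?SM //.
exact: unital_closed_int.
Qed.

(** Lagrange's theorem in the unit group: the nonzero elements of [S] form a subgroup of order
    [#|S| - 1]. *)
Lemma expr_card S x : unital_closed S -> {in S, forall x, x != 0 -> x \is a GRing.unit} ->
  x \in S -> x ^+ #|S| = x.
Proof.
move=> [S0 S1 SB SM] SU xS.
have cS : (0 < #|S|)%N by apply/card_gt0P; exists 0.
have [->|x0] := eqVneq x 0; first by rewrite expr0n gtn_eqF.
have ux := SU x xS x0.
pose G := [set u : {unit A} | val u \in S].
have gG : group_set G.
  by apply/group_setP; split=> [|u w]; rewrite ?inE //=; exact: SM.
have cG : #|G|.+1 = #|S|.
  rewrite (cardsD1 0 S) S0 add1n; congr _.+1.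
  rewrite -(card_imset _ val_inj); apply: eq_card => y.
  apply/imsetP/idP => [[u uG ->]|].
    rewrite !inE in uG *; rewrite uG andbT.
    by apply: contraTneq (valP u) => ->; rewrite unitr0.
  rewrite !inE => /andP[y0 yS]; exists (FinRing.unit _ (SU y yS y0)) => //.
  by rewrite inE.
have uG : FinRing.unit A ux \in Group gG by rewrite inE.
have := expg_cardG uG; move/(congr1 val); rewrite FinRing.val_unitX /= => e.
by rewrite -cG exprS e mulr1.
Qed.

(** Elements of [E] commute and their nonzero differences are units. This makes the degree of
    [X^s - X] bound its number of roots although [A] may be noncommutative. *)
Lemma card_roots_le E s : field_like E -> (1 < s)%N ->
  (#|[set x in E | x ^+ s == x]| <= s)%N.
Proof.
move=> [[E0 E1 EB EM] EC EU] s1; rewrite cardE; set rs := enum _.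
have rsE x : x \in rs -> x \in E /\ x ^+ s = x.
  by rewrite mem_enum inE => /andP[-> /eqP].
have szp : size ('X^s - 'X : {poly A}) = s.+1.
  by rewrite size_polyDl size_polyXn // size_polyN size_polyX.
rewrite -ltnS -szp; apply: max_ring_poly_roots.
- by rewrite -size_poly_eq0 szp.
- apply/allP => x /rsE[_ e].
  by rewrite rootE hornerD hornerN hornerXn hornerX e subrr.
have : uniq rs by exact: enum_uniq.
elim: rs rsE => //= x rs IH rsE /andP[xrs urs]; apply/andP; split; last first.
  by apply: IH => // y yrs; apply: rsE; rewrite in_cons yrs orbT.
apply/allP => y yrs; have [xE _] := rsE x (mem_head _ _).
have [yE _] : y \in E /\ y ^+ s = y by apply: rsE; rewrite in_cons yrs orbT.
rewrite /diff_roots EC // eqxx /=; apply: EU; first exact: EB.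
by rewrite subr_eq0; apply: contraNneq xrs => <-.
Qed.

Lemma card_unital_gt1 S : unital_closed S -> (1 < #|S|)%N.
Proof.
move=> [S0 S1 _ _]; rewrite (cardsD1 0) S0 (cardsD1 1) !inE S1 oner_neq0.
by [].
Qed.

(** Both sets are the set of roots of [X^s - X] in [E], with [s] the common order: they consist of
    roots, and there are at most [s] of these. *)
Lemma eq_of_card E S S' : field_like E -> unital_closed S -> unital_closed S' ->
  S \subset E -> S' \subset E -> #|S| = #|S'| -> S = S'.
Proof.
move=> fE cS cS' SE SE' e; have [cE EC EU] := fE.
have sub W : unital_closed W -> W \subset E -> #|W| = #|S| ->
    W = [set x in E | x ^+ #|S| == x].
  move=> cW WE eW; apply/eqP; rewrite eqEcard; apply/andP; split.
    apply/fintype.subsetP => x xW; rewrite inE (fintype.subsetP WE) //= -eW expr_card //.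
    by move=> y yW; apply: EU; apply: (fintype.subsetP WE).
  by rewrite eW card_roots_le // card_unital_gt1.
by rewrite (sub S) // (sub S').
Qed.

(** In characteristic [p] the additive group of [S] has exponent dividing [p], so it is a
    [p]-group. *)
Lemma card_closed_pow S : unital_closed S -> exists d, #|S| = (p ^ d)%N.
Proof.
move=> [S0 S1 SB SM].
have SD x y : x \in S -> y \in S -> x + y \in S.
  by move=> xS yS; rewrite -[y]opprK -[- y]sub0r SB // SB.
have gS : group_set S.
  by apply/group_setP; split=> [|x y]; rewrite ?S0 //; exact: SD.
have : pgroup p (Group gS).
  rewrite -pnat_exponent; apply: (pnat_dvd _ (pnat_id pp)).
  apply/exponentP => x _; rewrite -[LHS]/(x *+ p).
  by rewrite -mulr_natr (pcharf0 charA) mulr0.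
move=> /p_natP[d e]; exists d.
exact: e.
Qed.

(** By Bezout, [u * a = v * b + gcdn a b]; the [p ^ (u * a)]-th power of [x] is then both [x] and
    its [p ^ gcdn a b]-th power. *)
Lemma expr_gcd x a b : x ^+ (p ^ a) = x -> x ^+ (p ^ b) = x -> (0 < a)%N ->
  x ^+ (p ^ gcdn a b) = x.
Proof.
move=> xa xb a0; have it k c : x ^+ (p ^ c) = x -> x ^+ (p ^ (k * c)) = x.
  move=> xc; elim: k => [|k IH]; first by rewrite mul0n expr1.
  by rewrite mulSn expnD exprM xc.
have [u v e _] := egcdnP b a0.
by rewrite -[in RHS](it u a xa) e expnD exprM it.
Qed.

Lemma card_gen_field_like E m a : field_like E -> #|E| = (p ^ m)%N -> a \in E ->
  exists2 d, (d %| m)%N & #|unital_subring_gen a| = (p ^ d)%N.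
Proof.
move=> fE cm aE; have [cE EC EU] := fE.
have cS := unital_closed_gen a; set S := unital_subring_gen a in cS *.
have SE : S \subset E by exact: unital_subring_gen_min.
have [d ed] := card_closed_pow cS; exists d => //.
have d0 : (0 < d)%N.
  by have := card_unital_gt1 cS; rewrite ed; case: d {ed} => //.
have SU : {in S, forall x, x != 0 -> x \is a GRing.unit}.
  by move=> x xS; apply: EU; apply: (fintype.subsetP SE).
(* Elements of [S] are fixed by the [p ^ d]-th and the [p ^ m]-th power, hence are roots of
   [X^(p^g) - X] for [g = gcdn d m]. Counting them forces [d = g]. *)
have H : (p ^ d <= p ^ gcdn d m)%N.
  rewrite -ed; apply: leq_trans (card_roots_le fE _).
    apply: subset_leq_card; apply/fintype.subsetP => x xS; rewrite inE (fintype.subsetP SE) //=.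
    apply/eqP; apply: expr_gcd => //; first by rewrite -ed expr_card.
    by rewrite -cm expr_card // (fintype.subsetP SE).
  by rewrite -{1}(expn0 p) ltn_exp2l ?prime_gt1 // gcdn_gt0 d0.
rewrite leq_exp2l ?prime_gt1 // in H.
by apply/gcdn_idPl/eqP; rewrite eqn_leq H dvdn_leq // dvdn_gcdl.
Qed.

Lemma gen_eq_card E a b : field_like E -> a \in E -> b \in E ->
  #|unital_subring_gen a| = #|unital_subring_gen b| ->
  unital_subring_gen a = unital_subring_gen b.
Proof.
move=> fE aE bE; have [cE _ _] := fE.
by apply: (eq_of_card fE); rewrite ?unital_subring_gen_min //; exact: unital_closed_gen.
Qed.

End FieldLike.

(** * One and two generators over a finite field *)

Lemma sum_divisors_ord (n : nat) (F : nat -> nat) : (0 < n)%N ->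
  (\sum_(d <- divisors n) F d = \sum_(d < n.+1 | d %| n) F d)%N.
Proof.
move=> n0; rewrite -(big_mkord (fun d => d %| n)%N) -[RHS]big_filter; apply: perm_big.
apply: uniq_perm; rewrite ?divisors_uniq ?filter_uniq ?iota_uniq // => d.
rewrite mem_filter mem_index_iota -dvdn_divisors //.
by case: (boolP (d %| n)%N) => //= /dvdn_leq; rewrite ltnS => ->.
Qed.

Definition divset n := [set d : 'I_n.+1 | (d %| n)%N].
(** A pair [(d, i)] stands for the graph of [x |-> x^(p^i)] on [GF(p^d)]. Requiring [0 < i], as
    below, leaves out the diagonal subrings, whose generators give scalar matrices. *)
Definition divpairs n := [set di : 'I_n.+1 * 'I_n.+1 | (di.1 %| n)%N && (di.2 < di.1)%N].
Definition divpairs_pos n :=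
  [set di : 'I_n.+1 * 'I_n.+1 | (di.1 %| n)%N && (0 < di.2 < di.1)%N].

Lemma card_divset n : (0 < n)%N -> #|divset n| = ndiv n.
Proof.
move=> n0; rewrite /ndiv -sum1_size sum_divisors_ord // -sum1_card.
by apply: eq_bigl => d; rewrite inE.
Qed.

Lemma card_divpairs n : (0 < n)%N -> #|divpairs n| = sigma n.
Proof.
move=> n0; rewrite /sigma sum_divisors_ord // -sum1_card.
rewrite (eq_bigl (fun di : 'I_n.+1 * 'I_n.+1 => (di.1 %| n)%N && (di.2 < di.1)%N)); last first.
  by move=> di; rewrite inE.
rewrite -(pair_big_dep (fun d : 'I_n.+1 => d %| n)%N (fun d i : 'I_n.+1 => i < d)%N (fun _ _ => 1%N)) /=.
apply: eq_bigr => d dn; rewrite (big_ord_narrow (ltnW (ltn_ord d))).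
by rewrite sum1_card card_ord.
Qed.

Lemma card_divpairs_pos n : (0 < n)%N -> (#|divpairs_pos n| + ndiv n = sigma n)%N.
Proof.
move=> n0; rewrite -card_divpairs // -card_divset //.
rewrite -(cardsID (divpairs_pos n) (divpairs n)); congr (_ + _)%N.
  apply: eq_card => -[d i]; rewrite !inE /=.
  by case: (_ %| _)%N => //=; case: (0 < i)%N; rewrite ?andbF ?andbT //= andbb.
rewrite -(card_imset (f := fun d : 'I_n.+1 => (d, ord0 : 'I_n.+1))); last by move=> d e [].
apply: eq_card => -[d i]; rewrite !inE /=; apply/imsetP/idP => [[e]|].
  rewrite inE => en [-> ->] /=; rewrite en /=.
  by rewrite lt0n; apply: contraTneq en => ->; rewrite dvd0n -lt0n n0.
case/andP=> + /andP[dn id]; rewrite dn id andbT /= -leqNgt leqn0 => /eqP i0.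
by exists d; rewrite ?inE //; congr (_, _); apply: val_inj.
Qed.

Section FinField.
Variables (F : finFieldType) (p n : nat).
Hypotheses (pp : prime p) (n0 : (0 < n)%N) (cardF : #|F| = (p ^ n)%N).
Implicit Types (l m x : F).

Lemma pcharF : p \in [pchar F].
Proof. exact: card_finPcharP cardF pp. Qed.

Let charF := pcharF.

Lemma field_like_setT : field_like [set: F].
Proof.
split; first by split=> [||x y _ _|x y _ _]; rewrite finset.in_setT.
- by move=> x y _ _; rewrite mulrC.
- by move=> x _; rewrite unitfE.
Qed.

Lemma exprF_card x : x ^+ (p ^ n) = x.
Proof. by rewrite -cardF expf_card. Qed.

(** The degree of [l] over the prime field. *)
Definition degp l := logn p #|unital_subring_gen l|.

Lemma card_gen l : #|unital_subring_gen l| = (p ^ degp l)%N /\ (degp l %| n)%N.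
Proof.
have cT : #|[set: F]| = (p ^ n)%N by rewrite cardsT.
have [d dn e] := card_gen_field_like pp charF field_like_setT cT (finset.in_setT l).
by rewrite /degp e pfactorK.
Qed.

Lemma degp_gt0 l : (0 < degp l)%N.
Proof. by have [_ /dvdn_gt0] := card_gen l; apply. Qed.

Lemma degp_dvd l : (degp l %| n)%N.
Proof. by have [] := card_gen l. Qed.

Lemma degp_leq l : (degp l < n.+1)%N.
Proof. by rewrite ltnS dvdn_leq // degp_dvd. Qed.

Lemma degp_eq l m : degp l = degp m -> unital_subring_gen l = unital_subring_gen m.
Proof.
move=> e; apply: (gen_eq_card field_like_setT); rewrite ?inE //.
by have [-> _] := card_gen l; have [-> _] := card_gen m; rewrite e.
Qed.

Lemma expr_degp l : l ^+ (p ^ degp l) = l.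
Proof.
have [<- _] := card_gen l; apply: expr_card; rewrite ?mem_unital_subring_gen //.
  exact: unital_closed_gen.
by move=> x _; rewrite unitfE.
Qed.

Lemma exprp_eval q l k : eval_int q (l ^+ (p ^ k)) = eval_int q l ^+ (p ^ k).
Proof.
elim: k => [|k IH]; first by rewrite !expr1.
rewrite expnSr !exprM -IH.
by rewrite -!(pFrobenius_autE charF) -eval_int_rmorph.
Qed.

(** The [p] residues [k%:R] are distinct roots of [X^p - X], hence all its roots. *)
Lemma prime_subfield x : x ^+ p = x -> exists k : 'I_p, k%:R = x.
Proof.
move=> xp; have P1 := card_roots_le field_like_setT (prime_gt1 pp).
pose f (k : 'I_p) : F := k%:R.
have finj : injective f.
  suff H (a b : 'I_p) : (a <= b)%N -> f a = f b -> a = b.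
    by move=> a b e; case: (leqP a b) => ab; [exact: H|apply/esym/H => //; exact: ltnW].
  move=> ab e; apply: val_inj => /=; apply/eqP; rewrite eqn_leq ab /=.
  have : (p %| b - a)%N by rewrite (dvdn_pcharf charF) natrB // -/(f b) -/(f a) e subrr.
  have := ltn_ord b; case: (posnP (b - a)) => [h _ _|h bp /(dvdn_leq h)]; first by rewrite -subn_eq0 h.
  by lia.
have sub : f @: [set: 'I_p] \subset [set y in [set: F] | y ^+ p == y].
  apply/fintype.subsetP => _ /imsetP[k _ ->]; rewrite !inE /=.
  by rewrite -(pFrobenius_autE charF) /f rmorph_nat.
have /eqP E : f @: [set: 'I_p] == [set y in [set: F] | y ^+ p == y].
  by rewrite eqEcard sub card_imset // cardsT card_ord.
have : x \in [set y in [set: F] | y ^+ p == y] by rewrite !inE xp /=.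
by rewrite -E => /imsetP[k _ ->]; exists k.
Qed.

Lemma lift_poly (g : {poly F}) : (forall i, g`_i ^+ p = g`_i) ->
  exists q : {poly int}, map_poly intr q = g.
Proof.
move=> gp; pose k (c : F) : nat := if [pick k : 'I_p | k%:R == c] is Some k then k else 0%N.
have kE c : c ^+ p = c -> (k c)%:R = c.
  rewrite /k => /prime_subfield[i e]; case: pickP => [j /eqP //|/(_ i)].
  by rewrite e eqxx.
exists (\poly_(i < size g) (Posz (k g`_i))); apply/polyP => i.
rewrite coef_map coef_poly; case: ltnP => [_|h]; last by rewrite nth_default.
by rewrite /= -pmulrn kE.
Qed.

Definition conjugate l m := [exists i : 'I_(degp l), m == l ^+ (p ^ i)].

(** The product of [X - l'] over the conjugates [l'] of [l] vanishes at [l] but not at [m].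
    Frobenius permutes its factors cyclically, so its coefficients lie in the prime field and it
    lifts to the integers. *)
Lemma separating_poly l m : ~~ conjugate l m ->
  exists h : {poly int}, eval_int h l = 0 /\ eval_int h m = 1.
Proof.
move=> nc; pose G i := 'X - (l ^+ (p ^ i))%:P : {poly F}.
pose g := \prod_(i < degp l) G i.
have gF : map_poly (pFrobenius_aut charF) g = g.
  rewrite rmorph_prod /=.
  rewrite (eq_bigr (fun i : 'I_(degp l) => G i.+1)); last first.
    move=> i _; rewrite rmorphB /= map_polyX map_polyC /= pFrobenius_autE.
    by rewrite /G expnSr exprM.
  have := degp_gt0 l; have := expr_degp l; rewrite /g.
  case: (degp l) => // d e _; rewrite big_ord_recr big_ord_recl /= mulrC; congr (_ * _).
  by rewrite /G e expr1.
have [i|q qg] := lift_poly (g := g).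
  by rewrite -{2}gF coef_map /= pFrobenius_autE.
have ql : eval_int q l = 0.
  rewrite /eval_int qg /g horner_prod (bigD1 (Ordinal (degp_gt0 l))) //=.
  by rewrite /G hornerXsubC expr1 subrr mul0r.
have qm : eval_int q m != 0.
  rewrite /eval_int qg /g horner_prod; apply/prodf_neq0 => i _.
  rewrite /G hornerXsubC subr_eq0; apply: contra nc => e.
  by apply/existsP; exists i.
(* Raising to the power [p ^ n - 1] turns the nonzero value at [m] into 1. *)
exists (q ^+ (p ^ n).-1); rewrite !eval_intXn ql; split.
  rewrite expr0n gtn_eqF // -ltnS prednK ?expn_gt0 ?prime_gt0 //.
  by rewrite -{1}(expn0 p) ltn_exp2l ?prime_gt1.
apply: (mulfI qm); rewrite -exprS prednK ?expn_gt0 ?prime_gt0 //.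
by rewrite exprF_card mulr1.
Qed.

Definition genpair l m : {set F * F} :=
  [set z : F * F | `[< exists q, z = (eval_int q l, eval_int q m) >]].

Lemma genpairP l m z :
  reflect (exists q, z = (eval_int q l, eval_int q m)) (z \in genpair l m).
Proof. by rewrite inE; exact: asboolP. Qed.

Lemma genpair_sub l m l' m' r : l' = eval_int r l -> m' = eval_int r m ->
  genpair l' m' \subset genpair l m.
Proof.
move=> -> ->; apply/fintype.subsetP => z /genpairP[q ->]; apply/genpairP.
by exists (q \Po r); rewrite !eval_int_comp.
Qed.

(** Integer polynomials commute with Frobenius, so a polynomial carrying [l'] to [l] also carries
    [l' ^+ (p ^ i)] to [l ^+ (p ^ i)]. *)
Lemma genpair_conjugate l l' i : degp l = degp l' ->
  genpair l (l ^+ (p ^ i)) = genpair l' (l' ^+ (p ^ i)).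
Proof.
move=> e; have E := degp_eq e; apply/eqP; rewrite finset.eqEsubset; apply/andP; split.
  have /unital_subring_genP[r rl] : l \in unital_subring_gen l'.
    by rewrite -E mem_unital_subring_gen.
  by apply: (genpair_sub (r := r)); rewrite ?exprp_eval rl.
have /unital_subring_genP[r rl] : l' \in unital_subring_gen l.
  by rewrite E mem_unital_subring_gen.
by apply: (genpair_sub (r := r)); rewrite ?exprp_eval rl.
Qed.

(** Chinese remainder theorem: the separating polynomial [h] takes the value [(0, 1)] at [(l, m)],
    and [1 - h] the value [(1, 0)]. *)
Lemma genpair_nonconjugate l m : ~~ conjugate l m ->
  genpair l m = finset.setX (unital_subring_gen l) (unital_subring_gen m).
Proof.
move=> /separating_poly[h [hl hm]]; apply/setP => -[x y]; rewrite finset.in_setX /=.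
apply/genpairP/andP => [[q [-> ->]]|].
  by split; apply/unital_subring_genP; exists q.
move=> [/unital_subring_genP[q <-] /unital_subring_genP[r <-]].
exists (q * (1 - h) + r * h); rewrite !eval_intD !eval_intM !eval_intB !eval_int1 hl hm.
by rewrite subrr subr0 !mulr1 !mulr0 addr0 add0r.
Qed.

Definition genpairs := [set genpair lm.1 lm.2 | lm in [set: F * F]].

(** For conjugate entries the degree and the Frobenius exponent determine the subring; otherwise the
    two degrees do. *)
Lemma card_genpairs : (#|genpairs| <= sigma n + ndiv n ^ 2)%N.
Proof.
pose C := [set lm : F * F | conjugate lm.1 lm.2].
pose f (lm : F * F) := genpair lm.1 lm.2.
have -> : genpairs = f @: C :|: f @: (~: C) by rewrite -finset.imsetU finset.setUCr.
apply: leq_trans (leq_card_setU _ _) _; apply: leq_add.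
  rewrite -card_divpairs //.
  pose idx l m : nat := if [pick i : 'I_(degp l) | m == l ^+ (p ^ i)] is Some i then i else 0%N.
  have idxE l m : conjugate l m -> m = l ^+ (p ^ idx l m) /\ (idx l m < degp l)%N.
    rewrite /idx => /existsP[j /eqP e]; case: pickP => [i /eqP ei|/(_ j)]; first by rewrite -ei.
    by rewrite e eqxx.
  pose g (lm : F * F) : 'I_n.+1 * 'I_n.+1 := (inord (degp lm.1), inord (idx lm.1 lm.2)).
  apply: (card_imset_data (g := g)) => [[l m]|[l m] [l' m']]; rewrite !inE /= => /idxE[e i].
    have in1 : (idx l m < n.+1)%N by exact: ltn_trans i (degp_leq l).
    by rewrite !inordK ?degp_leq // degp_dvd i.
  move=> /idxE[e' i'] [/(congr1 val) /= h1 /(congr1 val) /= h2].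
  have in1 : (idx l m < n.+1)%N by exact: ltn_trans i (degp_leq l).
  have in2 : (idx l' m' < n.+1)%N by exact: ltn_trans i' (degp_leq l').
  rewrite !inordK ?degp_leq // in h1 h2.
  by rewrite /f /= e e' h2; exact: genpair_conjugate.
rewrite -card_divset // -mulnn -cardsX.
pose g (lm : F * F) : 'I_n.+1 * 'I_n.+1 := (inord (degp lm.1), inord (degp lm.2)).
apply: (card_imset_data (g := g)) => [[l m] _|[l m] [l' m']].
  by rewrite finset.in_setX !inE /= !inordK ?degp_leq // !degp_dvd.
rewrite !inE /= => c c' [/(congr1 val) /= h1 /(congr1 val) /= h2].
rewrite !inordK ?degp_leq // in h1 h2.
by rewrite /f /= !genpair_nonconjugate // (degp_eq h1) (degp_eq h2).
Qed.

Lemma genpair_swap l m : genpair m l = [set (z.2, z.1) | z in genpair l m].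
Proof.
apply/setP => -[x y]; apply/genpairP/imsetP => [[q [-> ->]]|[[u w] /genpairP[q [-> ->]] [-> ->]]].
  by exists (eval_int q l, eval_int q m) => //; apply/genpairP; exists q.
by exists q.
Qed.

(** Since [p ^ d - 1] divides [p ^ n - 1], a power of a generator of the cyclic unit group has order
    [p ^ d - 1]. *)
Lemma exists_primitive d : (d %| n)%N ->
  exists l, l != 0 /\ forall k, (l ^+ k == 1) = ((p ^ d).-1 %| k)%N.
Proof.
move=> dn; have d0 : (0 < d)%N by apply: dvdn_gt0 dn.
have /cyclicP[z ez] := field_unit_group_cyclic [set: {unit F}]%G.
have oz : #[z]%g = (p ^ n).-1.
  by rewrite -cardF -card_finField_unit [RHS](congr1 (fun G : {set _} => #|G|) ez).
have dv : ((p ^ d).-1 %| (p ^ n).-1)%N.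
  by rewrite -(divnK dn) mulnC expnM dvdn_pred_predX.
pose w := (z ^+ ((p ^ n).-1 %/ (p ^ d).-1))%g.
have ow : #[w]%g = (p ^ d).-1.
  rewrite /w orderXdiv oz ?dvdn_div // divnA // mulKn //.
  by rewrite -ltnS prednK ?expn_gt0 ?prime_gt0 // -{1}(expn0 p) ltn_exp2l ?prime_gt1.
exists (val w); split; first by have := valP w; rewrite unitfE.
move=> k; rewrite -ow order_dvdn -FinRing.val_unitX.
by rewrite -(inj_eq val_inj).
Qed.

End FinField.

(** * Upper bounds for two by two matrices *)

Section Matrix2.
Variable F : finFieldType.
Local Notation M := 'M[F]_2.
Local Notation q := #|F|.
Implicit Types (a b e : M) (x y l m : F).

Lemma ord2E (i : 'I_2) : i = 0 \/ i = 1.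
Proof. by case: i => [[|[|//]] Hi]; [left|right]; apply: val_inj. Qed.

Lemma mx2P a b : a 0 0 = b 0 0 -> a 0 1 = b 0 1 -> a 1 0 = b 1 0 -> a 1 1 = b 1 1 -> a = b.
Proof.
move=> h00 h01 h10 h11; apply/matrixP => i j.
by case: (ord2E i) => ->; case: (ord2E j) => ->.
Qed.

Lemma mul2E a b i j : (a * b) i j = a i 0 * b 0 j + a i 1 * b 1 j.
Proof.
rewrite -mulmxE mxE !big_ord_recl big_ord0 addr0.
by have -> : lift ord0 ord0 = 1 :> 'I_2 by apply: val_inj.
Qed.

Lemma one2E i j : (1 : M) i j = (i == j)%:R.
Proof. by rewrite -[1]/(1%:M) mxE. Qed.

Definition tr2 a : F := a 0 0 + a 1 1.
Definition dt2 a : F := a 0 0 * a 1 1 - a 0 1 * a 1 0.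

Definition mx2E := (mul2E, one2E, mxE).

Lemma cayley2 a : a * a = tr2 a *: a - (dt2 a)%:M.
Proof. by apply: mx2P; rewrite !mx2E /= /tr2 /dt2; ring. Qed.

Definition trdt t D := [set a : M | (tr2 a == t) && (dt2 a == D)].

Lemma trdtP t D a : reflect (tr2 a = t /\ dt2 a = D) (a \in trdt t D).
Proof. by rewrite inE; apply: (iffP andP) => -[/eqP -> /eqP ->]. Qed.

(** If [a 0 1 != 0], the first row determines the matrix, which leaves [q (q - 1)] choices. If
    [a 0 1 = 0], then [a 0 0] is one of at most two roots of the characteristic polynomial and
    [a 1 0] is free, which leaves at most [2 q]. *)
Lemma card_trdt t D : (#|trdt t D| <= q ^ 2 + q)%N.
Proof.
pose P1 := [set a in trdt t D | a 0 1 != 0]; pose P2 := [set a in trdt t D | a 0 1 == 0].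
have -> : trdt t D = id @: P1 :|: id @: P2.
  by rewrite !imset_id; apply/setP => a; rewrite !inE; case: (_ == 0); rewrite ?andbT ?andbF ?orbF.
apply: leq_trans (leq_card_setU _ _) _.
pose roots := [set x | x * x - t * x + D == 0].
have croots : (#|roots| <= 2)%N.
  have [->|[x0]] := set_0Vmem roots; first by rewrite cards0.
  rewrite inE => /eqP e0; apply: (@leq_trans #|[set x0; t - x0]|).
    apply: subset_leq_card; apply/fintype.subsetP => x; rewrite !inE => /eqP e.
    have : (x - x0) * (x - (t - x0)) = 0.
      have -> : (x - x0) * (x - (t - x0)) = (x * x - t * x + D) - (x0 * x0 - t * x0 + D) by ring.
      by rewrite e e0 subrr.
    by move/eqP; rewrite mulf_eq0 !subr_eq0.
  by rewrite cards2; case: (_ != _).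
have q0 : (0 < q)%N by apply/card_gt0P; exists 0.
have h1 : (#|id @: P1| <= #|finset.setX [set: F] [set~ (0 : F)%R]|)%N.
  apply: (card_imset_data (g := fun a => (a 0 0, a 0 1))) => [a|a b].
    by rewrite !inE => /andP[_ h].
  rewrite !inE => /andP[/andP[/eqP ta /eqP da] na] /andP[/andP[/eqP tb /eqP db] nb] [h0 h1].
  have h3 : a 1 1 = b 1 1.
    by apply: (addrI (a 0 0)); rewrite -/(tr2 a) ta {1}h0 -/(tr2 b) tb.
  apply: mx2P => //; apply: (mulfI na).
  rewrite -[LHS](subKr (a 0 0 * a 1 1)) -/(dt2 a) da.
  by rewrite h0 h1 h3 -[RHS](subKr (b 0 0 * b 1 1)) -/(dt2 b) db.
have h2 : (#|id @: P2| <= #|finset.setX roots [set: F]|)%N.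
  apply: (card_imset_data (g := fun a => (a 0 0, a 1 0))) => [a|a b].
    rewrite !inE => /andP[/andP[/eqP ta /eqP da] /eqP na]; rewrite andbT.
    by rewrite -ta -da /tr2 /dt2 na /=; apply/eqP; ring.
  rewrite !inE => /andP[/andP[/eqP ta /eqP da] /eqP na] /andP[/andP[/eqP tb /eqP db] /eqP nb] [h0 h1'].
  have h3 : a 1 1 = b 1 1.
    by apply: (addrI (a 0 0)); rewrite -/(tr2 a) ta {1}h0 -/(tr2 b) tb.
  by apply: mx2P => //; rewrite na nb.
rewrite !cardsX !cardsT cardsC1 in h1 h2.
apply: leq_trans (leq_add h1 h2) _.
apply: leq_trans (_ : q * q.-1 + 2 * q <= _)%N; first by rewrite leq_add2l leq_mul2r croots orbT.
by rewrite -mulnn; case: (q) q0 => // k _; rewrite -pred_Sn; nia.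
Qed.

(** Trace 1 and determinant 0 characterize the idempotents of rank one. *)
Definition idem2 := trdt 1 0.

Lemma idem2_idem e : e \in idem2 -> e * e = e.
Proof. by move=> /trdtP[te de]; rewrite cayley2 te de scale1r raddf0 subr0. Qed.

Lemma idem2_diag e : tr2 e = 1 -> e 1 1 = 1 - e 0 0.
Proof. by move=> te; rewrite -te /tr2; ring. Qed.

Lemma idem2_compl e : e \in idem2 -> 1 - e \in idem2.
Proof.
move=> /trdtP[te de]; have e11 := idem2_diag te.
apply/trdtP; rewrite /tr2 /dt2 !mx2E /= e11; split; first by ring.
by rewrite -[RHS]de /dt2 e11; ring.
Qed.

(** Equality would mean [2 e = 1]. The argument on entries covers characteristic 2 and odd
    characteristic together. *)
Lemma idem2_compl_neq e : e \in idem2 -> 1 - e != e.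
Proof.
move=> /trdtP[te de]; have e11 := idem2_diag te; apply/eqP => h.
have := congr1 (fun a : M => a 0 0) h; have := congr1 (fun a : M => a 0 1) h.
rewrite !mx2E /= => h01 h00.
have b2 : e 0 1 + e 0 1 = 0 by rewrite -{1}h01 sub0r addNr.
have one : e 0 0 + e 0 0 = 1 by rewrite -{1}h00 subrK.
have bb : e 0 1 = 0 by rewrite -[LHS]mulr1 -one mulrDr -mulrDl b2 mul0r.
have x0 : e 0 0 * e 0 0 = 0 by rewrite -{2}h00 -e11 -[RHS]de /dt2 bb; ring.
have e0 : e 0 0 = 0 by move/eqP: x0; rewrite mulf_eq0 orbb => /eqP.
by move: h00; rewrite e0 subr0 => /eqP; rewrite oner_eq0.
Qed.

(** For an idempotent [e], the matrix that acts as [x] on the image of [e] and as [y] on its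
    kernel. *)
Definition Phi e x y : M := x *: e + y *: (1 - e).

Lemma Phi_mul e x y x' y' : e * e = e -> Phi e x y * Phi e x' y' = Phi e (x * x') (y * y').
Proof.
move=> ee; have ef : e * (1 - e) = 0 by rewrite mulrBr mulr1 ee subrr.
have fe : (1 - e) * e = 0 by rewrite mulrBl mul1r ee subrr.
have ff : (1 - e) * (1 - e) = 1 - e by rewrite mulrBr mulr1 fe subr0.
rewrite /Phi mulrDl !mulrDr -!scalerAl -!scalerAr ee ef fe ff !scalerA.
by rewrite !scaler0 addr0 add0r.
Qed.

Lemma Phi_add e x y x' y' : Phi e x y + Phi e x' y' = Phi e (x + x') (y + y').
Proof. by rewrite /Phi !scalerDl addrACA. Qed.

Lemma Phi_diag e x : Phi e x x = x%:M.
Proof. by rewrite /Phi -scalerDr subrKC scalemx1. Qed.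

Lemma Phi_eval e q' x y : e * e = e ->
  eval_int q' (Phi e x y) = Phi e (eval_int q' x) (eval_int q' y).
Proof.
move=> ee; elim/poly_ind: q' => [|r c IH].
  by rewrite !eval_int0 Phi_diag raddf0.
rewrite !eval_intD !eval_intM IH !eval_intX !eval_intC Phi_mul // -Phi_add Phi_diag.
by rewrite rmorph_int.
Qed.

Lemma Phi_swap e x y : Phi (1 - e) x y = Phi e y x.
Proof. by rewrite /Phi opprB subrKC addrC. Qed.

Lemma split_Phi a l m : l + m = tr2 a -> l * m = dt2 a -> l != m ->
  exists2 e, e \in idem2 & a = Phi e l m.
Proof.
move=> ta da lm; have lm0 : l - m != 0 by rewrite subr_eq0.
(* The projection onto the [l]-eigenspace along the [m]-eigenspace. *)
exists ((l - m)^-1 *: (a - m%:M)).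
  apply/trdtP; rewrite /tr2 /dt2 !mx2E /= mulr1n !mulr0n !subr0; split.
    rewrite -mulrDr; apply: (mulfI lm0); rewrite mulVKf // mulr1.
    by rewrite addrACA -/(tr2 a) -ta; ring.
  apply: (mulfI lm0); apply: (mulfI lm0); rewrite !mulr0.
  transitivity (dt2 a - m * tr2 a + m * m); last by rewrite -ta -da; ring.
  by rewrite /dt2 /tr2; field.
apply: mx2P; rewrite /Phi !mx2E /= ?mulr1n ?mulr0n; by field.
Qed.

Lemma unital_Phi e l m : e \in idem2 ->
  unital_subring_gen (Phi e l m) = [set Phi e z.1 z.2 | z in genpair l m].
Proof.
move=> /idem2_idem ee; apply/setP => a; apply/unital_subring_genP/imsetP.
  move=> [r <-]; exists (eval_int r l, eval_int r m); last by rewrite Phi_eval.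
  by apply/genpairP; exists r.
by move=> [z /genpairP[r ->] ->]; exists r; rewrite Phi_eval.
Qed.


Lemma idem2_PhiE e x y : e \in idem2 -> tr2 (Phi e x y) = x + y /\ dt2 (Phi e x y) = x * y.
Proof.
move=> /trdtP[te de]; have e11 := idem2_diag te.
rewrite /tr2 /dt2 /Phi !mx2E /= e11; split; first by ring.
have bc : e 0 1 * e 1 0 = e 0 0 * (1 - e 0 0).
  by rewrite -e11; apply/eqP; rewrite eq_sym -subr_eq0 -/(dt2 e) de.
transitivity (x * y + (x - y) ^+ 2 * (e 0 0 * (1 - e 0 0) - e 0 1 * e 1 0)); first by ring.
by rewrite bc subrr mulr0 addr0.
Qed.

Definition split2 := [set a : M | [exists l, exists m, (l + m == tr2 a) && (l * m == dt2 a) && (l != m)]].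
Definition double2 := [set a : M | [exists l, (l + l == tr2 a) && (l * l == dt2 a)]].

Definition noroot a := forall x, x * x - tr2 a * x + dt2 a != 0.

Lemma noroot_of a : a \notin split2 -> a \notin double2 -> noroot a.
Proof.
rewrite !inE => ns nd x; apply/eqP => e.
have e2 : x * (tr2 a - x) = dt2 a.
  by apply/eqP; rewrite -subr_eq0 -oppr_eq0 -e; apply/eqP; ring.
have [xx|xx] := eqVneq x (tr2 a - x).
  move: nd => /existsP[]; exists x.
  have h1 : x + x = tr2 a by rewrite {2}xx subrKC.
  have h2 : x * x = dt2 a by rewrite -e2 -xx.
  by rewrite h1 h2 !eqxx.
move: ns => /existsP[]; exists x; apply/existsP; exists (tr2 a - x).
by rewrite e2 subrKC !eqxx xx.
Qed.

Section Upper.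
Variables (p n : nat).
Hypotheses (pp : prime p) (n0 : (0 < n)%N) (cardF : #|F| = (p ^ n)%N).
Let gen1 : M -> {set M} := @unital_subring_gen _.

(** An idempotent and a subring of [F x F] determine the generated subring. Replacing [e] by [1 - e]
    and exchanging the two coordinates gives the same subring, and has no fixed point because
    [1 - e != e]. *)
Lemma card_gen_split2 :
  (2 * #|gen1 @: split2| <= (q ^ 2 + q) * (sigma n + ndiv n ^ 2))%N.
Proof.
pose X := finset.setX idem2 (genpairs F).
pose f (x : M * {set F * F}) := [set Phi x.1 z.1 z.2 | z in x.2].
apply: leq_trans (_ : 2 * #|f @: X| <= _)%N.
  rewrite leq_mul2l; apply: subset_leq_card; apply/fintype.subsetP => _ /imsetP[a aS ->].
  move: aS; rewrite inE => /existsP[l /existsP[m /andP[/andP[/eqP ta /eqP da] lm]]].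
  have [e eI ->] := split_Phi ta da lm.
  apply/imsetP; exists (e, genpair l m); last by rewrite /gen1 unital_Phi.
  by rewrite finset.in_setX eI /=; apply/imsetP; exists (l, m).
pose iota (x : M * {set F * F}) := (1 - x.1, [set (z.2, z.1) | z in x.2]).
apply: leq_trans (card_imset_involution (iota := iota) _) _.
  move=> [e Z]; rewrite finset.in_setX /= => /andP[eI /imsetP[[l m] _ /= eZ]]; split.
  - rewrite finset.in_setX /= idem2_compl //=; apply/imsetP; exists (m, l) => //.
    by rewrite /= genpair_swap eZ.
  - rewrite /f /= -imset_comp; apply: eq_imset => z /=.
    by rewrite Phi_swap.
  - by rewrite xpair_eqE negb_and idem2_compl_neq.
rewrite cardsX leq_mul ?card_trdt //.
exact: (card_genpairs pp n0 cardF).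
Qed.

Lemma scalarE x : (x%:M : M) = in_alg M x.
Proof. by rewrite -scalemx1. Qed.

Lemma eval_scalar r x : eval_int r (x%:M : M) = (eval_int r x)%:M.
Proof. by rewrite !scalarE -eval_int_rmorph. Qed.

(* With [k = #|F|] the second term vanishes: the scalar part of [x%:M + N] is
   a power of it. *)
Lemma expr_scalar_nilp x (N : M) k : N * N = 0 -> (x%:M + N) ^+ k = (x ^+ k)%:M + (x ^+ k.-1 *+ k) *: N.
Proof.
move=> NN; elim: k => [|k IH]; first by rewrite !expr0 mulr0n scale0r addr0.
rewrite exprS IH mulrDl !mulrDr -!scalerAr NN scaler0 addr0 -!mulmxE -scalar_mxM -exprS.
rewrite mul_scalar_mx mul_mx_scalar scalerA -addrA -scalerDl.
congr (_ + _ *: _); case: k {IH} => [|k]; first by rewrite mulr0n mul0r add0r.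
by rewrite mulrnAl -exprSr -mulrSr.
Qed.

(** Write [a = x + N] with [x] the double eigenvalue. Then [N] has trace and determinant 0, so
    [N * N = 0], and the subring is determined by [N] and the degree of [x]. *)
Lemma card_gen_double2 : (#|gen1 @: double2| <= (q ^ 2 + q) * ndiv n)%N.
Proof.
rewrite -card_divset //; apply: (@leq_trans #|finset.setX (trdt 0 0) (divset n)|); last first.
  by rewrite cardsX leq_mul // card_trdt.
pose root a : F := if [pick l | (l + l == tr2 a) && (l * l == dt2 a)] is Some l then l else 0.
have rootE a : a \in double2 -> root a + root a = tr2 a /\ root a * root a = dt2 a.
  rewrite inE /root => /existsP[l hl]; case: pickP => [m /andP[/eqP -> /eqP ->] //|/(_ l)].
  by rewrite hl.
have chF := pcharF pp cardF.
apply: (card_imset_data (g := fun a => (a - (root a)%:M, inord (degp p (root a))))) => [a|a b].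
  move=> /rootE[ta da]; rewrite finset.in_setX /=; apply/andP; split.
    apply/trdtP; rewrite /tr2 /dt2 !mx2E /= mulr1n mulr0n !subr0; split.
      transitivity (tr2 a - (root a + root a)); first by rewrite /tr2; ring.
      by rewrite ta subrr.
    transitivity (dt2 a - root a * tr2 a + root a * root a); first by rewrite /tr2 /dt2; ring.
    by rewrite -ta -da; ring.
  by rewrite inE inordK ?(degp_leq pp n0 cardF) // (degp_dvd pp cardF).
move=> /rootE[ta da] /rootE[tb db] [eN /(congr1 val) /= ed].
rewrite !inordK ?(degp_leq pp n0 cardF) // in ed.
have NN : (a - (root a)%:M) * (a - (root a)%:M) = 0.
  have /trdtP[tN dN] : a - (root a)%:M \in trdt 0 0.
    apply/trdtP; rewrite /tr2 /dt2 !mx2E /= mulr1n mulr0n !subr0; split.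
      transitivity (tr2 a - (root a + root a)); first by rewrite /tr2; ring.
      by rewrite ta subrr.
    transitivity (dt2 a - root a * tr2 a + root a * root a); first by rewrite /tr2 /dt2; ring.
    by rewrite -ta -da; ring.
  by rewrite cayley2 tN dN scale0r raddf0 subr0.
have sub x y (N : M) : N * N = 0 -> degp p x = degp p y ->
    y%:M + N \in unital_subring_gen (x%:M + N).
  move=> NN' /(degp_eq pp cardF) exy.
  have /unital_subring_genP[r ry] : y \in unital_subring_gen x.
    by rewrite exy mem_unital_subring_gen.
  (* The [q]-th power of [x + N] is [x]. Hence [X - X^q] extracts [N], while [r (X^q)] turns [x]
     into [y]. *)
  apply/unital_subring_genP; exists (r \Po 'X^q + 'X - 'X^q).
  have Xq : eval_int 'X^q (x%:M + N) = x%:M.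
    rewrite eval_intXn eval_intX expr_scalar_nilp // cardF exprF_card //.
    rewrite -mulr_natr natrX -(prednK n0) exprS (pcharf0 chF) mul0r mulr0 scale0r addr0.
    by [].
  rewrite eval_intB eval_intD eval_int_comp Xq eval_scalar ry eval_intX.
  by rewrite addrCA addrAC subrr add0r.
rewrite -(subrK (root a)%:M a) -(subrK (root b)%:M b) -eN !(addrC _ _%:M).
by apply: unital_subring_gen_eq; apply: sub.
Qed.

(* Every matrix with [a 1 0 != 0] is [x%:M + y *: cmx c] for some [x], [y]. *)
Definition cmx (c : F * F) : M := \matrix_(i, j)
  (if i == 0 then (if j == 0 then 0 else c.1) else (if j == 0 then 1 else c.2)).
Definition cline (c : F * F) : {set M} := [set x.1%:M + x.2 *: cmx c | x : F * F].

Lemma clineP c a : reflect (exists x y, a = x%:M + y *: cmx c) (a \in cline c).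
Proof.
apply: (iffP imsetP) => [[[x y] _ ->]|[x [y ->]]]; first by exists x, y.
by exists (x, y).
Qed.

Lemma card_cline c : #|cline c| = (p ^ (2 * n))%N.
Proof.
rewrite card_imset; first by rewrite card_prod cardF -expnD addnn mul2n.
move=> [x y] [x' y'] h /=.
have := congr1 (fun a : M => a 0 0) h; have := congr1 (fun a : M => a 1 0) h.
by rewrite !mx2E /= !mulr1n !mulr0n !mulr1 !mulr0 !addr0 !add0r => -> ->.
Qed.

Lemma cline_mul c x y x' y' : (x%:M + y *: cmx c) * (x'%:M + y' *: cmx c) =
  (x * x' + y * y' * c.1)%:M + (x * y' + x' * y + y * y' * c.2) *: cmx c.
Proof. by apply: mx2P; rewrite !mx2E /= ?mulr1n ?mulr0n; ring. Qed.

(** As [cmx c] is the companion matrix of [X^2 - c.2 X - c.1], the plane is a quadratic extension of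
    [F]. An element times its conjugate is the norm [N], so inverses exist once [N] is nonzero. *)
Lemma cline_field_like c : (forall x, x * x - c.2 * x - c.1 != 0) -> field_like (cline c).
Proof.
move=> nr; split.
- split.
  + by apply/clineP; exists 0, 0; rewrite raddf0 scale0r addr0.
  + by apply/clineP; exists 1, 0; rewrite scale0r addr0.
  + move=> _ _ /clineP[x [y ->]] /clineP[x' [y' ->]]; apply/clineP; exists (x - x'), (y - y').
    by rewrite scalerBl raddfB /= opprD addrACA.
  + move=> _ _ /clineP[x [y ->]] /clineP[x' [y' ->]]; apply/clineP.
    by rewrite cline_mul; eexists; eexists.
- move=> _ _ /clineP[x [y ->]] /clineP[x' [y' ->]]; rewrite !cline_mul.
  by congr (_%:M + _ *: _); ring.
move=> _ /clineP[x [y ->]] xy0.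
pose N := x * x + x * y * c.2 - y * y * c.1.
have N0 : N != 0.
  have [y0|y0] := eqVneq y 0.
    rewrite /N y0 !mulr0 !mul0r addr0 subr0 mulf_eq0 orbb.
    by apply: contraNneq xy0 => ->; rewrite y0 raddf0 scale0r addr0.
  (* Up to the factor [y * y], the norm is the value at [- x / y] of the polynomial without
     roots. *)
  have := nr (- x / y); apply: contraNneq => e.
  have -> : - x / y * (- x / y) - c.2 * (- x / y) - c.1 = N / (y * y).
    by rewrite /N; field.
  by rewrite e mul0r.
have h1 : (x%:M + y *: cmx c) * ((x + y * c.2)%:M + (- y) *: cmx c) = N%:M.
  rewrite cline_mul (_ : x * - y + _ + _ = 0) ?scale0r ?addr0; last by ring.
  by congr (_%:M); rewrite /N; ring.
have h2 : ((x + y * c.2)%:M + (- y) *: cmx c) * (x%:M + y *: cmx c) = N%:M.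
  rewrite cline_mul (_ : (x + _) * y + _ + _ = 0) ?scale0r ?addr0; last by ring.
  by congr (_%:M); rewrite /N; ring.
apply/unitrP; exists (N^-1 *: ((x + y * c.2)%:M + (- y) *: cmx c)).
by rewrite -scalerAl -scalerAr h1 h2 -scalemx1 scalerA mulVf // scale1r.
Qed.

(** The pair [c a] fixes the plane spanned by 1 and [a]. This plane is a field with [p ^ (2 * n)]
    elements, in which the generated subring is determined by its order. *)
Lemma card_gen_rest : (#|gen1 @: ~: (split2 :|: double2)| <= q ^ 2 * ndiv (2 * n))%N.
Proof.
have n20 : (0 < 2 * n)%N by rewrite muln_gt0.
rewrite -card_divset //.
pose c a := (a 0 1 / a 1 0, (a 1 1 - a 0 0) / a 1 0).
have key a : noroot a -> (forall x, x * x - (c a).2 * x - (c a).1 != 0) /\ a \in cline (c a).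
  (* With [a 1 0 = 0] the entry [a 0 0] would be an eigenvalue. *)
  move=> nr; have a10 : a 1 0 != 0.
    apply/eqP => e; have /eqP := nr (a 0 0); apply.
    by rewrite /tr2 /dt2 e; ring.
  split.
    (* This affine substitution turns the characteristic polynomial of [a] into that of [cmx (c a)],
       up to the factor [a 1 0 ^+ 2]. *)
    move=> x; have := nr (a 0 0 + a 1 0 * x); apply: contraNneq => e.
    apply/eqP; transitivity (a 1 0 ^+ 2 * (x * x - (c a).2 * x - (c a).1)); last by rewrite e mulr0.
    by rewrite /c /tr2 /dt2 /=; field.
  apply/clineP; exists (a 0 0), (a 1 0).
  by apply: mx2P; rewrite !mx2E /= ?mulr1n ?mulr0n; field.
have chM : p \in [pchar M].
  rewrite inE pp /=; have := pcharF pp cardF; rewrite inE => /andP[_ /eqP e].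
  by rewrite -scaler_nat e scale0r.
have nrP a : a \in ~: (split2 :|: double2) -> noroot a.
  by rewrite finset.in_setC finset.in_setU negb_or => /andP[]; exact: noroot_of.
pose g a := (c a, inord (logn p #|gen1 a|) : 'I_(2 * n).+1).
have cg a : noroot a -> exists2 d, (d %| 2 * n)%N & #|gen1 a| = (p ^ d)%N.
  move=> /key[k1 k2].
  exact: (card_gen_field_like pp chM (cline_field_like k1) (card_cline _) k2).
have ->: (q ^ 2 * #|divset (2 * n)| = #|finset.setX [set: F * F] (divset (2 * n))|)%N.
  by rewrite cardsX cardsT card_prod mulnn.
apply: (card_imset_data (g := g)) => [a|a b].
  move=> /nrP /cg[d d2 e]; rewrite finset.in_setX finset.in_setT inE /= e pfactorK //.
  by rewrite inordK // ltnS dvdn_leq.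
move=> /nrP na /nrP nb [e1 e2 e3].
have [d dn ed] := cg a na; have [d' dn' ed'] := cg b nb.
have dd : d = d'.
  have dn1 : (d < (2 * n).+1)%N by rewrite ltnS dvdn_leq.
  have dn2 : (d' < (2 * n).+1)%N by rewrite ltnS dvdn_leq.
  have := congr1 val e3; rewrite /= ed ed' (pfactorK d pp) (pfactorK d' pp).
  by rewrite (inordK dn1) (inordK dn2).
have [k1 k2] := key a na; have [_ k3] := key b nb.
apply: (gen_eq_card (cline_field_like k1)) => //.
  by rewrite /c e1 e2 -/(c b).
by rewrite -/(gen1 a) -/(gen1 b) ed ed' dd.
Qed.

Lemma v1_le : (2 * v1 M <= (q ^ 2 + q) * (sigma n + ndiv n ^ 2)
  + 2 * ((q ^ 2 + q) * ndiv n) + 2 * (q ^ 2 * ndiv (2 * n)))%N.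
Proof.
have H : (v1 M <= #|gen1 @: split2| + #|gen1 @: double2| + #|gen1 @: ~: (split2 :|: double2)|)%N.
  apply: leq_trans (leq_add (leq_card_setU _ _) (leqnn _)); rewrite -finset.imsetU.
  apply: leq_trans (leq_card_setU _ _); rewrite -finset.imsetU finset.setUCr.
  apply: subset_leq_card; apply/fintype.subsetP => _ /imsetP[a _ ->].
  by apply/imsetP; exists a; rewrite ?finset.in_setT.
apply: leq_trans (leq_mul (leqnn 2) H) _; rewrite !(mulnDr 2).
apply: leq_add; last by rewrite leq_mul2l card_gen_rest.
apply: leq_add; last by rewrite leq_mul2l card_gen_double2.
exact: card_gen_split2.
Qed.

Lemma expr_unit_eq1 a : a \is a GRing.unit -> exists2 k, (0 < k)%N & a ^+ k = 1.
Proof.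
move=> ua; exists #[FinRing.unit _ ua]%g; first exact: order_gt0.
by have := congr1 val (expg_order (FinRing.unit _ ua)); rewrite FinRing.val_unitX.
Qed.

Lemma dt2_unit a : dt2 a != 0 -> a \is a GRing.unit.
Proof.
move=> d0; have c1 : a * ((tr2 a)%:M - a) = (dt2 a)%:M.
  by apply: mx2P; rewrite !mx2E /= /tr2 /dt2 ?mulr1n ?mulr0n; ring.
have c2 : ((tr2 a)%:M - a) * a = (dt2 a)%:M.
  by apply: mx2P; rewrite !mx2E /= /tr2 /dt2 ?mulr1n ?mulr0n; ring.
apply/unitrP; exists ((dt2 a)^-1 *: ((tr2 a)%:M - a)).
by rewrite -scalerAl -scalerAr c1 c2 -scalemx1 scalerA mulVf // scale1r.
Qed.

(** Invertible [a] give subrings already counted by [v1], and nilpotent ones number at most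
    [q ^ 2 + q]. In the remaining case [a] is its trace times an idempotent of rank one, and that
    idempotent and the degree of the trace determine the subring. *)
Lemma v_le : (v M <= v1 M + (q ^ 2 + q) * (1 + ndiv n))%N.
Proof.
pose gen : M -> {set M} := @subring_gen _.
pose U := [set a : M | a \is a GRing.unit].
pose S := [set a : M | (dt2 a == 0) && (tr2 a != 0)].
have H : (v M <= #|gen @: U| + #|gen @: trdt 0%R 0%R| + #|gen @: S|)%N.
  apply: leq_trans (leq_add (leq_card_setU _ _) (leqnn _)); rewrite -finset.imsetU.
  apply: leq_trans (leq_card_setU _ _); rewrite -finset.imsetU.
  apply: subset_leq_card; apply/fintype.subsetP => _ /imsetP[a _ ->].
  apply/imsetP; exists a => //; rewrite !inE.
  have [d0|d0] := eqVneq (dt2 a) 0.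
    by case: (tr2 a == 0); rewrite ?orbT.
  by rewrite dt2_unit.
apply: leq_trans H _; rewrite -addnA; apply: leq_add.
  apply: subset_leq_card; apply/fintype.subsetP => _ /imsetP[a aU ->].
  rewrite inE in aU; have [k k0 ak] := expr_unit_eq1 aU.
  by rewrite /gen (subring_gen_unital k0 ak); apply/imsetP; exists a.
rewrite mulnDr muln1; apply: leq_add.
  by apply: leq_trans (leq_imset_card _ _) (card_trdt _ _).
rewrite -card_divset //; apply: (@leq_trans #|finset.setX idem2 (divset n)|); last first.
  by rewrite cardsX leq_mul // card_trdt.
have Sdec a : a \in S -> (tr2 a)^-1 *: a \in idem2 /\ a = Phi ((tr2 a)^-1 *: a) (tr2 a) 0.
  rewrite inE => /andP[/eqP d0 t0]; split.
    apply/trdtP; rewrite /tr2 /dt2 !mxE -mulrDr mulVf //; split => //.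
    transitivity ((tr2 a)^-1 ^+ 2 * dt2 a); last by rewrite d0 mulr0.
    by rewrite /dt2 /tr2; ring.
  by rewrite /Phi scale0r addr0 scalerA mulfV // scale1r.
apply: (card_imset_data (g := fun a => ((tr2 a)^-1 *: a, inord (degp p (tr2 a))))) => [a aS|a b aS bS].
  have [aI _] := Sdec a aS; rewrite finset.in_setX aI inE /=.
  by rewrite inordK ?(degp_leq pp n0 cardF) // (degp_dvd pp cardF).
have [aI ea] := Sdec a aS; have [bI eb] := Sdec b bS.
move=> [ee /(congr1 val) /=]; rewrite !inordK ?(degp_leq pp n0 cardF) // => ed.
have sub e x y : e \in idem2 -> y != 0 -> x != 0 -> degp p x = degp p y ->
    Phi e y 0 \in subring_gen (Phi e x 0).
  move=> /idem2_idem eI y0 x0 /(degp_eq pp cardF) exy.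
  (* The polynomial must vanish at 0 in order to preserve the second eigenvalue 0. Such a polynomial
     exists because [x] has finite multiplicative order. *)
  have : y \in unital_subring_gen x by rewrite exy mem_unital_subring_gen.
  have xq : x ^+ q.-1 = 1.
    apply: (mulfI x0); rewrite -exprS prednK ?mulr1 ?expf_card //.
    by apply/card_gt0P; exists 0.
  have q1 : (0 < q.-1)%N.
    by rewrite cardF -ltnS prednK ?expn_gt0 ?prime_gt0 // -{1}(expn0 p) ltn_exp2l ?prime_gt1.
  rewrite -(subring_gen_unital q1 xq) => /subring_genP[r r0 ry].
  apply/subring_genP; exists r => //; rewrite Phi_eval // ry.
  by rewrite eval_int_at0 r0.
have ta : tr2 a != 0 by move: aS; rewrite inE => /andP[].
have tb : tr2 b != 0 by move: bS; rewrite inE => /andP[].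
rewrite ea eb -ee; apply: subring_gen_eq; apply: sub => //.
Qed.

End Upper.
End Matrix2.

(** * Lower bounds for two by two matrices *)

Section Lower.
Variables (F : finFieldType) (p n : nat).
Hypotheses (pp : prime p) (n0 : (0 < n)%N) (cardF : #|F| = (p ^ n)%N).
Local Notation M := 'M[F]_2.
Local Notation q := #|F|.
Implicit Types (a b e : M) (l m : F).

Lemma Phi_gen_eq e e' l m l' m' : e \in idem2 F -> e' \in idem2 F -> l' != m' ->
  unital_subring_gen (Phi e l m) = unital_subring_gen (Phi e' l' m') ->
  (e' = e /\ exists r, l' = eval_int r l /\ m' = eval_int r m) \/ e' = 1 - e.
Proof.
move=> eI eI' lm' h; have ee := idem2_idem eI.
have : Phi e' l' m' \in unital_subring_gen (Phi e l m) by rewrite h mem_unital_subring_gen.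
move=> /unital_subring_genP[r]; rewrite Phi_eval //; set x := eval_int r l; set y := eval_int r m => E.
have [t1 d1] := idem2_PhiE x y eI; have [t2 d2] := idem2_PhiE l' m' eI'.
rewrite E t2 in t1; rewrite E d2 in d1.
have d0 : l' - m' != 0 by rewrite subr_eq0.
have : (x - l') * (x - m') = 0.
  transitivity (x * x - (l' + m') * x + l' * m'); first by ring.
  by rewrite t1 d1; ring.
move/eqP; rewrite mulf_eq0 !subr_eq0 => /orP[]/eqP ex.
  have ey : y = m' by move: t1; rewrite ex => /addrI ->.
  left; split; last by exists r; rewrite -/x -/y ex ey.
  have : (l' - m') *: (e - e') = 0.
    have : Phi e l' m' - Phi e' l' m' = 0 by rewrite -E ex ey subrr.
    by move=> <-; apply: mx2P; rewrite /Phi !mx2E /=; ring.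
  by move/eqP; rewrite scaler_eq0 (negbTE d0) /= subr_eq0 => /eqP.
have ey : y = l' by move: t1; rewrite ex addrC => /addrI ->.
right; have : (l' - m') *: (e' - (1 - e)) = 0.
  have : Phi e' l' m' - Phi e m' l' = 0 by rewrite -E ex ey subrr.
  by move=> <-; apply: mx2P; rewrite /Phi !mx2E /=; ring.
by move/eqP; rewrite scaler_eq0 (negbTE d0) /= subr_eq0 => /eqP.
Qed.

(** Any first row with nonzero second entry completes to an idempotent of rank one; the
    parametrization makes these easy to count. *)
Definition emx (ab : F * F) : M := \matrix_(i, j)
  (if i == 0 then (if j == 0 then ab.1 else ab.2)
   else (if j == 0 then ab.1 * (1 - ab.1) / ab.2 else 1 - ab.1)).

Lemma emx_idem ab : ab.2 != 0 -> emx ab \in idem2 F.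
Proof.
move=> b0; apply/trdtP; rewrite /tr2 /dt2 !mxE /=; split; first by rewrite subrKC.
by field.
Qed.

Lemma emx_inj : injective emx.
Proof.
move=> [a b] [a' b'] h.
have := congr1 (fun a : M => a 0 0) h; have := congr1 (fun a : M => a 0 1) h.
by rewrite !mxE /= => -> ->.
Qed.

(** Multiplicative order exactly [p ^ d - 1]: such an [l] generates the unit group of [GF(p^d)]. *)
Definition primitive d l := l != 0 /\ forall k, (l ^+ k == 1) = ((p ^ d).-1 %| k)%N.

Lemma primitive_expr d l j : primitive d l -> (l ^+ (p ^ j) == l) = ((p ^ d).-1 %| (p ^ j).-1)%N.
Proof.
move=> [l0 H]; rewrite -H; have pj : (0 < p ^ j)%N by rewrite expn_gt0 prime_gt0.
have -> : l ^+ (p ^ j) = l * l ^+ (p ^ j).-1 by rewrite -exprS prednK.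
by rewrite -[RHS](inj_eq (mulfI l0)) mulr1.
Qed.

Lemma primitive_leq d l j : primitive d l -> (0 < j)%N -> l ^+ (p ^ j) = l -> (d <= j)%N.
Proof.
move=> H j0 /eqP; rewrite (primitive_expr _ H) => /dvdn_leq h.
have p1 := prime_gt1 pp.
have hj : (1 < p ^ j)%N by rewrite -{1}(expn0 p) ltn_exp2l.
rewrite -(leq_exp2l d j p1); have := h _; lia.
Qed.

Lemma frob_inj (x y : F) k : (k <= n)%N -> x ^+ (p ^ k) = y ^+ (p ^ k) -> x = y.
Proof.
move=> kn h; rewrite -(exprF_card cardF x) -(exprF_card cardF y) -(subnKC kn).
by rewrite expnD !exprM h.
Qed.

Lemma primitive_frob_inj d l i j : primitive d l -> (d <= n)%N -> (i < d)%N -> (j < d)%N ->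
  l ^+ (p ^ i) = l ^+ (p ^ j) -> i = j.
Proof.
move=> H dn; suff K i' j' : (i' < j')%N -> (j' < d)%N -> l ^+ (p ^ i') = l ^+ (p ^ j') -> False.
  move=> id jd e; case: (ltngtP i j) => // h; exfalso; [exact: K e|exact: K (esym e)].
move=> ij jd e; have : l ^+ (p ^ (j' - i')) = l.
  apply: (@frob_inj _ _ i'); first by lia.
  by rewrite -exprM -expnD subnK // ltnW.
move=> /(primitive_leq H) h; have := h _; rewrite subn_gt0 => /(_ ij); lia.
Qed.

(** A single [K] bounds both counts, because the family [g] consists of invertible matrices. It
    pairs each idempotent [emx] with the eigenvalues [l] and [l ^+ (p ^ i)], where [l] is primitive
    of degree [d] and [0 < i < d]. *)
Lemma v_ge_aux : exists K : nat, [/\ (q * q.-1 * #|divpairs_pos n| <= 2 * K)%N,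
  (K <= v M)%N & (K <= v1 M)%N].
Proof.
have [lam Hlam] : exists lam : nat -> F, forall d, (d %| n)%N -> primitive d (lam d).
  have H d : exists l, (d %| n)%N -> primitive d l.
    case: (boolP (d %| n)%N) => [dn|_]; last by exists 0.
    by have [l Hl] := exists_primitive pp n0 cardF dn; exists l.
  by have [lam Hl] := boolp.choice H; exists lam.
pose X := finset.setX (finset.setX [set: F] [set~ (0 : F)%R]) (divpairs_pos n).
pose g (x : (F * F) * ('I_n.+1 * 'I_n.+1)) : M :=
  Phi (emx x.1) (lam x.2.1) (lam x.2.1 ^+ (p ^ x.2.2)).
pose f x := unital_subring_gen (g x).
have XP x : x \in X -> [/\ x.1.2 != 0, (x.2.1 %| n)%N, (0 < x.2.2)%N & (x.2.2 < x.2.1)%N].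
  by rewrite !inE => /andP[/andP[_ h1] /andP[h2 /andP[h3 h4]]].
have ne x : x \in X -> lam x.2.1 != lam x.2.1 ^+ (p ^ x.2.2).
  move=> /XP[_ dn i0 id]; apply/eqP => /esym e.
  by have := primitive_leq (Hlam _ dn) i0 e; lia.
exists #|f @: X|; split.
- have -> : (q * q.-1 * #|divpairs_pos n| = #|X|)%N by rewrite !cardsX cardsT cardsC1.
  apply: (card_imset_fiber2 (h := fun x => emx x.1) (k := fun e => 1 - e)) => x y xX yX fxy.
    have [hx _ _ _] := XP x xX; have [hy _ _ _] := XP y yX.
    have [[-> _]|->] := Phi_gen_eq (emx_idem hy) (emx_idem hx) (ne x xX) (esym fxy).
      by left.
    by right.
  move=> /emx_inj exy.
  have [hx dx ix idx] := XP x xX; have [hy dy iy idy] := XP y yX.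
  have Hx := Hlam _ dx; have Hy := Hlam _ dy.
  (* The idempotents agree, so the swapped alternative would give [1 - e = e]. The polynomials [r]
     and [r'] carry the two eigenvalue pairs to each other; this yields equal degrees and then equal
     Frobenius exponents. *)
  have [[_ [r [rl rm]]]|e] := Phi_gen_eq (emx_idem hx) (emx_idem hy) (ne y yX) fxy; last first.
    by have := idem2_compl_neq (emx_idem hx); rewrite -e exy eqxx.
  have [[_ [r' [rl' rm']]]|e] := Phi_gen_eq (emx_idem hy) (emx_idem hx) (ne x xX) (esym fxy); last first.
    by have := idem2_compl_neq (emx_idem hy); rewrite -e exy eqxx.
  have self d l : primitive d l -> l ^+ (p ^ d) = l.
    by move=> H; apply/eqP; rewrite (primitive_expr _ H).
  have dd : x.2.1 = y.2.1 :> nat.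
    apply/eqP; rewrite eqn_leq; apply/andP; split.
      apply: (primitive_leq Hx); first by lia.
      by rewrite rl' -(exprp_eval pp cardF) self.
    apply: (primitive_leq Hy); first by lia.
    by rewrite rl -(exprp_eval pp cardF) self.
  have ii : x.2.2 = y.2.2 :> nat.
    apply: (primitive_frob_inj Hx); [exact: dvdn_leq n0 dx|exact: idx|by rewrite dd|].
    by rewrite dd rm (exprp_eval pp cardF) -rl.
  case: x y exy dd ii {xX yX fxy hx hy dx dy ix iy idx idy Hx Hy rl rm rl' rm'} => [ab [d i]] [ab' [d' i']] /= -> dd ii.
  by congr (_, (_, _)); apply: val_inj.
- have sub x : x \in X -> subring_gen (g x) = f x.
    move=> xX; have [hx dx ix idx] := XP x xX.
    have [l0 _] := Hlam _ dx.
    have u : g x \is a GRing.unit.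
      apply: dt2_unit; have [_ ->] := idem2_PhiE (lam x.2.1) (lam x.2.1 ^+ (p ^ x.2.2)) (emx_idem hx).
      by rewrite mulf_neq0 // expf_neq0.
    by have [k k0 gk] := expr_unit_eq1 u; rewrite (subring_gen_unital k0 gk).
  apply: subset_leq_card; apply/fintype.subsetP => _ /imsetP[x xX ->].
  by rewrite -sub //; apply/imsetP; exists (g x).
- apply: subset_leq_card; apply/fintype.subsetP => _ /imsetP[x xX ->].
  by apply/imsetP; exists (g x).
Qed.

Lemma v_ge : (q * q.-1 * (sigma n - ndiv n) <= 2 * v M)%N.
Proof.
have [K [h1 h2 _]] := v_ge_aux; rewrite -(card_divpairs_pos n0) addnK.
by apply: leq_trans h1 _; rewrite leq_mul2l.
Qed.

Lemma v1_ge : (q * q.-1 * (sigma n - ndiv n) <= 2 * v1 M)%N.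
Proof.
have [K [h1 _ h2]] := v_ge_aux; rewrite -(card_divpairs_pos n0) addnK.
by apply: leq_trans h1 _; rewrite leq_mul2l.
Qed.

End Lower.

Local Open Scope classical_set_scope.
Local Open Scope ring_scope.

(** * Mertens' theorems *)

(** The equal coefficients at [m] and [m.+1] both occur in the expansion of [2 ^ (2 m + 1)]. *)
Lemma bin_double_le m : ('C(m.*2.+1, m) <= 4 ^ m)%N.
Proof.
rewrite -(leq_pmul2l (isT : (0 < 2)%N)).
have -> : (2 * 4 ^ m = (1 + 1) ^ m.*2.+1)%N.
  by rewrite expnS -mul2n expnM.
rewrite expnDn; pose i1 := inord m : 'I_m.*2.+2; pose i2 := inord m.+1 : 'I_m.*2.+2.
have e1 : i1 = m :> nat by rewrite inordK //; lia.
have e2 : i2 = m.+1 :> nat by rewrite inordK //; lia.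
have ne : i2 != i1 by rewrite -val_eqE /= e1 e2; lia.
rewrite (bigD1 i1) //= (bigD1 i2) //= !exp1n !muln1 e1 e2.
have -> : 'C(m.*2.+1, m.+1) = 'C(m.*2.+1, m).
  by rewrite -bin_sub; [congr 'C(_, _); lia|lia].
by rewrite addnA mul2n -addnn leq_addr.
Qed.

Lemma prime_dvd_fact p n : prime p -> (p %| n`!)%N = (p <= n)%N.
Proof.
move=> pp; apply/idP/idP => [|pn]; last by apply: dvdn_fact; rewrite prime_gt0.
elim: n => [|n IH]; first by rewrite fact0 Euclid_dvd1.
rewrite factS Euclid_dvdM // => /orP[/dvdn_leq -> //|/IH]; lia.
Qed.

Lemma prod_primes_dvd (s : seq nat) (n : nat) : uniq s -> all prime s ->
  (forall p, p \in s -> (p %| n)%N) -> (\prod_(p <- s) p %| n)%N.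
Proof.
elim: s => [|p s IH] /=; first by rewrite big_nil dvd1n.
move=> /andP[ps us] /andP[pp as_] H; rewrite big_cons Gauss_dvd.
  rewrite H ?mem_head //= IH // => q qs; apply: H.
  by rewrite in_cons qs orbT.
rewrite prime_coprime // big_seq; apply/negP => D.
have [q qs pq] : exists2 q, q \in s & (p %| q)%N.
  elim: s {IH us H as_} D ps => [|q s IH].
    by rewrite -big_seq big_nil Euclid_dvd1.
  rewrite -big_seq big_cons Euclid_dvdM // => /orP[pq _|D].
    by exists q; rewrite ?mem_head.
  rewrite in_cons negb_or big_seq in D *.
  move=> /andP[_ /(IH D)[r rs pr]]; exists r => //.
  by rewrite in_cons rs orbT.
have pq' := allP as_ q qs; move: pq; rewrite dvdn_prime2 // => /eqP e.
by rewrite e qs in ps.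
Qed.

Lemma sump_recr (R : nmodType) (F : nat -> R) (P : pred nat) n :
  \sum_(0 <= p < n.+1 | P p) F p =
  \sum_(0 <= p < n | P p) F p + (if P n then F n else 0).
Proof. by rewrite big_mkcond big_nat_recr //= -big_mkcond. Qed.

(** Erdos's argument: for [n = 2 m + 1] the primes from [m + 2] to [n] divide ['C(n, m)], which is
    at most [4 ^ m]. An even [n > 2] adds no prime. *)
Lemma primorial_le n : (\prod_(0 <= p < n.+1 | prime p) p <= 4 ^ n)%N.
Proof.
elim/ltn_ind: n => n IH.
have [n2|n2] := leqP n 2.
  by case: n n2 {IH} => [|[|[|//]]] _; rewrite big_mkcond unlock.
have [on|en] := boolP (odd n); last first.
  case: n n2 en IH => // n n2 en IH.
  rewrite big_mkcond big_nat_recr //= -big_mkcond /=.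
  have -> : prime n.+1 = false.
    by apply/negP => /even_prime[|]; [lia|rewrite (negbTE en)].
  rewrite muln1; apply: leq_trans (IH n _) _ => //.
  by rewrite leq_exp2l.
have [m e] : exists m, n = m.*2.+1 by exists n./2; lia.
have m1 : (1 <= m)%N by lia.
rewrite {}e in n2 on IH *.
rewrite (big_cat_nat _ (n := m.+2)) /=; try lia.
rewrite (_ : 4 ^ _ = 4 ^ m.+1 * 4 ^ m)%N; last by rewrite -expnD; congr (_ ^ _)%N; lia.
apply: leq_mul; first by apply: IH; lia.
apply: leq_trans (bin_double_le m); apply: dvdn_leq.
  by rewrite bin_gt0; lia.
rewrite -big_filter; apply: prod_primes_dvd.
- by rewrite filter_uniq // iota_uniq.
- by apply/allP => p; rewrite mem_filter => /andP[].
move=> p; rewrite mem_filter mem_index_iota => /andP[pp /andP[p1 p2]].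
have : (p %| m.*2.+1 `!)%N by rewrite prime_dvd_fact //; lia.
rewrite -(@bin_fact _ m); last by lia.
rewrite !Euclid_dvdM // !prime_dvd_fact // => /orP[//|]; lia.
Qed.

Section Mertens1.
Variable R : realType.
Implicit Types (x y : R) (n N p : nat).
Local Notation L n := (ln (n%:R : R)).

Lemma ler_lnS x y : 0 < x -> x <= y -> ln x <= ln y.
Proof. by move=> x0 xy; rewrite ler_ln ?posrE // (lt_le_trans x0). Qed.

Lemma ln_leB1 x : 0 < x -> ln x <= x - 1.
Proof. by move=> x0; rewrite -{1}[x](subrKC 1) le_ln1Dx //; lra. Qed.

Lemma ln_geB1 x : 0 < x -> 1 - x^-1 <= ln x.
Proof.
move=> x0; rewrite -[ln x]opprK -lnV ?posrE // lerNr opprB.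
by apply: ln_leB1; rewrite invr_gt0.
Qed.

Lemma lnn_ge0 n : 0 <= L n.
Proof. by case: n => [|n]; [rewrite ln0|rewrite ln_ge0 // ler1n]. Qed.

Lemma lnn_gt0 n : (1 < n)%N -> 0 < L n.
Proof. by move=> n1; rewrite ln_gt0 // ltr1n. Qed.

Lemma ler_lnn m n : (0 < m)%N -> (m <= n)%N -> L m <= L n.
Proof. by move=> m0 mn; rewrite ler_lnS ?ltr0n ?ler_nat. Qed.

Lemma lnnM m n : (0 < m)%N -> (0 < n)%N -> L (m * n)%N = L m + L n.
Proof. by move=> m0 n0; rewrite natrM lnM ?posrE ?ltr0n. Qed.

Lemma lnnX n k : (0 < n)%N -> L (n ^ k)%N = k%:R * L n.
Proof. by move=> n0; rewrite natrX lnXn ?ltr0n // mulr_natl. Qed.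

Lemma lnnS_le n : (0 < n)%N -> L n.+1 - L n <= n%:R^-1.
Proof.
move=> n0; have n0' : 0 < n%:R :> R by rewrite ltr0n.
rewrite -ln_div ?posrE ?ltr0n // (le_trans (ln_leB1 _)) ?divr_gt0 ?ltr0n //.
by rewrite -natr1 mulrDl divff ?gt_eqF // mul1r addrC addKr.
Qed.

Lemma lnnS_ge n : (0 < n)%N -> n.+1%:R^-1 <= L n.+1 - L n.
Proof.
move=> n0; have n0' : 0 < n%:R :> R by rewrite ltr0n.
rewrite -ln_div ?posrE ?ltr0n // (le_trans _ (ln_geB1 _)) ?divr_gt0 ?ltr0n //.
rewrite invf_div -natr1; have : n%:R + 1 != 0 :> R by rewrite natr1 pnatr_eq0.
by move=> H; rewrite -[X in X - _](divff H) -mulrBl addrAC subrr add0r mul1r.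
Qed.

(* Telescoping majorant: [(ln (m+1) + 1) / m]. *)
Lemma sum_ln_le N :
  \sum_(2 <= m < N) L m / (m%:R * (m%:R - 1)) <= L 2 + 1.
Proof.
suff H : forall N, \sum_(2 <= m < N.+2) L m / (m%:R * (m%:R - 1))
    <= L 2 + 1 - (L N.+2 + 1) / N.+1%:R.
  case: N => [|[|N]]; try (by rewrite big_geq // addr_ge0 // lnn_ge0).
  by apply: le_trans (H N) _; rewrite gerBl divr_ge0 // addr_ge0 // lnn_ge0.
elim=> [|n IH]; first by rewrite big_geq // divr1 subrr.
rewrite big_nat_recr //=; apply: le_trans (lerD IH (lexx _)) _.
have := lnnS_le (isT : 0 < n.+2)%N.
set a : R := n.+1%:R; have a0 : 0 < a by rewrite ltr0n.
rewrite (_ : n.+2%:R = a + 1); last by rewrite natr1.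
move: (ln (a + 1)) (ln n.+3%:R) => u w H.
have {}H : a * (w - u) <= 1.
  apply: le_trans (_ : a * (a + 1)^-1 <= _); first by rewrite ler_pM2l.
  by rewrite ler_pdivrMr ?addr_gt0 //; lra.
rewrite -subr_ge0 (_ : _ - _ = (1 - a * (w - u)) / (a * (a + 1))).
  by apply: divr_ge0; [rewrite subr_ge0|apply/ltW/mulr_gt0 => //; lra].
have a1 : a + 1 != 0 by rewrite gt_eqF ?addr_gt0.
  have -> : a + 1 - 1 = a by ring.
  clearbody a; field.
  by rewrite a1 gt_eqF.
Qed.

Lemma le_lnn_fact N : L N`! <= N%:R * L N.
Proof.
rewrite -[leRHS](_ : L (N ^ N)%N = _); last first.
  by case: N => [|N]; [rewrite ln1 mul0r|rewrite lnnX].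
rewrite ler_lnn ?fact_gt0 //; elim: N => // N IH.
rewrite factS expnS leq_mul // (leq_trans IH) //.
by case: (N) => // M; rewrite leq_exp2r.
Qed.

Lemma ge_lnn_fact N : N%:R * L N - N%:R <= L N`!.
Proof.
elim: N => [|N IH]; first by rewrite fact0 ln1 mul0r subrr.
rewrite factS lnnM ?fact_gt0 //; case: N IH => [|N] IH.
  by rewrite fact0 ln1 mul1r; lra.
have := lnnS_le (isT : 0 < N.+1)%N.
have -> : N.+2%:R = N.+1%:R + 1 :> R by rewrite natr1.
set a : R := N.+1%:R in IH *; have a0 : 0 < a by rewrite ltr0n.
move: (ln a) (ln (a + 1)) (ln N.+1 `!%:R) IH => u w z IH H.
have {}H : a * (w - u) <= 1 by rewrite mulrC -ler_pdivlMr // mul1r.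
lra.
Qed.

Lemma theta_le N : \sum_(0 <= p < N.+1 | prime p) L p <= N%:R * L 4.
Proof.
rewrite -lnnX //.
suff -> : \sum_(0 <= p < N.+1 | prime p) L p = L (\prod_(0 <= p < N.+1 | prime p) p)%N.
  rewrite ler_lnn ?primorial_le // big_mkcond /=.
  by apply: prodn_gt0 => i; case: ifP => // /prime_gt0.
elim: N.+1 => [|M IH]; first by rewrite !big_geq // ln1.
rewrite sump_recr [in RHS]big_mkcond big_nat_recr //= -big_mkcond /= IH.
case: ifP => [pM|_]; last by rewrite addr0 muln1.
rewrite lnnM ?(prime_gt0 pM) //.
by rewrite big_mkcond; apply: prodn_gt0 => i; case: ifP => // /prime_gt0.
Qed.

Lemma lnn_logn m M : (0 < m)%N -> (m <= M)%N ->
  L m = \sum_(0 <= p < M.+1 | prime p) (logn p m)%:R * L p.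
Proof.
move=> m0 mM; rewrite -{1}(partnT m0) (widen_partn _ mM) (eq_bigl xpredT) //.
elim: M.+1 => [|K IH]; first by rewrite !big_geq // ln1.
rewrite sump_recr -IH big_nat_recr //= lnnM; last 2 first.
- by apply: prodn_gt0 => i; rewrite pfactor_gt0.
- by rewrite pfactor_gt0.
congr (_ + _); case: ifP => [pK|nK]; first by rewrite lnnX ?prime_gt0.
by rewrite lognE nK expn0 ln1.
Qed.

Lemma lnn_fact_logn N M : (N <= M)%N ->
  L N`! = \sum_(0 <= p < M.+1 | prime p) (logn p N`!)%:R * L p.
Proof.
elim: N => [|N IH] NM.
  by rewrite fact0 ln1 big1 // => p _; rewrite logn1 mul0r.
rewrite factS lnnM ?fact_gt0 // (IH (ltnW NM)) (lnn_logn _ NM) // -big_split /=.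
by apply: eq_bigr => p _; rewrite lognM ?fact_gt0 // natrD mulrDl.
Qed.

Lemma logn_fact_ge N p : prime p -> N%:R / p%:R - 1 <= (logn p N`!)%:R :> R.
Proof.
move=> pp; have p0 := prime_gt0 pp; rewrite logn_fact //.
apply: le_trans (_ : (N %/ p)%:R <= _).
  rewrite lerBlDr ler_pdivrMr ?ltr0n // natr1 -natrM ler_nat ltnW //.
  by rewrite -ltn_divLR.
rewrite ler_nat; case: N => [|N]; first by rewrite div0n.
by rewrite big_ltn // expn1 leq_addr.
Qed.

Lemma logn_fact_le N p : prime p -> (logn p N`!)%:R <= N%:R / (p%:R - 1) :> R.
Proof.
move=> pp; have p1 := prime_gt1 pp; have p0 := prime_gt0 pp; rewrite logn_fact // natr_sum.
have p1' : 0 < p%:R - 1 :> R by rewrite subr_gt0 ltr1n.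
have p0' : 0 < p%:R :> R by rewrite ltr0n.
apply: le_trans (_ : \sum_(1 <= k < N.+1) N%:R / p%:R ^+ k <= _).
  apply: ler_sum => k _; rewrite ler_pdivlMr ?exprn_gt0 //.
  by rewrite -natrX -natrM ler_nat leq_trunc_div.
rewrite -mulr_sumr ler_wpM2l //.
suff -> : \sum_(1 <= k < N.+1) (p%:R ^+ k)^-1 = (1 - p%:R ^- N) / (p%:R - 1) :> R.
  apply: ler_piMl; first by rewrite invr_ge0 ltW.
  by rewrite gerBl invr_ge0 exprn_ge0 // ltW.
elim: N => [|N IH]; first by rewrite big_geq // expr0 invr1 subrr mul0r.
rewrite big_nat_recr //= IH exprS.
have : p%:R ^+ N != 0 :> R by rewrite gt_eqF ?exprn_gt0.
by move=> H; field; rewrite H !gt_eqF.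
Qed.

(** Legendre's formula puts the exponent of [p] in [N!] between [N / p - 1] and [N / (p - 1)];
    summing against [ln p] compares [N] times the sum with [ln N! = N ln N + O(N)]. *)
Lemma mertens1 : exists C : R, forall N, (0 < N)%N ->
  `|\sum_(0 <= p < N.+1 | prime p) L p / p%:R - L N| <= C.
Proof.
(* [L 4] bounds the subtracted units through [theta_le], [L 2 + 1] is the bound of [sum_ln_le] for
   the excess [1 / (p (p - 1))], and the last 1 comes from [ge_lnn_fact]. *)
exists (L 4 + L 2 + 2) => N N0; have N0' : 0 < N%:R :> R by rewrite ltr0n.
set A := \sum_(_ <= _ < _ | _) _.
have pos2 := lnn_ge0 2; have pos4 := lnn_ge0 4.
have H1 : N%:R * A <= N%:R * L N + N%:R * L 4.
  apply: le_trans (lerD (le_lnn_fact N) (theta_le N)).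
  rewrite (lnn_fact_logn (leqnn N)) -big_split /= mulr_sumr; apply: ler_sum => p pp.
  rewrite -[X in _ + X]mul1r -mulrDl mulrA mulrAC ler_wpM2r ?lnn_ge0 //.
  by rewrite -lerBlDr logn_fact_ge.
have H2 : N%:R * L N - N%:R <= N%:R * (A + (L 2 + 1)).
  apply: le_trans (ge_lnn_fact N) _.
  apply: le_trans (_ : N%:R * (A + \sum_(2 <= p < N.+1) L p / (p%:R * (p%:R - 1))) <= _); last first.
    by rewrite ler_pM2l // lerD2l sum_ln_le.
  apply: le_trans (_ : N%:R * (A + \sum_(0 <= p < N.+1 | prime p) L p / (p%:R * (p%:R - 1))) <= _); last first.
    rewrite ler_pM2l // lerD2l.
    have t0 p : (1 < p)%N -> 0 <= L p / (p%:R * (p%:R - 1)).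
      by move=> p1; rewrite divr_ge0 ?lnn_ge0 // mulr_ge0 // subr_ge0 ler1n ltnW.
    rewrite big_mkcond (big_cat_nat _ (n := 2)) //= 2?big_ltn // big_geq //= !add0r.
    rewrite !big_nat; apply: ler_sum => p /andP[p1 _].
    by case: ifP => // _; exact: t0.
  rewrite /A -big_split /= mulr_sumr (lnn_fact_logn (leqnn N)); apply: ler_sum => p pp.
  have p1 := prime_gt1 pp.
  have p1' : 0 < p%:R - 1 :> R by rewrite subr_gt0 ltr1n.
  have p0' : 0 < p%:R :> R by rewrite ltr0n prime_gt0.
  rewrite [leRHS](_ : _ = (N%:R / (p%:R - 1)) * L p); last by field; rewrite !gt_eqF.
  by rewrite ler_wpM2r ?lnn_ge0 // logn_fact_le.
rewrite -mulrDr ler_pM2l // in H1.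
rewrite -[X in _ - X]mulr1 -mulrBr ler_pM2l // in H2.
by rewrite ler_norml; apply/andP; split; lra.
Qed.

End Mertens1.

(** * Mertens' second theorem and the convergence to Euler's constant *)

Section Mertens2.
Variable R : realType.
Implicit Types (x y : R) (n N p : nat).
Local Notation L n := (ln (n%:R : R)).

Lemma sump2 (F : nat -> R) N :
  \sum_(0 <= p < N | prime p) F p =
  \sum_(2 <= p < N) (if prime p then F p else 0).
Proof.
rewrite big_mkcond; case: N => [|[|N]]; first by rewrite !big_geq.
  by rewrite big_ltn // !big_geq //= addr0.
by rewrite (big_cat_nat _ (n := 2)) //= 2?big_ltn // big_geq //= !add0r.
Qed.

Lemma cvgn_lnn : L n @[n --> \oo] --> +oo.
Proof.
apply/cvgryPge => A; near=> n.
have H : expR A <= n%:R by near: n; exact: nbhs_infty_ger.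
by rewrite -ler_expR lnK // posrE (lt_le_trans (expR_gt0 A)).
Unshelve. all: by end_near. Qed.

Lemma cvg_seqS (u : nat -> R) (l : R) :
  u @ \oo --> l -> u n.+1 @[n --> \oo] --> l.
Proof. by rewrite -(cvg_shiftS u). Qed.

Lemma cvg_seqS_inv (u : nat -> R) (l : R) :
  u n.+1 @[n --> \oo] --> l -> u @ \oo --> l.
Proof. by rewrite -(cvg_shiftS u). Qed.

Lemma cvg_near_eq (w u : nat -> R) (l : R) : (\forall n \near \oo, w n = u n) ->
  w @ \oo --> l -> u @ \oo --> l.
Proof. by move=> wu; apply: cvg_trans; apply: near_eq_cvg. Qed.

Lemma cvg_squeeze0 (u w : nat -> R) : (\forall n \near \oo, `|u n| <= w n) ->
  w @ \oo --> (0 : R) -> u @ \oo --> (0 : R).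
Proof.
move=> uw w0; apply: (@squeeze_cvgr _ \oo _ _ (fun n => - w n) w u) => //.
  by near=> n; rewrite -ler_norml; near: n.
by rewrite -oppr0; apply: cvgN.
Unshelve. all: by end_near. Qed.

Lemma cvgn_invn : (n%:R : R)^-1 @[n --> \oo] --> (0 : R).
Proof.
by apply: cvg_seqS_inv; exact: cvg_harmonic.
Qed.

Lemma cvgn_invlnn : (L n)^-1 @[n --> \oo] --> (0 : R).
Proof.
apply/gtr0_cvgV0; last exact: cvgn_lnn.
by near=> n; apply: lnn_gt0; near: n; exact: nbhs_infty_gt.
Unshelve. all: by end_near. Qed.

Lemma cvgn_lnratio : L n / L n.+1 @[n --> \oo] --> (1 : R).
Proof.
rewrite -[X in _ --> X]subr0.
have : (1 - n%:R^-1 / L n.+1) @[n --> \oo] --> (1 - 0 * 0 : R).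
  apply: cvgB; first exact: cvg_cst.
  apply: cvgM; first exact: cvgn_invn.
  by apply: (@cvg_seqS (fun n => (L n)^-1)); exact: cvgn_invlnn.
rewrite mul0r subr0 => H.
apply: (@squeeze_cvgr _ \oo _ _ _ (fun=> 1) _ _ 1 H); last exact: cvg_cst.
near=> n.
have n1 : (0 < n)%N by near: n; exact: nbhs_infty_gt.
have l0 : 0 < L n.+1 by rewrite lnn_gt0.
rewrite ler_pdivrMr // mul1r ler_lnn // ler_pdivlMr // mulrBl divfK ?gt_eqF //.
by rewrite mul1r lerBlDr -lerBlDl lnnS_le.
Unshelve. all: by end_near. Qed.

Lemma cvgn_lnlnS : ln (L n.+1) - ln (L n) @[n --> \oo] --> (0 : R).
Proof.
have H : ln (L n / L n.+1) @[n --> \oo] --> (ln 1 : R).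
  by apply: (cvg_comp _ _ cvgn_lnratio); apply: continuous_ln.
rewrite ln1 in H; rewrite -oppr0; apply: cvg_near_eq (cvgN H); near=> n; rewrite -[LHS]/(- ln (L n / L n.+1)).
have n1 : (1 < n)%N by near: n; exact: nbhs_infty_gt.
by rewrite ln_div ?posrE ?lnn_gt0 // ?opprB // ltnW.
Unshelve. all: by end_near. Qed.

(** Write [v] as [(v + u) - u]: both series have nonnegative terms and bounded partial sums. *)
Lemma sum_cvg_bounded (v u : nat -> R) (a : nat) (M : R) :
  (forall n, (a <= n)%N -> `|v n| <= u n) ->
  (forall N, \sum_(a <= n < N) u n <= M) ->
  cvgn (fun N => \sum_(a <= n < N) v n).
Proof.
move=> vu uM.
have P (w : nat -> R) (M' : R) : (forall n, (a <= n)%N -> 0 <= w n) ->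
    (forall N, \sum_(a <= n < N) w n <= M') -> cvgn (fun N => \sum_(a <= n < N) w n).
  move=> w0 wM; apply: nondecreasing_is_cvgn; last by exists M' => _ [n _ <-].
  apply/nondecreasing_seqP => n.
  have [an|na] := leqP a n; first by rewrite big_nat_recr //= lerDl w0.
  by rewrite !big_geq //; lia.
have u0 n : (a <= n)%N -> 0 <= u n by move=> /vu; exact: le_trans.
have -> : (fun N => \sum_(a <= n < N) v n) =
  (fun N => \sum_(a <= n < N) (v n + u n)) \- (fun N => \sum_(a <= n < N) u n).
  by apply/funext => N /=; rewrite big_split /= addrK.
apply: is_cvgB; last exact: P uM.
apply: (P _ (M + M)).
  by move=> n /vu; rewrite ler_norml => /andP[]; lra.
move=> N; apply: le_trans (lerD (uM N) (uM N)); rewrite -big_split /=.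
rewrite !big_nat; apply: ler_sum => n /andP[/vu H _].
by rewrite lerD2r (le_trans (ler_norm _)).
Qed.

Lemma sum_invMB1 N : \sum_(2 <= n < N) ((n%:R : R) * (n%:R - 1))^-1 <= 1.
Proof.
suff H M : \sum_(2 <= n < M.+2) ((n%:R : R) * (n%:R - 1))^-1 = 1 - M.+1%:R^-1.
  case: N => [|[|N]]; try by rewrite big_geq.
  by rewrite H gerBl invr_ge0.
elim: M => [|M IH]; first by rewrite big_geq // invr1 subrr.
rewrite big_nat_recr //= IH -[M.+2%:R]natr1.
set a : R := M.+1%:R; have a0 : 0 < a by rewrite ltr0n.
clearbody a; rewrite (_ : a + 1 - 1 = a); last ring.
by field; rewrite !gt_eqF ?addr_gt0.
Qed.

Definition lnfactor (p : nat) : R := - ln (1 - p%:R^-1).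

Lemma lnfactor_bounds p : (1 < p)%N ->
  0 <= lnfactor p - p%:R^-1 <= (p%:R * (p%:R - 1))^-1.
Proof.
move=> p1; have p0' : 0 < p%:R :> R by rewrite ltr0n ltnW.
have p1' : 0 < p%:R - 1 :> R by rewrite subr_gt0 ltr1n.
have h0 : 0 < 1 - p%:R^-1 :> R by rewrite subr_gt0 invf_lt1 // ltr1n.
rewrite /lnfactor; apply/andP; split.
  by have := ln_leB1 h0; lra.
have := ln_geB1 h0.
have -> : (1 - p%:R^-1)^-1 = p%:R / (p%:R - 1) :> R by field; rewrite !gt_eqF.
have -> : (p%:R * (p%:R - 1))^-1 = p%:R / (p%:R - 1) - p%:R^-1 - 1 :> R.
  by field; rewrite !gt_eqF.
lra.
Qed.

Definition Bsum (N : nat) : R := \sum_(0 <= p < N.+1 | prime p) lnfactor p.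

(** Up to terms with an evident limit, [Bsum N - ln (ln N)] splits into three convergent sums: [E1]
    replaces [lnfactor p] by [1 / p], [S2] carries the bounded Mertens remainder [r], and [G] the
    error of telescoping [ln (ln n)]. *)
Lemma mertens2 : cvgn (fun N => Bsum N - ln (L N)).
Proof.
have [C HC] := mertens1 R.
pose A N := \sum_(0 <= p < N.+1 | prime p) L p / p%:R.
pose r N := A N - L N.
have rC N : (0 < N)%N -> `|r N| <= C by exact: HC.
have C0 : 0 <= C by exact: le_trans (rC 1%N isT).
pose E1 N := \sum_(2 <= p < N.+1) (if prime p then lnfactor p - p%:R^-1 else 0).
pose W n := (L n)^-1 - (L n.+1)^-1.
pose S2 N := \sum_(2 <= n < N.+1) r n * W n.
pose g n := ln (L n.+1) - ln (L n) - (1 - L n / L n.+1).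
pose G N := \sum_(2 <= n < N.+1) g n.
have l0 n : (2 <= n)%N -> 0 < L n by exact: lnn_gt0.
(* Partial summation, with [1 / p] written as [(ln p / p) * (1 / ln p)]. *)
have abel N : (2 <= N)%N -> \sum_(0 <= p < N.+1 | prime p) p%:R^-1 =
    A N / L N.+1 + \sum_(2 <= n < N.+1) A n * W n :> R.
  elim: N => // N IH; rewrite leq_eqVlt => /orP[/eqP[<-]|N2].
    rewrite big_nat1 /W /A !sump2 !big_nat1 /=.
    have := l0 2%N isT; have := l0 3%N isT => H3 H2; field; by rewrite !gt_eqF.
  rewrite sump_recr IH // [X in _ = _ + X]big_nat_recr ?(ltnW N2) //.
  rewrite -[X in _ = _ + X]/(\sum_(2 <= i < N.+1) A i * W i + A N.+1 * W N.+1).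
  have -> : A N.+1 = A N + (if prime N.+1 then L N.+1 / N.+1%:R else 0).
    by rewrite /A sump_recr.
  have -> : W N.+1 = (L N.+1)^-1 - (L N.+2)^-1 by [].
  have := l0 N.+1 (ltnW N2); have := l0 N.+2 (leqW (ltnW N2)) => H3 H2.
  have n0 : N.+1%:R != 0 :> R by rewrite pnatr_eq0.
  move: (\sum_(_ <= _ < _) _) (A N) (L N.+1) (L N.+2) (N.+1%:R : R) H3 H2 n0.
  by move=> s a b c d c0 b0 d0; case: ifP => _; field; rewrite ?d0 !gt_eqF.
have dec N : (2 <= N)%N -> Bsum N - ln (L N) =
    E1 N + (L N / L N.+1 + r N / L N.+1) + S2 N - G N
    + (ln (L N.+1) - ln (L N)) - ln (L 2).
  move=> N2.
  have -> : Bsum N = E1 N + \sum_(0 <= p < N.+1 | prime p) p%:R^-1.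
    rewrite /Bsum /E1 !sump2 -big_split /=; apply: eq_bigr => p _.
    by case: ifP => _; rewrite ?subrK // addr0.
  rewrite abel // -mulrDl addrC (addrC (L N)) subrK.
  have -> : \sum_(2 <= n < N.+1) A n * W n = S2 N + \sum_(2 <= n < N.+1) L n * W n.
    rewrite /S2 -big_split /=; apply: eq_bigr => n _.
    by rewrite -mulrDl subrK.
  have -> : \sum_(2 <= n < N.+1) L n * W n = ln (L N.+1) - ln (L 2) - G N.
    rewrite -(telescope_sumr (fun n => ln (L n))); last exact: ltnW.
    rewrite /G -sumrB !big_nat; apply: eq_bigr => n /andP[n2 _].
    by rewrite /g /W mulrBr divff ?gt_eqF ?l0 //; ring.
  ring.
have cE : cvgn E1.
  apply/cvg_ex.
  have /cvg_ex[l Hl] : cvgn (fun N => \sum_(2 <= p < N) (if prime p then lnfactor p - p%:R^-1 else 0)).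
    apply: (@sum_cvg_bounded _ (fun n => ((n%:R : R) * (n%:R - 1))^-1) _ 1); last exact: sum_invMB1.
    move=> n n2; have /andP[h1 h2] := lnfactor_bounds n2.
    case: ifP => _; first by rewrite ger0_norm.
    by rewrite normr0 (le_trans h1).
  by exists l; apply: cvg_seqS Hl.
have cS : cvgn S2.
  apply/cvg_ex.
  have /cvg_ex[l Hl] : cvgn (fun N => \sum_(2 <= n < N) r n * W n).
    have W0 n : (2 <= n)%N -> 0 <= W n.
      by move=> n2; rewrite subr_ge0 lef_pV2 ?posrE ?l0 ?ler_lnn //; lia.
    apply: (@sum_cvg_bounded _ (fun n => C * W n) _ (C * (L 2)^-1)).
      by move=> n n2; rewrite normrM (ger0_norm (W0 n n2)) ler_wpM2r ?W0 // rC //; lia.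
    move=> N; rewrite -mulr_sumr ler_wpM2l //.
    have [N2|N2] := leqP N 2; first by rewrite big_geq // invr_ge0 lnn_ge0.
    have -> : \sum_(2 <= n < N) W n = (L 2)^-1 - (L N)^-1.
      rewrite -[RHS]opprB -(telescope_sumr (fun n => (L n)^-1)) ?(ltnW N2) // -sumrN.
      by apply: eq_bigr => n _; rewrite opprB.
    by rewrite gerBl invr_ge0 lnn_ge0.
  by exists l; apply: cvg_seqS Hl.
have cG : cvgn G.
  apply/cvg_ex.
  have /cvg_ex[l Hl] : cvgn (fun N => \sum_(2 <= n < N) g n).
    apply: (@sum_cvg_bounded _ (fun n => (L 2)^-2 * ((n%:R : R) * (n%:R - 1))^-1) _ ((L 2)^-2 * 1)).
      move=> n n2; have a0 := l0 n n2; have b0 := l0 n.+1 (ltnW n2).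
      have h := lnnS_le R (ltnW n2).
      have ab : L n <= L n.+1 by rewrite ler_lnn //; lia.
      have h2 : L 2 <= L n by rewrite ler_lnn.
      rewrite /g -ln_div ?posrE //; set a := L n in a0 h ab h2 *; set b := L n.+1 in b0 h ab *.
      have H1 := ln_geB1 (divr_gt0 b0 a0); have H2 := ln_leB1 (divr_gt0 b0 a0).
      rewrite invf_div in H1.
      rewrite ger0_norm; last by lra.
      (* Both bounds on [ln (b / a)] agree to first order; their gap is [(b - a)^2 / (a b)], of
         order [n^-2] because [b - a <= 1 / n]. *)
      apply: le_trans (_ : (b - a) ^+ 2 * (a * b)^-1 <= _).
        rewrite (_ : (b - a) ^+ 2 / (a * b) = b / a - 1 - (1 - a / b)); last by field; rewrite !gt_eqF.
        by rewrite lerD2r.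
      rewrite mulrC; apply: ler_pM; rewrite ?sqr_ge0 ?invr_ge0 ?mulr_ge0 ?(ltW a0) ?(ltW b0) //.
        have p2 : 0 < L 2 ^+ 2 by rewrite exprn_gt0 // l0.
        rewrite lef_pV2 ?posrE ?p2 ?mulr_gt0 // expr2.
        by apply: ler_pM; rewrite ?lnn_ge0 ?(le_trans h2).
      apply: le_trans (_ : (n%:R^-1) ^+ 2 <= _).
        by rewrite ler_sqr ?nnegrE ?invr_ge0 ?subr_ge0.
      have n1 : 0 < n%:R - 1 :> R by rewrite subr_gt0 ltr1n.
      have n0 : 0 < n%:R :> R by rewrite ltr0n; lia.
      by rewrite exprVn lef_pV2 ?posrE ?exprn_gt0 ?mulr_gt0 // expr2 ler_pM2l //; lra.
    by move=> N; rewrite -mulr_sumr ler_wpM2l ?sum_invMB1 // invr_ge0 exprn_ge0 // lnn_ge0.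
  by exists l; apply: cvg_seqS Hl.
have cr : r N / L N.+1 @[N --> \oo] --> (0 : R).
  apply: (@cvg_squeeze0 _ (fun N => C * (L N.+1)^-1)).
    near=> N; rewrite normrM (gtr0_norm (_ : 0 < (L N.+1)^-1)); last first.
      by rewrite invr_gt0 l0 // ltnS; near: N; exact: nbhs_infty_gt.
    rewrite ler_wpM2r ?invr_ge0 ?lnn_ge0 // rC //.
    by near: N; exact: nbhs_infty_gt.
  rewrite -(mulr0 C); apply: cvgM; first exact: cvg_cst.
  by apply: (@cvg_seqS (fun n => (L n)^-1)); exact: cvgn_invlnn.
have : cvgn (fun N => E1 N + (L N / L N.+1 + r N / L N.+1) + S2 N - G N
    + (ln (L N.+1) - ln (L N)) - ln (L 2)).
  apply: is_cvgB; last exact: is_cvg_cst.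
  apply: is_cvgD; last by apply/cvg_ex; exists 0; exact: cvgn_lnlnS.
  apply: is_cvgB => //; apply: is_cvgD => //; apply: is_cvgD => //.
  apply: is_cvgD; apply/cvg_ex; first by exists 1; exact: cvgn_lnratio.
  by exists 0.
move=> /cvg_ex[l Hl]; apply/cvg_ex; exists l; apply: cvg_near_eq Hl.
near=> N; rewrite dec //.
by near: N; exact: nbhs_infty_ge.
Unshelve. all: by end_near. Qed.

Definition harm (N : nat) : R := \sum_(1 <= k < N.+1) k%:R^-1.

Lemma harm_ge N : L N.+1 <= harm N.
Proof.
elim: N => [|N IH]; first by rewrite ln1 /harm big_geq.
rewrite /harm big_nat_recr //= -/(harm N).
move: (lnnS_le R (isT : 0 < N.+1)%N) IH.
by move: (ln N.+2%:R) (ln N.+1%:R) (N.+1%:R^-1) => a b c; lra.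
Qed.

Lemma euler_gamma_cvg : harm N - L N @[N --> \oo] --> euler_gamma R.
Proof.
rewrite /euler_gamma; apply: (@near_nonincreasing_is_cvgn _ _ 0).
  (* Monotonicity starts at 1: at 0 the sequence is 0 because [ln 0 = 0], and at 1 it is 1. *)
  exists 1%N => // k /= k1; suff H n : (1 <= n)%N -> harm n.+1 - L n.+1 <= harm n - L n.
    move=> n kn; elim: n kn => [|n IH]; first by lia.
    rewrite leq_eqVlt => /orP[/eqP->//|kn].
    by apply: le_trans (IH kn); apply: H; lia.
  move=> n1; rewrite /harm big_nat_recr //= -/(harm n).
  move: (lnnS_ge R n1).
  by move: (ln n.+1%:R) (ln n%:R) (n.+1%:R^-1) => a b c; lra.
near=> n; rewrite subr_ge0 (le_trans _ (harm_ge n)) // ler_lnn //.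
by near: n; exact: nbhs_infty_gt.
Unshelve. all: by end_near. Qed.

End Mertens2.

(** * Partial Euler products through divisor sums *)

Section SmoothNumbers.
Variable R : realType.
Implicit Types (N K : nat) (g : nat -> R).

Lemma ler_sum_sub (T : eqType) (s t : seq T) (f : T -> R) : uniq s -> uniq t ->
  {subset s <= t} -> (forall x, 0 <= f x) -> \sum_(x <- s) f x <= \sum_(x <- t) f x.
Proof.
move=> us ut st f0.
have P : perm_eq t (s ++ [seq x <- t | x \notin s]).
  apply: uniq_perm => //.
    rewrite cat_uniq us filter_uniq // andbT /=; apply/hasPn => x.
    by rewrite mem_filter => /andP[].
  move=> x; rewrite mem_cat mem_filter.
  by case: (boolP (x \in s)) => //= /st ->.
by rewrite (perm_big _ P) big_cat /= lerDl sumr_ge0.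
Qed.

(** Weierstrass product inequality; the induction also has to keep the product in [[0, 1]]. *)
Lemma ge1_prod_sub (s : seq nat) (x : nat -> R) : (forall i, i \in s -> 0 <= x i <= 1) ->
  1 - \sum_(i <- s) x i <= \prod_(i <- s) (1 - x i).
Proof.
move=> x01; suff [H _] : 1 - \sum_(i <- s) x i <= \prod_(i <- s) (1 - x i) /\
   0 <= \prod_(i <- s) (1 - x i) <= 1 by [].
elim: s x01 => [|a s IH] x01; first by rewrite !big_nil; split; lra.
have /andP[a0 a1] := x01 a (mem_head _ _).
have [i|H1 /andP[H2 H3]] := IH.
  by move=> is_; apply: x01; rewrite in_cons is_ orbT.
rewrite !big_cons; set P := \prod_(_ <- _) _ in H1 H2 H3 *; set S := \sum_(_ <- _) _ in H1 *.
by split; [nra|apply/andP; split; nra].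
Qed.

(** Its divisors are the integers with prime factors at most [N] and exponents at most [K], so its
    divisor sums are truncated Euler products. *)
Definition primepow_prod N K := (\prod_(0 <= p < N.+1 | prime p) p ^ K)%N.

Lemma primepow_prod_gt0 N K : (0 < primepow_prod N K)%N.
Proof.
rewrite /primepow_prod big_mkcond; apply: prodn_gt0 => p.
by case: ifP => // /prime_gt0 p0; rewrite expn_gt0 p0.
Qed.

Lemma sum_divisors_primepow g N K : completely_mult g ->
  \sum_(d <- divisors (primepow_prod N K)) g d =
  \prod_(0 <= p < N.+1 | prime p) \sum_(i < K.+1) g p ^+ i.
Proof.
move=> gM; elim: N => [|N IH].
  rewrite (_ : primepow_prod 0 K = 1%N); last by rewrite /primepow_prod big_mkcond big_nat1.
  rewrite [RHS]big_mkcond big_nat1 /=.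
  by rewrite (_ : divisors 1 = [:: 1%N]) // big_seq1; case: gM.
have -> : (primepow_prod N.+1 K = primepow_prod N K * (if prime N.+1 then N.+1 ^ K else 1))%N.
  by rewrite /primepow_prod big_mkcond big_nat_recr //= -big_mkcond.
rewrite [RHS]big_mkcond big_nat_recr //= -big_mkcond /= -IH.
case: ifP => [pN|_]; last by rewrite muln1 mulr1.
rewrite sum_divisors_coprime ?primepow_prod_gt0 ?expn_gt0 // ?sum_divisorsX //.
apply: coprimeXr; rewrite coprime_sym /primepow_prod big_nat_cond.
apply: (big_ind (fun x => coprime N.+1 x)) => [|x y|p]; first exact: coprimen1.
  by rewrite coprimeMr => -> ->.
move=> /andP[/andP[_ pN1] pp]; apply: coprimeXr; rewrite prime_coprime //.
by apply/negP => /dvdn_leq; rewrite prime_gt0 // => /(_ isT); lia.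
Qed.

Lemma sum_divisors_le g n : (0 < n)%N -> (forall m, 0 <= g m) ->
  \sum_(d <- divisors n) g d <= \sum_(1 <= d < n.+1) g d.
Proof.
move=> n0 g0; apply: ler_sum_sub => //; rewrite ?divisors_uniq ?iota_uniq // => d.
rewrite -dvdn_divisors // mem_index_iota => dn.
by rewrite (dvdn_gt0 n0 dn) ltnS dvdn_leq.
Qed.

(** Every positive [d <= M] divides [primepow_prod M M], since its exponents are smaller than
    [d]. *)
Lemma sum_le_primepow g M : (forall m, 0 <= g m) ->
  \sum_(1 <= d < M.+1) g d <= \sum_(d <- divisors (primepow_prod M M)) g d.
Proof.
move=> g0; apply: ler_sum_sub => //; rewrite ?divisors_uniq ?iota_uniq // => d.
rewrite mem_index_iota -dvdn_divisors ?primepow_prod_gt0 // => /andP[d0 dM].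
have {}dM : (d <= M)%N by [].
rewrite -(partnT d0) (widen_partn _ dM) (eq_bigl xpredT) // /primepow_prod.
rewrite [X in (_ %| X)%N]big_mkcond /=.
apply: (big_ind2 (fun x y => x %| y)%N) => // [x1 x2 y1 y2|p _]; first exact: dvdn_mul.
case: ifP => pp; last by rewrite lognE pp.
by rewrite dvdn_exp2l // ltnW // (leq_trans (ltn_logl _ d0)).
Qed.

Lemma geom_sum (x : R) K : x != 1 -> \sum_(i < K.+1) x ^+ i = (1 - x ^+ K.+1) / (1 - x).
Proof.
move=> x1; have x1' : 1 - x != 0 by rewrite subr_eq0 eq_sym.
apply: (mulIf x1'); rewrite divfK // mulrC -[X in _ = X]opprB subrX1 -mulNr opprB.
by [].
Qed.

Lemma euler_ge g M : completely_mult g -> (forall m, 0 <= g m) -> (forall p, prime p -> g p < 1) ->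
  \sum_(1 <= d < M.+1) g d <= \prod_(0 <= p < M.+1 | prime p) (1 - g p)^-1.
Proof.
move=> gM g0 g1; apply: le_trans (sum_le_primepow M g0) _.
rewrite sum_divisors_primepow //; apply: ler_prod => p pp.
have H : 0 < 1 - g p by rewrite subr_gt0 g1.
rewrite geom_sum ?lt_eqF ?g1 //; apply/andP; split.
  by rewrite divr_ge0 ?(ltW H) // subr_ge0 exprn_ile1 // ltW ?g1.
by rewrite ler_piMl ?invr_ge0 ?(ltW H) // gerBl exprn_ge0.
Qed.

(** Truncation multiplies the Euler factor of [p] by [1 - g p ^+ K.+1]. There are at most [N] such
    factors, which together lose at most [N * c]. *)
Lemma primepow_ge g N K (c : R) : completely_mult g -> (forall m, 0 <= g m) ->
  (forall p, prime p -> g p < 1) -> (forall p, prime p -> g p ^+ K.+1 <= c) -> c <= 1 ->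
  (1 - N%:R * c) * \prod_(0 <= p < N.+1 | prime p) (1 - g p)^-1 <=
  \sum_(d <- divisors (primepow_prod N K)) g d.
Proof.
move=> gM g0 g1 gc c1.
have c0 : 0 <= c by apply: le_trans (gc 2%N isT); rewrite exprn_ge0.
rewrite sum_divisors_primepow //.
rewrite [X in _ <= X](eq_bigr (fun p => (1 - g p ^+ K.+1) * (1 - g p)^-1)); last first.
  by move=> p pp; rewrite geom_sum // lt_eqF ?g1.
rewrite big_split /= ler_wpM2r //.
  by apply: prodr_ge0 => p pp; rewrite invr_ge0 subr_ge0 ltW ?g1.
rewrite -big_filter.
set s := [seq _ <- _ | _]; have ps p : p \in s -> prime p by rewrite mem_filter => /andP[].
apply: le_trans (ge1_prod_sub _); last first.
  by move=> p /ps pp; rewrite exprn_ge0 //= (le_trans (gc p pp)).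
rewrite lerD2l lerN2.
apply: le_trans (_ : \sum_(p <- s) c <= _).
  by rewrite !big_seq; apply: ler_sum => p /ps; exact: gc.
rewrite big_const_seq count_predT iter_addr_0 -[c *+ _]mulr_natl ler_wpM2r // ler_nat.
have -> : N = size (index_iota 1 N.+1) by rewrite size_iota subn1.
apply: uniq_leq_size; first by rewrite filter_uniq // iota_uniq.
by move=> p; rewrite mem_filter !mem_index_iota => /andP[/prime_gt0 -> /andP[_ ->]].
Qed.

(** For fixed [N] the truncation loss [N * 2^-(K+1)] vanishes as [K] grows, and each truncated
    product is a finite subsum of the series. *)
Lemma euler_le g N (Z : R) : completely_mult g -> (forall m, 0 <= g m) ->
  (forall p, prime p -> g p <= 2^-1) -> (forall M, \sum_(1 <= d < M.+1) g d <= Z) ->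
  \prod_(0 <= p < N.+1 | prime p) (1 - g p)^-1 <= Z.
Proof.
move=> gM g0 g1 gZ; set P := \prod_(_ <= _ < _ | _) _.
have lim : (1 - N%:R * 2^-1 ^+ K.+1) * P @[K --> \oo] --> (1 - N%:R * 0) * P.
  apply: cvgM; last exact: cvg_cst.
  apply: cvgB; first exact: cvg_cst.
  apply: cvgM; first exact: cvg_cst.
  apply: (@cvg_seqS _ (fun K => 2^-1 ^+ K)); apply: cvg_expr.
  by rewrite ger0_norm; lra.
rewrite mulr0 subr0 mul1r in lim.
apply: (cvgr_to_le lim); near=> K.
apply: le_trans (_ : \sum_(d <- divisors (primepow_prod N K)) g d <= _).
  apply: primepow_ge => // [p pp|p pp|].
  - by apply: le_lt_trans (g1 p pp) _; lra.
  - by apply: lerXn2r; rewrite ?nnegrE ?g0 ?g1 //; lra.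
  - by apply: exprn_ile1; lra.
by apply: le_trans (sum_divisors_le _ g0) (gZ _); rewrite primepow_prod_gt0.
Unshelve. all: by end_near. Qed.

End SmoothNumbers.

(** * The logarithmic series with remainder *)

Section LnSeries.
Variable R : realType.

(** Partial sum of the series of [- ln (1 - x)], as a polynomial to be differentiated formally. Its
    constant term is 0 because [0^-1 = 0]. *)
Definition lnpoly K : {poly R} := \poly_(k < K.+1) k%:R^-1.

Lemma horner_lnpoly K (x : R) : (lnpoly K).[x] = \sum_(1 <= k < K.+1) x ^+ k / k%:R.
Proof.
rewrite horner_poly -(big_mkord xpredT (fun k => k%:R^-1 * x ^+ k)) big_ltn //.
by rewrite invr0 mul0r add0r; apply: eq_bigr => k _; rewrite mulrC.
Qed.

Lemma horner_lnpoly0 K : (lnpoly K).[0] = 0.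
Proof. by rewrite horner_coef0 coef_poly invr0. Qed.

Lemma horner_deriv_lnpoly K (x : R) : x != 1 -> (lnpoly K)^`().[x] = (1 - x ^+ K) / (1 - x).
Proof.
move=> x1; have -> : (lnpoly K)^`() = \poly_(k < K) 1.
  apply/polyP => i; rewrite coef_deriv !coef_poly ltnS; case: ifP => _; last by rewrite mul0rn.
  by rewrite -[LHS]mulr_natl divff // pnatr_eq0.
rewrite horner_poly; case: K => [|K]; first by rewrite big_ord0 expr0 subrr mul0r.
by rewrite -geom_sum //; apply: eq_bigr => i _; rewrite mul1r.
Qed.

(** Mean value theorem on [[0, x]] for the remainder [phi], whose derivative is
    [y ^+ K / (1 - y)]. *)
Lemma ln_series_bounds K (x : R) : 0 <= x < 1 ->
  0 <= - ln (1 - x) - \sum_(1 <= k < K.+1) x ^+ k / k%:R <= x ^+ K.+1 / (1 - x).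
Proof.
move=> /andP[]; rewrite le_eqVlt => /orP[/eqP <- _|x0 x1].
  by rewrite subr0 ln1 oppr0 exprS mul0r mul0r -horner_lnpoly horner_lnpoly0 subrr lexx.
pose phi y := - ln (1 - y) - (lnpoly K).[y].
pose dphi (y : R) := y ^+ K / (1 - y).
have D (y : R) : y < 1 -> is_derive y 1 phi (dphi y).
  move=> y1; have y1' : 0 < 1 - y by rewrite subr_gt0.
  have d1 : is_derive y 1 (fun z : R => 1 - z) (- 1).
    have d0 := is_deriveB (is_derive_cst (1 : R) y (1 : R)) (is_derive_id y (1 : R)).
    by apply: (is_derive_eq d0); rewrite sub0r.
  have d2 := @is_derive1_ln R _ y1'.
  have d3 := @is_derive1_comp R (@ln R) (fun z : R => 1 - z) y _ _ d2 d1.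
  have d4 := is_deriveB (is_deriveN d3) (is_derive_poly (lnpoly K) y).
  apply: (is_derive_eq d4); rewrite horner_deriv_lnpoly ?lt_eqF // /dphi.
  rewrite /GRing.scale /=; field; exact: lt0r_neq0.
have [c] : exists2 c, c \in `]0, x[%R & phi x - phi 0 = dphi c * (x - 0).
  apply: MVT => // [y|]; first by rewrite in_itv /= => /andP[_ yx]; apply: D; lra.
  apply: derivable_within_continuous => y; rewrite in_itv /= => /andP[_ yx].
  by have [] := D y (le_lt_trans yx x1).
rewrite in_itv /= => /andP[c0 cx].
have -> : phi 0 = 0 by rewrite /phi subr0 ln1 horner_lnpoly0 oppr0 addr0.
rewrite !subr0 /phi horner_lnpoly => ->.
rewrite /dphi; apply/andP; split.
  by rewrite mulr_ge0 ?divr_ge0 ?exprn_ge0 //; lra.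
rewrite exprSr mulrAC; apply: ler_pM.
- by rewrite mulr_ge0 ?exprn_ge0 //; lra.
- by rewrite invr_ge0; lra.
- by rewrite ler_pM2r // lerXn2r ?nnegrE //; lra.
- by rewrite lef_pV2 ?posrE; lra.
Qed.

End LnSeries.

Local Opaque expR ln.

(** * The constant in Mertens' third theorem *)

Section Constant.
Variable R : realType.
Implicit Types (n N p M K : nat).
Local Notation L n := (ln (n%:R : R)).

Lemma cvg_trunc_log : trunc_log 2 n @[n --> \oo] --> \oo.
Proof.
move=> A [K _ HK]; exists (2 ^ K)%N => // n /= Kn; apply: HK => /=.
by apply: trunc_log_max.
Qed.

(* The subtracted term jumps by [1/k] exactly at [2 ^ k], so its transform
   against [npow delta] is the series of [- ln (1 - 2 ^ - delta)]. *)
Definition Dseq n : R := Bsum R n - harm R (trunc_log 2 n).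

(** [trunc_log 2 n] differs from [ln n / ln 2] by at most 1. *)
Lemma cvg_ln_trunc_log : ln (trunc_log 2 n)%:R - ln (L n) @[n --> \oo] --> (- ln (L 2) : R).
Proof.
have l2 : 0 < L 2 by apply: lnn_gt0.
have H : (trunc_log 2 n)%:R / L n @[n --> \oo] --> ((L 2)^-1 : R).
  have H1 : ((L 2)^-1 - (L n)^-1) @[n --> \oo] --> ((L 2)^-1 - 0 : R).
    by apply: cvgB; [exact: cvg_cst|exact: cvgn_invlnn].
  rewrite subr0 in H1.
  apply: (@squeeze_cvgr _ \oo _ _ _ (fun=> (L 2)^-1) _ _ _ H1); last exact: cvg_cst.
  near=> n.
  have n1 : (1 < n)%N by near: n; exact: nbhs_infty_gt.
  have ln0 : 0 < L n by apply: lnn_gt0.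
  have h1 : (trunc_log 2 n)%:R * L 2 <= L n.
    by rewrite -lnnX // ler_lnn ?expn_gt0 // trunc_logP // ltnW.
  have h2 : L n <= (trunc_log 2 n).+1%:R * L 2.
    rewrite -lnnX // ler_lnn ?(ltnW n1) // ltnW //; exact: trunc_log_ltn.
  apply/andP; split; last first.
    by rewrite ler_pdivrMr // mulrC ler_pdivlMr.
  rewrite ler_pdivlMr // mulrBl mulVf ?gt_eqF // lerBlDr.
  by rewrite mulrC ler_pdivrMr // natr1.
have H2 : ln ((trunc_log 2 n)%:R / L n) @[n --> \oo] --> (ln ((L 2)^-1) : R).
  by apply: (cvg_comp _ _ H); apply: continuous_ln; rewrite invr_gt0.
rewrite lnV ?posrE // in H2; apply: cvg_near_eq H2; near=> n.
have n1 : (1 < n)%N by near: n; exact: nbhs_infty_gt.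
rewrite ln_div ?posrE ?lnn_gt0 // ltr0n trunc_log_gt0.
by rewrite /=; lia.
Unshelve. all: by end_near. Qed.

Lemma cvg_Dseq c : Bsum R N - ln (L N) @[N --> \oo] --> c ->
  Dseq @ \oo --> (c - euler_gamma R + ln (L 2) : R).
Proof.
move=> Hc.
have H := cvg_comp _ _ cvg_trunc_log (@euler_gamma_cvg R).
have key : (Bsum R n - ln (L n)) - (harm R (trunc_log 2 n) - L (trunc_log 2 n))
    - (L (trunc_log 2 n) - ln (L n)) @[n --> \oo] --> (c - euler_gamma R - - ln (L 2) : R).
  by apply: cvgB; [apply: cvgB|exact: cvg_ln_trunc_log].
rewrite opprK in key; apply: cvg_near_eq key; apply: nearW => n.
rewrite /Dseq; ring.
Qed.

(** Bounds the weight carried by the initial segment [i <= n], whichever of [M] and [n] is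
    larger. *)
Lemma telescope_trunc_le (u : nat -> R) n M :
  (forall i j, (0 < i)%N -> (i <= j)%N -> u j <= u i) ->
  \sum_(1 <= i < M.+1) (if (i <= n)%N then u i - u i.+1 else 0) <= u 1%N - u n.+1.
Proof.
move=> mono.
suff H : \sum_(1 <= i < M.+1) (if (i <= n)%N then u i - u i.+1 else 0)
    <= u 1%N - u (minn M n).+1.
  by apply: le_trans H _; rewrite lerD2l lerN2 mono // ltnS geq_minr.
elim: M => [|m IH]; first by rewrite big_geq // min0n subrr.
rewrite big_nat_recr //=; case: ifP => mN.
  apply: le_trans (lerD IH (lexx _)) _.
  rewrite (minn_idPl mN) (minn_idPl (ltnW mN)).
  by move: (u m.+1) (u m.+2) => a b; lra.
rewrite addr0; apply: le_trans IH _; rewrite lerD2l lerN2 mono // ltnS.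
by rewrite leq_min geq_minr andbT geq_min leqnSn.
Qed.

Section Delta.
Variable delta : R.
Hypothesis d0 : 0 < delta.

Definition npow n : R := expR (- (delta * L n)).
Definition zterm n : R := expR (- ((1 + delta) * L n)).

Lemma npow_gt0 n : 0 < npow n. Proof. exact: expR_gt0. Qed.

Lemma npow_le1 n : npow n <= 1.
Proof. by rewrite expR_le1 oppr_le0 mulr_ge0 ?lnn_ge0 // ltW. Qed.

Lemma npow1 : npow 1 = 1.
Proof. by rewrite /npow ln1 mulr0 oppr0 expR0. Qed.

Lemma npow_mono m n : (0 < m)%N -> (m <= n)%N -> npow n <= npow m.
Proof. by move=> m0 mn; rewrite ler_expR lerN2 ler_pM2l // ler_lnn. Qed.

Lemma npow_ge n : 1 - npow n <= delta * L n.
Proof. by rewrite lerBlDr -lerBlDl; exact: expR_ge1Dx. Qed.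

Lemma zterm_completely_mult : completely_mult zterm.
Proof.
split=> [|a b a0 b0]; first by rewrite /zterm ln1 mulr0 oppr0 expR0.
by rewrite /zterm lnnM // mulrDr opprD expRD.
Qed.

Lemma zterm_ge0 n : 0 <= zterm n. Proof. exact: expR_ge0. Qed.

Lemma ztermE n : (0 < n)%N -> zterm n = npow n / n%:R.
Proof.
move=> n0; rewrite /zterm mulrDl mul1r opprD expRD mulrC; congr (_ * _).
by rewrite expRN lnK // posrE ltr0n.
Qed.

Lemma zterm_le n : prime n -> zterm n <= 2^-1.
Proof.
move=> pn; rewrite ztermE ?prime_gt0 //.
rewrite -[leRHS]mul1r; apply: ler_pM; rewrite ?npow_le1 ?invr_ge0 ?(ltW (npow_gt0 _)) //.
by rewrite lef_pV2 ?posrE ?ltr0n ?prime_gt0 // (ler_nat _ 2) prime_gt1.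
Qed.

(** A discrete comparison of [n^(-1-delta)] with its integral, from [1 + t <= expR t] and
    [1/(n+1) <= ln (n+1) - ln n <= 1/n]. *)
Lemma npow_diff n : (0 < n)%N ->
  delta * zterm n.+1 <= npow n - npow n.+1 <= delta * zterm n.
Proof.
move=> n0; rewrite !ztermE // /npow.
set u := L n; set w := L n.+1.
have h1 := lnnS_le R n0; have h2 := lnnS_ge R n0; rewrite -/u -/w in h1 h2.
have eu := expR_gt0 (- (delta * u)); have ew := expR_gt0 (- (delta * w)).
have E1 : expR (- (delta * w)) = expR (- (delta * u)) * expR (- (delta * (w - u))).
  by rewrite -expRD; congr expR; ring.
have E2 : expR (- (delta * u)) = expR (- (delta * w)) * expR (delta * (w - u)).
  by rewrite -expRD; congr expR; ring.
apply/andP; split.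
  rewrite E2 -[X in _ <= _ - X]mulr1 -mulrBr mulrCA ler_pM2l //.
  have := expR_ge1Dx (delta * (w - u)).
  have : delta / n.+1%:R <= delta * (w - u) by rewrite ler_pM2l.
  by move: (delta * (w - u)) (delta / _) => a b; lra.
rewrite E1 -[X in X - _]mulr1 -mulrBr mulrCA ler_pM2l //.
have := expR_ge1Dx (- (delta * (w - u))).
have : delta * (w - u) <= delta / n%:R by rewrite ler_pM2l.
by move: (delta * (w - u)) (delta / _) => a b; lra.
Qed.

(** Telescoping [npow_diff]; with [zeta_ge] this describes the pole of zeta at 1 as
    [zeta(1 + delta) = 1/delta + O(1)]. *)
Lemma zeta_le M : \sum_(1 <= n < M.+1) zterm n <= 1 + delta^-1.
Proof.
case: M => [|M]; first by rewrite big_geq // addr_ge0 // invr_ge0 ltW.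
suff H : \sum_(1 <= n < M.+2) zterm n <= 1 + delta^-1 * (1 - npow M.+1).
  apply: le_trans H _; rewrite lerD2l ler_piMr ?invr_ge0 ?(ltW d0) //.
  by rewrite gerBl (ltW (npow_gt0 _)).
elim: M => [|M IH].
  by rewrite big_nat1 npow1 subrr mulr0 addr0; case: zterm_completely_mult => ->.
rewrite big_nat_recr //=; have /andP[h _] := npow_diff (isT : 0 < M.+1)%N.
have {}h : zterm M.+2 <= delta^-1 * (npow M.+1 - npow M.+2) by rewrite mulrC ler_pdivlMr // mulrC.
apply: le_trans (lerD IH h) _; rewrite -addrA -mulrDr; rewrite le_eqVlt; apply/orP; left; apply/eqP; congr (_ + _ * _); ring.
Qed.

Lemma zeta_ge M : (1 - npow M.+1) / delta <= \sum_(1 <= n < M.+1) zterm n.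
Proof.
elim: M => [|M IH]; first by rewrite big_geq // npow1 subrr mul0r.
rewrite big_nat_recr //=; have /andP[_ h] := npow_diff (isT : 0 < M.+1)%N.
have {}h : (npow M.+1 - npow M.+2) / delta <= zterm M.+1 by rewrite ler_pdivrMr // mulrC.
apply: le_trans (lerD IH h); rewrite -mulrDl; rewrite le_eqVlt; apply/orP; left; apply/eqP; congr (_ / _); ring.
Qed.

Definition lnEuler M : R := \sum_(0 <= p < M.+1 | prime p) - ln (1 - zterm p).

Lemma lnEuler_prod M :
  lnEuler M = ln (\prod_(0 <= p < M.+1 | prime p) (1 - zterm p)^-1).
Proof.
rewrite /lnEuler -[LHS]big_filter -[X in ln X]big_filter.
have : all prime [seq i <- index_iota 0 M.+1 | prime i] by exact: filter_all.
elim: [seq _ <- _ | _] => [|p s IH] /=; first by rewrite !big_nil ln1.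
have pos q : prime q -> 0 < (1 - zterm q)^-1 :> R.
  by move=> /zterm_le h; rewrite invr_gt0 subr_gt0 (le_lt_trans h) //; lra.
move=> /andP[pp ps]; rewrite !big_cons IH // lnM ?posrE ?pos //.
  by rewrite lnV // posrE -invr_gt0 pos.
by rewrite big_seq; apply: prodr_gt0 => q qs; apply: pos; exact: (allP ps).
Qed.

Lemma lnEuler_le M : lnEuler M <= ln (1 + delta^-1).
Proof.
rewrite lnEuler_prod ler_lnS //.
  apply: prodr_gt0 => p pp; rewrite invr_gt0 subr_gt0 (le_lt_trans (zterm_le pp)) //; lra.
apply: euler_le; [exact: zterm_completely_mult|exact: zterm_ge0|exact: zterm_le|exact: zeta_le].
Qed.

Lemma lnEuler_ge M : (0 < M)%N -> ln ((1 - npow M.+1) / delta) <= lnEuler M.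
Proof.
move=> M0; rewrite lnEuler_prod ler_lnS //.
  rewrite divr_gt0 // subr_gt0 expR_lt1 oppr_lt0 mulr_gt0 // lnn_gt0 //.
apply: le_trans (zeta_ge M) _; apply: euler_ge.
- exact: zterm_completely_mult.
- exact: zterm_ge0.
- by move=> p pp; apply: le_lt_trans (zterm_le pp) _; lra.
Qed.

Definition Gsum M : R := \sum_(0 <= p < M.+1 | prime p) lnfactor R p * npow p.

(* Both [- y ln (1 - x)] and [- ln (1 - x y)] are [x y] up to a second order
   term, and they agree at [y = 1]; here [x = 1/p], [y = p^-delta]. *)
Lemma Gsum_lnEuler M : `|Gsum M - lnEuler M| <= delta * (L 2 + 1).
Proof.
rewrite /Gsum /lnEuler -sumrB; apply: le_trans (ler_norm_sum _ _ _) _.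
apply: le_trans (_ : delta * \sum_(2 <= p < M.+1) L p / (p%:R * (p%:R - 1)) <= _); last first.
  by rewrite ler_pM2l // sum_ln_le.
rewrite mulr_sumr sump2 !big_nat; apply: ler_sum => p /andP[p1 _].
have p0' : 0 < p%:R :> R by rewrite ltr0n; lia.
have p1' : 0 < p%:R - 1 :> R by rewrite subr_gt0 ltr1n.
case: ifP => [pp|_]; last first.
  by apply: mulr_ge0 (ltW d0) _; rewrite divr_ge0 ?lnn_ge0 // mulr_ge0 // ltW.
apply: le_trans (_ : (1 - npow p) * (p%:R * (p%:R - 1))^-1 <= _); last first.
  rewrite mulrA; apply: ler_wpM2r (npow_ge p).
  by rewrite invr_ge0 mulr_ge0 // ltW.
rewrite /lnfactor opprK ztermE ?prime_gt0 //.
have := npow_le1 p; have := npow_gt0 p; move: (npow p) => y y0 y1.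
set x : R := p%:R^-1.
have x1 : x < 1 by rewrite invf_lt1 // ltr1n.
have x0 : 0 < x by rewrite invr_gt0.
have -> : (p%:R * (p%:R - 1))^-1 = x ^+ 2 / (1 - x).
  by rewrite /x; field; rewrite !gt_eqF.
clearbody x.
have xy : x * y < 1 by apply: le_lt_trans x1; rewrite ler_piMr // ltW.
have hx : 0 < 1 - x by lra.
have hxy : 0 < 1 - x * y by lra.
have qpos : 0 < (1 - x * y) / (1 - x) by rewrite divr_gt0.
have E : - ln (1 - x) * y + ln (1 - y * x) = ln ((1 - x * y) / (1 - x)) + (1 - y) * ln (1 - x).
  by rewrite ln_div ?posrE // (mulrC y x); ring.
rewrite E.
have h1 := ln_leB1 qpos; have h2 := ln_geB1 qpos; rewrite invf_div in h2.
have h3 := ln_leB1 hx; have h4 := ln_geB1 hx.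
have yy : 0 <= 1 - y by lra.
have h5 : (1 - y) * ln (1 - x) <= (1 - y) * (1 - x - 1) by rewrite ler_wpM2l.
have h6 : (1 - y) * (1 - (1 - x)^-1) <= (1 - y) * ln (1 - x) by rewrite ler_wpM2l.
rewrite ler_norml; apply/andP; split; last first.
  have e1 : (1 - x * y) / (1 - x) - 1 + (1 - y) * (1 - x - 1) = (1 - y) * (x ^+ 2 / (1 - x)).
    by field; rewrite gt_eqF.
  by rewrite -e1; lra.
have e2 : (1 - y) * (1 - (1 - x)^-1) + (1 - y) * x = - ((1 - y) * (x ^+ 2 / (1 - x))).
  by field; rewrite gt_eqF.
have e3 : (1 - y) * x <= 1 - (1 - x) / (1 - x * y).
  rewrite (_ : 1 - _ / _ = (1 - y) * (x / (1 - x * y))); last by field; rewrite gt_eqF.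
  rewrite ler_wpM2l // ler_pdivlMr // ler_piMr ?(ltW x0) // gerBl.
  by rewrite mulr_ge0 // ltW.
by rewrite -e2; lra.
Qed.

(** The increment at [n = 1] vanishes because [trunc_log 2 0 = 0]. *)
Definition Hsum M : R :=
  \sum_(1 <= n < M.+1) (harm R (trunc_log 2 n) - harm R (trunc_log 2 n.-1)) * npow n.

Lemma npow_expn K : npow (2 ^ K)%N = npow 2 ^+ K.
Proof. by rewrite /npow lnnX // -expRM_natl; congr expR; ring. Qed.

Lemma Hsum_pow K : Hsum (2 ^ K.+1).-1 = \sum_(1 <= k < K.+1) npow 2 ^+ k / k%:R.
Proof.
rewrite /Hsum prednK ?expn_gt0 //; elim: K => [|K IH].
  by rewrite expn1 big_nat1 !big_geq //= subrr mul0r.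
(* In the block from [2 ^ K.+1] up to [2 ^ K.+2] only the first index carries an increment, namely
   [1 / K.+1]. *)
rewrite (big_cat_nat _ (n := 2 ^ K.+1)) /=; last 2 first.
- by rewrite expn_gt0.
- by rewrite leq_exp2l.
rewrite IH [RHS]big_nat_recr //=; congr (_ + _).
rewrite big_ltn ?ltn_exp2l // [X in _ + X]big1_seq ?addr0 => [|i /andP[_]].
  rewrite npow_expn mulrC; congr (_ * _).
  have -> : trunc_log 2 (2 ^ K.+1) = K.+1 by exact: trunc_expnK.
  have -> : trunc_log 2 (2 ^ K.+1).-1 = K.
    apply: trunc_log_eq => //; rewrite prednK ?expn_gt0 // leqnn andbT.
    by rewrite -ltnS prednK ?expn_gt0 // ltn_exp2l.
  by rewrite /harm big_nat_recr //= addrAC subrr add0r.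
rewrite mem_index_iota => /andP[i1 i2].
have -> : trunc_log 2 i = K.+1 by apply: trunc_log_eq => //; rewrite i2 ltnW.
have -> : trunc_log 2 i.-1 = K.+1 by apply: trunc_log_eq => //; lia.
by rewrite subrr mul0r.
Qed.

Lemma Dseq_abel M :
  \sum_(1 <= N < M.+1) Dseq N * (npow N - npow N.+1) = Gsum M - Hsum M - Dseq M * npow M.+1.
Proof.
elim: M => [|M IH].
  rewrite big_geq // /Gsum /Hsum big_mkcond big_nat1 big_geq //= /Dseq /Bsum /harm.
  by rewrite big_mkcond big_nat1 big_geq //= !subr0 mul0r subrr.
rewrite big_nat_recr //= IH.
have -> : Gsum M.+1 = Gsum M + (Bsum R M.+1 - Bsum R M) * npow M.+1.
  rewrite /Gsum /Bsum !(sump_recr _ _ M.+1); case: ifP => _; ring.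
have -> : Hsum M.+1 = Hsum M + (harm R (trunc_log 2 M.+1) - harm R (trunc_log 2 M)) * npow M.+1.
  by rewrite /Hsum big_nat_recr.
rewrite /Dseq; ring.
Qed.

End Delta.

(** An Abelian argument: the averages of [Dseq] with weights [npow N - npow N.+1] approach its limit
    [l], while summation by parts turns them into [Gsum - Hsum] up to a small boundary term, which
    tends to [ln (ln 2)] as [delta] goes to 0. *)
Lemma Dseq_lim (l : R) : Dseq @ \oo --> l -> l = ln (L 2).
Proof.
move=> Dl; have l2 : 0 < L 2 by apply: lnn_gt0.
have [C C0 HC] : exists2 C : R, 0 < C & forall n, `|Dseq n| <= C.
  have /cvg_has_ub[C /ubP HC] : cvgn Dseq by apply/cvg_ex; exists l.
  exists (C + 1) => [|n].
    by apply: ltr_wpDl ltr01; apply: le_trans (HC _ (imageP _ (_ : setT 0%N))).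
  by apply: ler_wpDr => //; apply: HC; exists n.
apply/eqP; rewrite -subr_eq0 -normr_le0; apply/ler_addgt0Pr => eps eps0; rewrite add0r.
pose e := eps / 4; have e0 : 0 < e by rewrite divr_gt0.
have /cvgrPdist_le/(_ e e0)[N0 _ HN0] := Dl.
pose A := C + `|l|; have A0 : 0 < A by rewrite ltr_wpDr.
(* [c1] collects the errors proportional to [delta]: the initial segment up to [N0], [Gsum_lnEuler],
   the bound [L1], and the bound [T2]. The choice of [delta] makes their sum [e]. *)
pose c1 := A * L N0.+1 + (L 2 + 1) + 1 + L 2.
have c10 : 0 < c1.
  have : 0 <= A * L N0.+1 by rewrite mulr_ge0 ?lnn_ge0 ?(ltW A0).
  by rewrite /c1; lra.
pose delta := e / c1; have d0 : 0 < delta by rewrite divr_gt0.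
pose x := npow delta 2.
have x0 : 0 < x by exact: npow_gt0.
have x1 : x < 1 by rewrite expR_lt1 oppr_lt0 mulr_gt0.
have hx : 0 < 1 - x by rewrite subr_gt0.
(* [c2] bounds the errors proportional to [X = x ^+ K.+1]: the boundary term, the missing mass times
   [l], and the logarithmic tails. Here [K] is chosen after [delta]. *)
pose c2 := A + 2 / (1 - x).
have c20 : 0 < c2 by rewrite addr_gt0 // divr_gt0.
have [K HK] : exists K, c2 * x ^+ K.+1 <= e.
  have : x ^+ K @[K --> \oo] --> (0 : R) by apply: cvg_expr; rewrite ger0_norm // ltW.
  move=> /cvgr0Pnorm_le/(_ (e / c2)) [|K _ HK]; first by rewrite divr_gt0.
  exists K; have := HK K.+1 (leqnSn K); rewrite /= ger0_norm ?exprn_ge0 ?(ltW x0) //.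
  by rewrite ler_pdivlMr // mulrC.
pose M := (2 ^ K.+1).-1.
have M1 : M.+1 = (2 ^ K.+1)%N by rewrite prednK // expn_gt0.
have eM : npow delta M.+1 = x ^+ K.+1 by rewrite M1 npow_expn.
have M0 : (0 < M)%N by rewrite -ltnS M1 (leq_ltn_trans (_ : 1 <= K.+1)%N) // ltn_expl.
set X := x ^+ K.+1 in HK eM.
have X0 : 0 < X by rewrite exprn_gt0.
have X1 : X < 1 by rewrite exprn_ilt1 // (ltW x0).
(* The weights are nonnegative with total mass [1 - X], and at most
   [1 - npow delta N0.+1] of it lies on [N <= N0]. *)
have S1 : `|\sum_(1 <= N < M.+1) Dseq N * (npow delta N - npow delta N.+1) - l * (1 - X)| <=
    A * (1 - npow delta N0.+1) + e.
  have tel : \sum_(1 <= N < M.+1) (npow delta N - npow delta N.+1) = 1 - X.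
    rewrite -[RHS]opprB -eM -(npow1 delta) -(telescope_sumr (npow delta)) // -sumrN.
    by apply: eq_bigr => N _; rewrite opprB.
  have w0 N : (0 < N)%N -> 0 <= npow delta N - npow delta N.+1.
    by move=> N1; rewrite subr_ge0 npow_mono.
  rewrite -tel mulr_sumr -sumrB.
  apply: le_trans (ler_norm_sum _ _ _) _.
  have tel2 : \sum_(1 <= N < M.+1) (if (N <= N0)%N then npow delta N - npow delta N.+1 else 0)
      <= 1 - npow delta N0.+1.
    rewrite -(npow1 delta); apply: telescope_trunc_le => i j.
    exact: npow_mono.
  apply: le_trans (_ : A * \sum_(1 <= N < M.+1) (if (N <= N0)%N then npow delta N - npow delta N.+1 else 0)
     + e * \sum_(1 <= N < M.+1) (npow delta N - npow delta N.+1) <= _); last first.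
    apply: lerD; first by rewrite ler_pM2l.
    by rewrite tel ler_piMr ?(ltW e0) // gerBl ltW.
  rewrite !mulr_sumr -big_split /= !big_nat; apply: ler_sum => N /andP[N1 _].
  rewrite -mulrBl normrM (ger0_norm (w0 N N1)).
  case: ifP => NN0.
    rewrite -mulrDl ler_wpM2r ?w0 // (le_trans (ler_normB _ _)) //.
    by apply: ler_wpDr (ltW e0) _; rewrite lerD2r.
  rewrite mulr0 add0r ler_wpM2r ?w0 // distrC.
  by apply: HN0 => /=; rewrite ltnW // ltnNge NN0.
rewrite (Dseq_abel delta M) eM /M (Hsum_pow d0) -/M in S1.
have G1 := Gsum_lnEuler d0 M.
have E1 := lnEuler_le d0 M.
have E2 := lnEuler_ge d0 M0; rewrite eM in E2.
have x01 : 0 <= x < 1 by rewrite x1 (ltW x0).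
have /andP[P1 P2] := ln_series_bounds K x01; rewrite -/x -/X in S1 P1 P2.
have DM := HC M.
have n1 := npow_ge delta N0.+1.
(* [T1] and [T2] express that [(1 - 2^(-delta)) / delta] tends to [ln 2]; this is the source of
   [ln (ln 2)]. *)
have T1 : ln (1 - x) - ln delta <= ln (L 2).
  rewrite -ln_div ?posrE // ler_lnS ?divr_gt0 // ler_pdivrMr // mulrC.
  exact: npow_ge.
have T2 : ln (L 2) - delta * L 2 <= ln (1 - x) - ln delta.
  rewrite -ln_div ?posrE // -[X in _ - X]expRK -ln_div ?posrE ?expR_gt0 //.
  rewrite ler_lnS ?divr_gt0 ?expR_gt0 // -expRN -/x ler_pdivlMr //.
  have -> : 1 - x = x * (expR (delta * L 2) - 1).
    by rewrite /x /npow mulrBr -expRD addNr expR0 mulr1.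
  rewrite (_ : L 2 * x * delta = x * (delta * L 2)); last by ring.
  by rewrite ler_pM2l // lerBrDl expR_ge1Dx.
have L1 : ln (1 + delta^-1) <= delta - ln delta.
  rewrite (_ : 1 + delta^-1 = (1 + delta) / delta); last by field; rewrite gt_eqF.
  have d1 : 0 < 1 + delta by lra.
  by rewrite ln_div ?posrE // lerD2r; have := ln_leB1 d1; lra.
have L2 : ln (1 - X) - ln delta <= ln ((1 - X) / delta).
  by rewrite -ln_div // posrE // subr_gt0.
have L3 : - (X / (1 - x)) <= ln (1 - X).
  have hX : 0 < 1 - X by rewrite subr_gt0.
  apply: le_trans (ln_geB1 hX).
  rewrite (_ : 1 - (1 - X)^-1 = - (X / (1 - X))); last by field; rewrite gt_eqF.
  rewrite lerN2 ler_pM2l // lef_pV2 ?posrE // lerD2l lerN2 /X exprS ler_piMr ?(ltW x0) //.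
  by rewrite exprn_ile1 // ltW.
have dc : delta * c1 = e by rewrite /delta divfK // gt_eqF.
have AL : A * (1 - npow delta N0.+1) <= A * (delta * L N0.+1) by rewrite ler_pM2l.
have cX : c2 * X = C * X + `|l| * X + 2 * (X / (1 - x)).
  by rewrite /c2 /A; ring.
have dc' : delta * c1 = A * (delta * L N0.+1) + delta * (L 2 + 1) + delta + delta * L 2.
  by rewrite /c1; ring.
have DX : `|Dseq M * X| <= C * X by rewrite normrM (ger0_norm (ltW X0)) ler_pM2r.
have lX : `|l * X| = `|l| * X by rewrite normrM (ger0_norm (ltW X0)).
rewrite mulrBr mulr1 in S1.
move: S1 G1 DX; rewrite !ler_norml => /andP[S1 S2] /andP[G1 G2] /andP[D1 D2].
have lX1 : l * X <= `|l| * X by rewrite -lX ler_norm.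
have lX2 : - (`|l| * X) <= l * X by rewrite -lX lerNl -normrN ler_norm.
have e4 : eps = 4 * e by rewrite /e; field.
rewrite dc' in dc.
by rewrite e4; apply/andP; split; lra.
Qed.

Theorem mertens3 : Bsum R N - ln (L N) @[N --> \oo] --> euler_gamma R.
Proof.
have /cvg_ex[c Hc] := @mertens2 R.
have := Dseq_lim (cvg_Dseq Hc) => e.
by rewrite (_ : euler_gamma R = c) //; lra.
Qed.

End Constant.

(** * Gronwall's theorem *)

Section Gronwall.
Variable R : realType.
Implicit Types (n N p : nat).
Local Notation L n := (ln (n%:R : R)).
Let inv_ n : R := n%:R^-1.

Lemma invn_completely_mult : completely_mult inv_.
Proof. by split=> [|a b a0 b0]; rewrite /inv_ ?invr1 // natrM invfM. Qed.

Lemma invn_ge0 n : 0 <= inv_ n. Proof. by rewrite invr_ge0. Qed.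

Lemma invn_lt1 p : prime p -> inv_ p < 1.
Proof. by move=> pp; rewrite invf_lt1 ?ltr0n ?prime_gt0 // ltr1n prime_gt1. Qed.

Lemma sigma_divE n : (0 < n)%N ->
  (sigma n)%:R / n%:R = \sum_(d <- divisors n) inv_ d.
Proof.
move=> n0; rewrite /sigma.
have P : perm_eq (divisors n) [seq (n %/ d)%N | d <- divisors n].
  apply: uniq_perm; first exact: divisors_uniq.
    rewrite map_inj_in_uniq ?divisors_uniq // => d e.
    rewrite -!dvdn_divisors // => dn en h.
    have q0 : (0 < n %/ e)%N by rewrite divn_gt0 ?(dvdn_gt0 n0 en) // dvdn_leq.
    by apply/eqP; rewrite -(eqn_pmul2l q0) -{1}h (mulnC _ d) (mulnC _ e) !(mulnC d) !(mulnC e) !divnK.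
  move=> d; apply/idP/mapP => [dn|[e en ->]].
    rewrite -dvdn_divisors // in dn.
    exists (n %/ d)%N; first by rewrite -dvdn_divisors // dvdn_div.
    by rewrite divnA // mulKn.
  by rewrite -dvdn_divisors // in en; rewrite -dvdn_divisors // dvdn_div.
rewrite (perm_big _ P) /= big_map natr_sum mulr_suml !big_seq.
apply: eq_bigr => d; rewrite -dvdn_divisors // => dn.
have d0 := dvdn_gt0 n0 dn; have n0' : n%:R != 0 :> R by rewrite pnatr_eq0 -lt0n.
have d0' : d%:R != 0 :> R by rewrite pnatr_eq0 -lt0n.
rewrite /inv_ -{2}(divnK dn) natrM; field; rewrite d0' /=.
by rewrite pnatr_eq0 -lt0n divn_gt0 // dvdn_leq.
Qed.

Lemma lnfactor_le p : (1 < p)%N -> 0 <= lnfactor R p <= (p%:R - 1)^-1.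
Proof.
move=> p1; have /andP[h1 h2] := lnfactor_bounds R p1.
have p0' : 0 < p%:R :> R by rewrite ltr0n ltnW.
have p1' : 0 < p%:R - 1 :> R by rewrite subr_gt0 ltr1n.
have i0 : 0 < (p%:R)^-1 :> R by rewrite invr_gt0.
have e : (p%:R * (p%:R - 1))^-1 = (p%:R - 1)^-1 - p%:R^-1 :> R.
  by field; rewrite !gt_eqF.
by apply/andP; split; lra.
Qed.

Lemma expR_lnfactor_sum (s : seq nat) : all prime s ->
  expR (\sum_(p <- s) lnfactor R p) = \prod_(p <- s) (1 - inv_ p)^-1.
Proof.
elim: s => [|p s IH] /=; first by rewrite !big_nil expR0.
move=> /andP[pp ps]; rewrite !big_cons expRD IH //; congr (_ * _).
by rewrite /lnfactor expRN lnK // posrE subr_gt0 invn_lt1.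
Qed.

(** The geometric sum of each prime divisor is truncated at its exponent in [n]; completing it gives
    the full Euler factor. *)
Lemma sigma_le_prod n : (0 < n)%N ->
  (sigma n)%:R / n%:R <= expR (\sum_(p <- primes n) lnfactor R p).
Proof.
move=> n0; rewrite sigma_divE // (sum_divisorsE invn_completely_mult n0).
have pp : all prime (primes n) by apply/allP => p; rewrite mem_primes => /andP[].
rewrite expR_lnfactor_sum // !big_seq; apply: ler_prod => p /(allP pp) p_pr.
have h := invn_lt1 p_pr; have h0 := invn_ge0 p.
rewrite geom_sum ?lt_eqF //; apply/andP; split.
  by rewrite divr_ge0 ?subr_ge0 ?exprn_ile1 // ltW.
by rewrite ler_piMl ?invr_ge0 ?subr_ge0 ?(ltW h) // gerBl exprn_ge0.
Qed.

(** Prime divisors up to [N] contribute at most [Bsum R N]. If [k] of them exceed [N], then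
    [N.+1 ^ k <= n], so [k <= N.+1 / ln N.+1], and each contributes at most [1 / N]. *)
Lemma gronwall_upper_N n N : (0 < n)%N -> (0 < N)%N -> L n <= N.+1%:R ->
  (sigma n)%:R / n%:R <= expR (Bsum R N + N.+1%:R / (N%:R * L N.+1)).
Proof.
move=> n0 N0 nN; apply: le_trans (sigma_le_prod n0) _; rewrite ler_expR.
have pp : all prime (primes n) by apply/allP => p; rewrite mem_primes => /andP[].
have N0' : 0 < N%:R :> R by rewrite ltr0n.
rewrite (bigID (fun p => p <= N)%N) /=; apply: lerD.
  rewrite -big_filter /Bsum -[X in _ <= X]big_filter.
  (* [ler_sum_sub] asks for a nonnegative summand at every index, not only at primes; the maximum
     with 0 provides it. *)
  apply: (@le_trans _ _ (\sum_(i <- [seq i <- primes n | (i <= N)%N]) Num.max 0 (lnfactor R i))).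
    by apply: ler_sum => p _; rewrite le_max lexx orbT.
  apply: (@le_trans _ _ (\sum_(i <- [seq x <- index_iota 0 N.+1 | prime x]) Num.max 0 (lnfactor R i))).
    apply: ler_sum_sub => [|||x].
    - by rewrite filter_uniq // primes_uniq.
    - by rewrite filter_uniq // iota_uniq.
    - move=> p; rewrite !mem_filter mem_index_iota ltnS => /andP[-> /(allP pp) ->] //.
    - by rewrite le_max lexx.
  rewrite !big_seq; apply: ler_sum => p; rewrite mem_filter => /andP[p_pr _].
  by have /andP[h _] := lnfactor_le (prime_gt1 p_pr); rewrite ge_max h lexx.
rewrite -big_filter; set s := [seq _ <- _ | _].
have sN p : p \in s -> (N < p)%N by rewrite mem_filter ltnNge => /andP[].
have sp p : p \in s -> prime p by rewrite mem_filter => /andP[_ /(allP pp)].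
apply: (@le_trans _ _ (\sum_(p <- s) N%:R^-1)).
  rewrite !big_seq; apply: ler_sum => p ps.
  have /andP[_ h] := lnfactor_le (prime_gt1 (sp p ps)).
  apply: le_trans h _; rewrite lef_pV2 ?posrE //; last first.
    by rewrite subr_gt0 ltr1n prime_gt1 // sp.
  by rewrite lerBrDr natr1 ler_nat sN.
rewrite big_const_seq count_predT iter_addr_0 -[_ *+ size s]mulr_natl.
rewrite invfM mulrCA mulrC ler_pM2l ?invr_gt0 //.
have lN : 0 < L N.+1 by rewrite lnn_gt0.
rewrite ler_pdivlMr //; apply: le_trans nN.
rewrite -lnnX // ler_lnn ?expn_gt0 //.
apply: leq_trans (_ : \prod_(p <- s) p <= _)%N; last first.
  apply: dvdn_leq => //; apply: prod_primes_dvd.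
  - by rewrite filter_uniq // primes_uniq.
  - by apply/allP.
  - by move=> p; rewrite mem_filter mem_primes => /andP[_ /and3P[]].
elim: (s) sN => [|p t IH] sN; first by rewrite big_nil.
rewrite big_cons expnS leq_mul ?sN ?mem_head // IH // => q qt.
by rewrite sN // in_cons qt orbT.
Qed.

Lemma cvgn_pinfty_nat (u : nat -> nat) :
  (forall K, \forall n \near \oo, (K <= u n)%N) -> u @ \oo --> \oo.
Proof.
move=> H A [K _ HK]; have := H K; apply: filterS => n Kn.
exact: HK.
Qed.

Lemma cvgn_lnln : ln (L n) @[n --> \oo] --> +oo.
Proof.
apply/cvgryPge => A; near=> n.
have H : expR A <= L n by near: n; apply: (cvgryPge _).1; exact: cvgn_lnn.
by rewrite -ler_expR lnK // posrE (lt_le_trans (expR_gt0 A)).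
Unshelve. all: by end_near. Qed.

Lemma cvg_gronwall_bound :
  expR (Bsum R N + N.+1%:R / (N%:R * L N.+1)) / L N @[N --> \oo] --> expR (euler_gamma R).
Proof.
have c1 : N.+1%:R / (N%:R * L N.+1) @[N --> \oo] --> (0 : R).
  apply: (@cvg_squeeze0 _ _ (fun N => 2 * (L N.+1)^-1)).
    near=> N.
    have N0 : (0 < N)%N by near: N; exact: nbhs_infty_gt.
    have N0' : 0 < N%:R :> R by rewrite ltr0n.
    have l0 : 0 < L N.+1 by rewrite lnn_gt0.
    rewrite ger0_norm; last by rewrite divr_ge0 // mulr_ge0 // ltW.
    rewrite invfM mulrA ler_pM2r ?invr_gt0 // ler_pdivrMr //.
    by rewrite -natrM ler_nat; lia.
  rewrite -(mulr0 2); apply: cvgM; first exact: cvg_cst.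
  by apply: (@cvg_seqS _ (fun n => (L n)^-1)); exact: cvgn_invlnn.
have c2 : (Bsum R N - ln (L N)) + N.+1%:R / (N%:R * L N.+1) @[N --> \oo] --> (euler_gamma R + 0 : R).
  by apply: cvgD c1; exact: mertens3.
rewrite addr0 in c2.
have c3 : expR ((Bsum R N - ln (L N)) + N.+1%:R / (N%:R * L N.+1)) @[N --> \oo] --> expR (euler_gamma R).
  by apply: (cvg_comp _ _ c2); apply: continuous_expR.
apply: cvg_near_eq c3; near=> N.
have N0 : (1 < N)%N by near: N; exact: nbhs_infty_gt.
rewrite addrAC expRB lnK // posrE lnn_gt0 //.
Unshelve. all: by end_near. Qed.

Lemma gronwall_upper (eps : R) : 0 < eps -> \forall n \near \oo,
  (sigma n)%:R / (n%:R * ln (L n)) <= expR (euler_gamma R) + eps.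
Proof.
(* With the integer part of [ln n] as cutoff, [gronwall_upper_N] applies and
   [ln (N n) <= ln (ln n)]. *)
move=> eps0; pose N n := Num.truncn (L n).
have cN : N @ \oo --> \oo.
  apply: cvgn_pinfty_nat => K; near=> n.
  rewrite truncn_ge_nat ?lnn_ge0 //.
  by near: n; apply: (cvgryPge _).1; exact: cvgn_lnn.
have H := cvg_comp _ _ cN cvg_gronwall_bound.
have E : expR (euler_gamma R) < expR (euler_gamma R) + eps by rewrite ltrDl.
have H2 : \forall n \near \oo, expR (Bsum R (N n) + (N n).+1%:R / ((N n)%:R * L (N n).+1)) / L (N n) <= expR (euler_gamma R) + eps.
  by apply: (cvgr_le _ H).
have N2' : \forall n \near \oo, (1 < N n)%N := cN _ (nbhs_infty_gt 1).
near=> n.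
have h : expR (Bsum R (N n) + (N n).+1%:R / ((N n)%:R * L (N n).+1)) / L (N n) <= expR (euler_gamma R) + eps.
  by near: n.
apply: le_trans h => /=.
have n0 : (0 < n)%N by near: n; exact: nbhs_infty_gt.
have N2 : (1 < N n)%N by near: n.
have /andP[t1 t2] := truncn_itv (lnn_ge0 R n); rewrite -/(N n) in t1 t2.
have l1 : 0 < L (N n) by rewrite lnn_gt0.
have l2 : L (N n) <= ln (L n) by rewrite ler_lnS // ltr0n ltnW.
rewrite invfM mulrA; apply: ler_pM.
- by rewrite divr_ge0.
- by rewrite invr_ge0 (le_trans (ltW l1)).
- by apply: gronwall_upper_N => //; [exact: ltnW|exact: ltW].
- by rewrite lef_pV2 ?posrE // (lt_le_trans l1).
Unshelve. all: by end_near. Qed.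

Lemma primepow_prodE N K : primepow_prod N K = ((\prod_(0 <= p < N.+1 | prime p) p) ^ K)%N.
Proof.
rewrite /primepow_prod; elim: N.+1 => [|M IH]; first by rewrite !big_geq // exp1n.
rewrite big_mkcond [in RHS]big_mkcond !big_nat_recr //= -!big_mkcond /= IH expnMn.
by case: ifP => // _; rewrite exp1n.
Qed.

Lemma primepow_prod_ge N K : (1 < N)%N -> (2 ^ K <= primepow_prod N K)%N.
Proof.
move=> N1; rewrite primepow_prodE; case: K => // K; rewrite leq_exp2r //.
rewrite -big_filter; apply: dvdn_leq.
  by rewrite big_seq; apply: prodn_cond_gt0 => p; rewrite mem_filter => /andP[/prime_gt0].
have H : 2%N \in [seq i <- index_iota 0 N.+1 | prime i].
  by rewrite mem_filter mem_index_iota /= ltnS.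
by rewrite (big_rem _ H) /= dvdn_mulr.
Qed.

(* Any prime bound [N] and exponent [K] with [N = o(2 ^ K)] and
   [ln K = o(ln N)] would do in [primepow_prod N K]. *)
Definition gronwall_bound m := (2 ^ (m ^ 2))%N.
Definition gronwall_seq m := primepow_prod (gronwall_bound m) (2 * m ^ 2).

(** [primepow_ge] with [c = N^-2]: as [p >= 2], the power [p ^ (2 m^2 + 1)] is at least
    [2 ^ (2 m^2) = N ^ 2]. *)
Lemma sigma_primepow_ge m (N := gronwall_bound m) (n := gronwall_seq m) :
  (1 - N%:R^-1) * expR (Bsum R N) <= (sigma n)%:R / n%:R.
Proof.
rewrite sigma_divE ?primepow_prod_gt0 //.
have N0 : 0 < N%:R :> R by rewrite ltr0n expn_gt0.
have -> : expR (Bsum R N) = \prod_(0 <= p < N.+1 | prime p) (1 - inv_ p)^-1.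
  rewrite /Bsum -[X in expR X]big_filter expR_lnfactor_sum ?filter_all //.
  by rewrite big_filter.
have -> : N%:R^-1 = N%:R * (N%:R ^+ 2)^-1 :> R by field; rewrite gt_eqF.
apply: primepow_ge; [exact: invn_completely_mult|exact: invn_ge0|exact: invn_lt1| |].
  move=> p pp; have p0 := prime_gt0 pp.
  rewrite /inv_ exprVn lef_pV2 ?posrE ?exprn_gt0 ?ltr0n ?expn_gt0 //.
  rewrite -!natrX ler_nat -expnM mulnC (leq_trans (_ : _ <= 2 ^ (2 * m ^ 2).+1)%N) ?leq_exp2l //.
  by rewrite leq_exp2r // prime_gt1.
rewrite invf_le1 ?exprn_gt0 // -natrX ler1n expn_gt0 expn_gt0 //.
Qed.

(** By [primorial_le], [n <= 4 ^ (2 m^2 N)], so [ln n <= (2 m)^2 N]. The logarithm of [(2 m)^2] is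
    at most [4 m]. *)
Lemma lnln_primepow_le m (N := gronwall_bound m) (n := gronwall_seq m) : (0 < m)%N ->
  ln (L n) <= L N + 4 * m%:R.
Proof.
move=> m0.
have n2 : (1 < n)%N.
  apply: leq_trans (primepow_prod_ge _ _); first by rewrite -{1}(expn0 2) ltn_exp2l // muln_gt0 expn_gt0 m0.
  by rewrite -{1}(expn0 2) ltn_exp2l // expn_gt0 m0.
have H : L n <= ((2 * m) ^ 2 * N)%N%:R.
  apply: le_trans (_ : L (4 ^ (N * (2 * m ^ 2)))%N <= _).
    rewrite ler_lnn // ?(ltnW n2) // /n /gronwall_seq primepow_prodE (expnM 4) leq_exp2r ?primorial_le //.
    by rewrite muln_gt0 expn_gt0 m0.
  rewrite lnnX // (_ : 4%N = (2 ^ 2)%N) // lnnX //.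
  have h : L 2 <= 1 by have := ln_leB1 (ltr0Sn R 1); lra.
  have -> : ((2 * m) ^ 2 * N)%N%:R = (N * (2 * m ^ 2))%N%:R * 2%:R :> R.
    by rewrite -natrM; congr (_%:R); ring.
  by rewrite ler_wpM2l // ler_piMr.
apply: le_trans (_ : L ((2 * m) ^ 2 * N)%N <= _).
  by rewrite ler_lnS // lnn_gt0.
rewrite lnnM ?expn_gt0 ?muln_gt0 ?m0 // addrC lerD2l lnnX ?muln_gt0 ?m0 //.
have := ln_leB1 (_ : 0 < (2 * m)%N%:R :> R); rewrite ltr0n muln_gt0 m0 => /(_ isT).
have -> : 4 * m%:R = 2 * (2 * m)%N%:R :> R by rewrite natrM; ring.
by move: (L (2 * m)%N) ((2 * m)%N%:R : R) => a b; lra.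
Qed.

Lemma gronwall_lower (eps : R) k : 0 < eps -> exists2 n, (k <= n)%N &
  expR (euler_gamma R) - eps <= (sigma n)%:R / (n%:R * ln (L n)).
Proof.
move=> eps0; pose N := gronwall_bound; pose n := gronwall_seq.
have mN m : (m <= N m)%N.
  apply: leq_trans (ltnW (ltn_expl _ (ltnSn 1))) _.
  rewrite /N /gronwall_bound leq_exp2l //; nia.
have cN : N @ \oo --> \oo.
  apply: cvgn_pinfty_nat => K; near=> m; apply: leq_trans (mN m).
  by near: m; exact: nbhs_infty_ge.
have c1 : expR (Bsum R N) / L N @[N --> \oo] --> expR (euler_gamma R).
  have c3 : expR (Bsum R N - ln (L N)) @[N --> \oo] --> expR (euler_gamma R).
    by apply: (cvg_comp _ _ (@mertens3 R)); apply: continuous_expR.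
  apply: cvg_near_eq c3; near=> N0.
  by rewrite expRB lnK // posrE lnn_gt0 //; near: N0; exact: nbhs_infty_gt.
have c2 := cvg_comp _ _ cN c1.
have c3 := cvg_comp _ _ cN (@cvgn_invn R).
have l2 : 0 < L 2 by rewrite lnn_gt0.
(* The error [4 m] of [lnln_primepow_le] is negligible against [ln N = m^2 ln 2]. *)
have lN m : L (N m) = m%:R ^+ 2 * L 2 by rewrite /N /gronwall_bound lnnX // natrX.
have c4 : (1 + 4 * m%:R^-1 / L 2)^-1 @[m --> \oo] --> ((1 + 4 * 0 / L 2)^-1 : R).
  apply: cvgV; first by rewrite mulr0 mul0r addr0 oner_neq0.
  apply: cvgD; first exact: cvg_cst.
  apply: cvgM; last exact: cvg_cst.
  by apply: cvgM; [exact: cvg_cst|exact: cvgn_invn].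
have c5 : (1 - (N m)%:R^-1) * (expR (Bsum R (N m)) / L (N m)) * (1 + 4 * m%:R^-1 / L 2)^-1
    @[m --> \oo] --> ((1 - 0) * expR (euler_gamma R) * (1 + 4 * 0 / L 2)^-1 : R).
  apply: cvgM => //; apply: cvgM => //.
  by apply: cvgB; [exact: cvg_cst|exact: c3].
rewrite subr0 mul1r mulr0 mul0r addr0 invr1 mulr1 in c5.
have E : expR (euler_gamma R) - eps < expR (euler_gamma R) by rewrite gtrBl.
have H : \forall m \near \oo, expR (euler_gamma R) - eps <=
   (1 - (N m)%:R^-1) * (expR (Bsum R (N m)) / L (N m)) * (1 + 4 * m%:R^-1 / L 2)^-1.
  by apply: (cvgr_ge _ c5).
have [m [Hm km lm]] : exists m, [/\ expR (euler_gamma R) - eps <=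
   (1 - (N m)%:R^-1) * (expR (Bsum R (N m)) / L (N m)) * (1 + 4 * m%:R^-1 / L 2)^-1,
   (k < m)%N & 0 < ln (L (n m))].
  have nn : n @ \oo --> \oo.
    apply: cvgn_pinfty_nat => K; near=> m.
    have m0 : (0 < m)%N by near: m; exact: nbhs_infty_gt.
    apply: leq_trans (primepow_prod_ge _ _); last first.
      by rewrite -{1}(expn0 2) ltn_exp2l // expn_gt0 m0.
    apply: leq_trans (ltnW (ltn_expl _ (ltnSn 1))) _; rewrite leq_exp2l //.
    apply: leq_trans (_ : m <= _)%N; first by near: m; exact: nbhs_infty_ge.
    by rewrite -mulnn mulnA leq_pmull // muln_gt0 m0.
  have ln3 : \forall n0 \near \oo, 0 < ln (L n0) by apply: (cvgryPgt _).1; exact: cvgn_lnln.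
  have ln4 : \forall m \near \oo, 0 < ln (L (n m)) := nn _ ln3.
  apply: (@filter_ex _ \oo); near=> m; split; first by near: m.
    by near: m; exact: nbhs_infty_gt.
  by near: m.
have m0 : (0 < m)%N by apply: leq_ltn_trans km.
have m0' : 0 < m%:R :> R by rewrite ltr0n.
exists (n m).
  apply: leq_trans (ltnW km) _; apply: leq_trans (primepow_prod_ge _ _); last first.
    by rewrite -{1}(expn0 2) ltn_exp2l // expn_gt0 m0.
  apply: leq_trans (ltnW (ltn_expl _ (ltnSn 1))) _; rewrite leq_exp2l //.
  by rewrite -mulnn mulnA leq_pmull // muln_gt0 m0.
apply: le_trans Hm _.
have lNp : 0 < L (N m) by rewrite lN mulr_gt0 ?exprn_gt0.
have -> : (1 - (N m)%:R^-1) * (expR (Bsum R (N m)) / L (N m)) * (1 + 4 * m%:R^-1 / L 2)^-1 =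
    ((1 - (N m)%:R^-1) * expR (Bsum R (N m))) * (L (N m) + 4 * m%:R)^-1.
  rewrite mulrA -mulrA -invfM; congr (_ * _^-1).
  rewrite lN; field; by rewrite !gt_eqF.
rewrite [X in _ <= X](_ : _ = (sigma (n m))%:R / (n m)%:R * (ln (L (n m)))^-1); last first.
  by rewrite invfM mulrA.
apply: ler_pM.
- rewrite mulr_ge0 ?expR_ge0 // subr_ge0 invf_le1 ?ler1n ?ltr0n ?expn_gt0 //.
- by rewrite invr_ge0 addr_ge0 ?(ltW lNp) // mulr_ge0.
- exact: sigma_primepow_ge.
- by rewrite lef_pV2 ?posrE ?addr_gt0 ?mulr_gt0 // lnln_primepow_le.
Unshelve. all: by end_near. Qed.

End Gronwall.

(** * Limits superior and the size of the divisor function *)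

Section Limsup.
Variable R : realType.

Lemma limn_esup_eq (u : nat -> R) (l : R) :
  (forall eps, 0 < eps -> \forall n \near \oo, u n <= l + eps) ->
  (forall eps k, 0 < eps -> exists2 n, (k <= n)%N & l - eps <= u n) ->
  limn_esup (fun n => (u n)%:E) = l%:E.
Proof.
move=> up low; apply/eqP; rewrite eq_le; apply/andP; split.
  apply/lee_addgt0Pr => e e0; rewrite /limn_esup /limf_esup.
  apply: (@le_trans _ _ (ereal_sup [set (u n)%:E | n in [set n | u n <= l + e]])).
    by apply: ereal_inf_lbound; exists [set n | u n <= l + e] => //; exact: up.
  by apply: ub_ereal_sup => _ [n /= h <-]; rewrite -EFinD lee_fin.
apply: le_ereal_inf_tmp => _ [V [k _ kV] <-].
apply/lee_addgt0Pr => e e0; have [n kn hn] := low e k e0.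
rewrite -leeBlDr //; apply: (@le_trans _ _ (u n)%:E).
  by rewrite -EFinB lee_fin.
by apply: ereal_sup_ubound; exists n => //; exact: kV.
Qed.

Lemma ndiv_sq_small (eps : R) : 0 < eps ->
  \forall n \near \oo, (ndiv n)%:R ^+ 2 <= eps * n%:R.
Proof.
move=> e0; have := ndiv_cube; move: (8 ^ 8)%N => c Hc; near=> n.
have n0 : (0 < n)%N by near: n; exact: nbhs_infty_gt.
have n0' : 0 < n%:R :> R by rewrite ltr0n.
(* After cubing, the claim follows from [ndiv n ^ 6 <= c^2 n^2 <= eps^3 n^3]. *)
have big : c%:R ^+ 2 / eps ^+ 3 <= n%:R by near: n; exact: nbhs_infty_ger.
rewrite -(@ler_pXn2r _ 3) ?nnegrE ?exprn_ge0 ?mulr_ge0 ?(ltW e0) //.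
have -> : ((ndiv n)%:R ^+ 2) ^+ 3 = ((ndiv n ^ 3)%N%:R) ^+ 2 :> R.
  by rewrite natrX -!exprM.
apply: le_trans (_ : ((c * n)%N%:R) ^+ 2 <= _).
  by rewrite lerXn2r ?nnegrE // ler_nat Hc.
rewrite natrM !exprMn [n%:R ^+ 3]exprS mulrA ler_pM2r ?exprn_gt0 //.
by rewrite mulrC -ler_pdivrMr ?exprn_gt0.
Unshelve. all: by end_near. Qed.

End Limsup.

(** * Asymptotics of v and v1 *)

Section Asymptotics.
Variable R : realType.

Lemma ratio_bound (eps S Q d D V : R) : 0 < eps -> eps <= 1 -> 0 < S -> 0 < Q ->
  0 <= d -> 1 <= eps * Q -> 1 <= eps * S -> d ^+ 2 <= eps * S -> d <= eps * S ->
  D <= 2 * eps * S ->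
  Q * (Q - 1) * (S - d) <= 2 * V ->
  2 * V <= (Q ^+ 2 + Q) * (S + d ^+ 2) + 2 * ((Q ^+ 2 + Q) * d) + 2 * (Q ^+ 2 * D)
           + 2 * ((Q ^+ 2 + Q) * (1 + d)) ->
  `|V / (2^-1 * S * Q ^+ 2) - 1| <= 19 * eps.
Proof.
move=> e0 e1 S0 Q0 d0 eQ eS dS d1 DS low up.
have Q2 : 0 < Q ^+ 2 by rewrite exprn_gt0.
have SQ : 0 < S * Q ^+ 2 by rewrite mulr_gt0.
have -> : V / (2^-1 * S * Q ^+ 2) = 2 * V / (S * Q ^+ 2).
  by field; rewrite !gt_eqF.
have QQ : Q <= eps * Q ^+ 2 by rewrite expr2 mulrA ler_peMl // ltW.
rewrite ler_distl; apply/andP; split.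
  rewrite ler_pdivlMr //; apply: le_trans low.
  have h1 : Q * S <= eps * Q ^+ 2 * S by rewrite ler_pM2r.
  have h2 : Q ^+ 2 * d <= Q ^+ 2 * (eps * S) by rewrite ler_pM2l.
  have h3 : 0 <= Q * d by rewrite mulr_ge0 // ltW.
  have h4 : 0 <= eps * (S * Q ^+ 2) by rewrite mulr_ge0 // ltW.
  have E1 : Q * (Q - 1) * (S - d) = Q ^+ 2 * S - Q * S - Q ^+ 2 * d + Q * d by ring.
  have E2 : (1 - 19 * eps) * (S * Q ^+ 2) = Q ^+ 2 * S - 19 * (eps * (S * Q ^+ 2)) by ring.
  have E3 : eps * Q ^+ 2 * S = eps * (S * Q ^+ 2) by ring.
  have E4 : Q ^+ 2 * (eps * S) = eps * (S * Q ^+ 2) by ring.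
  rewrite E1 E2; rewrite E3 in h1; rewrite E4 in h2; lra.
rewrite ler_pdivrMr //; apply: le_trans up _.
have -> : (Q ^+ 2 + Q) * (S + d ^+ 2) + 2 * ((Q ^+ 2 + Q) * d) + 2 * (Q ^+ 2 * D)
   + 2 * ((Q ^+ 2 + Q) * (1 + d)) =
   (Q ^+ 2 + Q) * (S + d ^+ 2 + 4 * d + 2) + 2 * (Q ^+ 2 * D) by ring.
(* The 7 is 1 for [d ^+ 2], 4 for [4 * d] and 2 for the constant. Expanding gives
   [1 + 12 eps + 7 eps^2], at most [1 + 19 eps]. *)
apply: (@le_trans _ _ (((1 + eps) * Q ^+ 2) * (S + 7 * (eps * S)) + 2 * (Q ^+ 2 * (2 * eps * S)))).
  apply: lerD; last by rewrite ler_pM2l // ler_pM2l.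
  apply: ler_pM; rewrite ?addr_ge0 ?exprn_ge0 ?mulr_ge0 ?(ltW Q0) ?(ltW S0) //; lra.
have -> : ((1 + eps) * Q ^+ 2) * (S + 7 * (eps * S)) + 2 * (Q ^+ 2 * (2 * eps * S)) =
  S * Q ^+ 2 * (1 + 12 * eps + 7 * (eps * eps)) by ring.
rewrite mulrC ler_pM2r //.
have : eps * eps <= eps by rewrite ler_piMl // ltW.
lra.
Qed.

Lemma sigma_ge n : (0 < n)%N -> (n <= sigma n)%N.
Proof.
by move=> n0; rewrite /sigma (big_rem _ (divisors_id n0)) /= leq_addr.
Qed.

Variables (p : nat) (hp : prime p) (Q : nat -> nat).
Hypothesis hQ : forall n, (0 < n)%N -> Q n = (p ^ n)%N.
Variable V : nat -> nat.
Hypothesis V_ge : forall n, (0 < n)%N ->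
  (Q n * (Q n).-1 * (sigma n - ndiv n) <= 2 * V n)%N.
Hypothesis V_le : forall n, (0 < n)%N ->
  (2 * V n <= (Q n ^ 2 + Q n) * (sigma n + ndiv n ^ 2)
    + 2 * ((Q n ^ 2 + Q n) * ndiv n) + 2 * (Q n ^ 2 * ndiv (2 * n))
    + 2 * ((Q n ^ 2 + Q n) * (1 + ndiv n)))%N.

Lemma cvg_ratio :
  (V n)%:R / (2^-1 * (sigma n)%:R * (Q n)%:R ^+ 2) @[n --> \oo] --> (1 : R).
Proof.
apply/cvgrPdist_le => e' e'0.
pose eps : R := Num.min 1 (e' / 19).
have eps0 : 0 < eps by rewrite lt_min ltr01 divr_gt0.
have eps1 : eps <= 1 by rewrite ge_min lexx.
have epse : 19 * eps <= e'.
  by rewrite mulrC -ler_pdivlMr // ge_min lexx orbT.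
have H1 := ndiv_sq_small eps0.
have H2 : \forall n \near \oo, (ndiv (2 * n))%:R ^+ 2 <= eps * (2 * n)%:R :> R.
  have [N _ HN] := H1; exists N => // n /= Nn; apply: HN => /=; lia.
near=> n; rewrite distrC; apply: le_trans epse.
have n0 : (0 < n)%N by near: n; exact: nbhs_infty_gt.
have nS : n%:R <= (sigma n)%:R :> R by rewrite ler_nat sigma_ge.
have n0' : 0 < n%:R :> R by rewrite ltr0n.
have Qn : Q n = (p ^ n)%N by exact: hQ.
have nQ : (n <= Q n)%N by rewrite Qn ltnW // ltn_expl // prime_gt1.
have Q0 : (0 < Q n)%N by rewrite (leq_trans n0).
have en : 1 <= eps * n%:R.
  rewrite mulrC -ler_pdivrMr // mul1r; near: n; exact: nbhs_infty_ger.
have dn : (ndiv n)%:R ^+ 2 <= eps * n%:R :> R by near: n.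
have d2n : (ndiv (2 * n))%:R ^+ 2 <= eps * (2 * n)%:R :> R by near: n.
have enS : eps * n%:R <= eps * (sigma n)%:R by rewrite ler_pM2l.
have sq k : k%:R <= k%:R ^+ 2 :> R by rewrite -natrX ler_nat; nia.
apply: (@ratio_bound eps _ _ (ndiv n)%:R (ndiv (2 * n))%:R) => //.
- exact: lt_le_trans nS.
- by rewrite ltr0n.
- by apply: le_trans en _; rewrite ler_pM2l // ler_nat.
- exact: le_trans enS.
- exact: le_trans enS.
- exact: le_trans (sq _) (le_trans dn enS).
- apply: le_trans (sq _) (le_trans d2n _).
  by rewrite natrM mulrCA mulrA ler_pM2l // mulr_gt0.
- have := V_ge n0; rewrite -(ler_nat R) !natrM -subn1 natrB //; apply: le_trans.
  apply: ler_wpM2l; first by rewrite mulr_ge0 // subr_ge0 ler1n.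
  (* The subtraction in [V_ge] is truncated; where it yields 0 the real difference is negative. *)
  case: (leqP (ndiv n) (sigma n)) => h; first by rewrite natrB.
  by rewrite (le_trans _ (ler0n _ _)) // subr_le0 ler_nat ltnW.
- by have := V_le n0; rewrite -(ler_nat R) !(natrM, natrD, natrX).
Unshelve. all: by end_near. Qed.

(** The quotient is half the product of [r], which tends to 1, and of Gronwall's quotient [s]. *)
Lemma limsup_ratio :
  limn_esup (fun n => ((V n)%:R / (p%:R ^+ (2 * n) * n%:R * ln (ln n%:R)))%:E)
    = (2^-1 * expR (euler_gamma R))%:E.
Proof.
pose r n : R := (V n)%:R / (2^-1 * (sigma n)%:R * (Q n)%:R ^+ 2).
pose s n : R := (sigma n)%:R / (n%:R * ln (ln n%:R)).
set G := expR (euler_gamma R); have G0 : 0 < G by exact: expR_gt0.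
have E n : (0 < n)%N -> (V n)%:R / (p%:R ^+ (2 * n) * n%:R * ln (ln n%:R)) = 2^-1 * (r n * s n).
  move=> n0; have sn0 : (sigma n)%:R != 0 :> R.
    by rewrite pnatr_eq0 -lt0n (leq_trans n0) // sigma_ge.
  have Q0 : (Q n)%:R != 0 :> R by rewrite pnatr_eq0 hQ // -lt0n expn_gt0 prime_gt0.
  rewrite /r /s mulnC exprM -natrX -hQ // -mulrA invfM (invfM n%:R).
  by move: (n%:R^-1) ((ln (ln n%:R))^-1) => a b; field; rewrite sn0 Q0.
have r0 n : 0 <= r n by rewrite divr_ge0 // !mulr_ge0 // ?invr_ge0 // exprn_ge0.
(* Such an [h] satisfies [(1 + h) (G + h) <= G + eps] and [G - eps <= (1 - h) (G - h)], with both
   factors of the latter nonnegative. *)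
have eta (eps : R) : 0 < eps -> exists eta : R, [/\ 0 < eta, eta <= 1, eta <= G & eta * (G + 2) <= eps].
  move=> eps0; have G2 : 0 < G + 2 by lra.
  exists (Num.min 1 (Num.min G (eps / (G + 2)))); split.
  - by rewrite !lt_min ltr01 G0 divr_gt0.
  - by rewrite ge_min lexx.
  - by rewrite !ge_min lexx orbT.
  - by rewrite -ler_pdivlMr // !ge_min lexx !orbT.
have cr := cvg_ratio.
apply: limn_esup_eq => [eps eps0|eps k eps0]; have [h [h0 h1 hG he]] := eta eps eps0.
  have H1 : \forall n \near \oo, s n <= G + h by exact: gronwall_upper.
  have H2 : \forall n \near \oo, r n <= 1 + h by apply: (cvgr_le _ cr); rewrite ltrDl.
  near=> n; have n0 : (0 < n)%N by near: n; exact: nbhs_infty_gt.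
  rewrite E //.
  have sn : s n <= G + h by near: n.
  have rn : r n <= 1 + h by near: n.
  have : r n * s n <= (1 + h) * (G + h).
    apply: le_trans (_ : r n * (G + h) <= _); first by rewrite ler_wpM2l.
    by rewrite ler_wpM2r // addr_ge0 // ltW.
  have -> : (1 + h) * (G + h) = G + h * (G + 2) - h * (1 - h) by ring.
  have : 0 <= h * (1 - h) by rewrite mulr_ge0 ?(ltW h0) // subr_ge0.
  move: (r n * s n) (h * (1 - h)) (h * (G + 2)) he => a b c; lra.
have H2 : \forall n \near \oo, 1 - h <= r n by apply: (cvgr_ge _ cr); rewrite gtrBl.
have [N _ HN] := H2.
have [n kn sn] := @gronwall_lower R h (maxn k N.+1) h0.
exists n; first by apply: leq_trans kn; exact: leq_maxl.
have Nn : (N.+1 <= n)%N by apply: leq_trans kn; exact: leq_maxr.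
rewrite E; last by apply: leq_ltn_trans Nn.
have rn : 1 - h <= r n by apply: HN => /=; exact: ltnW.
rewrite -/(s n) -/G in sn.
have s0 : 0 <= s n by apply: le_trans sn; rewrite subr_ge0.
have : (1 - h) * (G - h) <= r n * s n.
  by apply: ler_pM => //; rewrite subr_ge0.
have -> : (1 - h) * (G - h) = G - h * (G + 2) + h + h * h by ring.
have : 0 <= h * h by rewrite mulr_ge0 // ltW.
move: (r n * s n) (h * h) (h * (G + 2)) he => a b c; lra.
Unshelve. all: by end_near. Qed.

End Asymptotics.

Theorem corollary24 (R : realType) (p : nat) (hp : prime p)
    (F : nat -> finFieldType)
    (hF : forall n : nat, (0 < n)%N -> #|F n| = (p ^ n)%N) :
  [/\ (v 'M[F n]_2)%:R / (2^-1 * (sigma n)%:R * #|F n|%:R ^+ 2)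
        @[n --> \oo] --> (1 : R),
      (v1 'M[F n]_2)%:R / (2^-1 * (sigma n)%:R * #|F n|%:R ^+ 2)
        @[n --> \oo] --> (1 : R),
      limn_esup (fun n : nat =>
          ((v 'M[F n]_2)%:R / (p%:R ^+ (2 * n) * n%:R * ln (ln n%:R)))%:E)
        = (2^-1 * expR (euler_gamma R))%:E
    & limn_esup (fun n : nat =>
          ((v1 'M[F n]_2)%:R / (p%:R ^+ (2 * n) * n%:R * ln (ln n%:R)))%:E)
        = (2^-1 * expR (euler_gamma R))%:E].
Proof.
have v1g n (n0 : (0 < n)%N) := v1_ge hp n0 (hF n n0).
have vg n (n0 : (0 < n)%N) := v_ge hp n0 (hF n n0).
have v1l n (n0 : (0 < n)%N) := v1_le hp n0 (hF n n0).
have vl n (n0 : (0 < n)%N) := v_le hp n0 (hF n n0).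
(* The bound for [v1] is weakened by the summand that noninvertible matrices add for [v], so that
   both counts fit the same estimate. *)
have v1u n : (0 < n)%N -> (2 * v1 'M[F n]_2 <= (#|F n| ^ 2 + #|F n|) * (sigma n + ndiv n ^ 2)
    + 2 * ((#|F n| ^ 2 + #|F n|) * ndiv n) + 2 * (#|F n| ^ 2 * ndiv (2 * n))
    + 2 * ((#|F n| ^ 2 + #|F n|) * (1 + ndiv n)))%N.
  by move=> n0; apply: leq_trans (v1l n n0) (leq_addr _ _).
have vu n : (0 < n)%N -> (2 * v 'M[F n]_2 <= (#|F n| ^ 2 + #|F n|) * (sigma n + ndiv n ^ 2)
    + 2 * ((#|F n| ^ 2 + #|F n|) * ndiv n) + 2 * (#|F n| ^ 2 * ndiv (2 * n))
    + 2 * ((#|F n| ^ 2 + #|F n|) * (1 + ndiv n)))%N.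
  move=> n0; apply: leq_trans (leq_mul (leqnn 2) (vl n n0)) _.
  by rewrite (mulnDr 2) leq_add2r v1l.
split.
- exact: (@cvg_ratio R p hp (fun n => #|F n|) hF (fun n => v 'M[F n]_2) vg vu).
- exact: (@cvg_ratio R p hp (fun n => #|F n|) hF (fun n => v1 'M[F n]_2) v1g v1u).
- exact: (@limsup_ratio R p hp (fun n => #|F n|) hF (fun n => v 'M[F n]_2) vg vu).
- exact: (@limsup_ratio R p hp (fun n => #|F n|) hF (fun n => v1 'M[F n]_2) v1g v1u).
Qed.
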